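(* Let $(X,Y,\langle\cdot,\cdot\rangle)$ be a dual pair of normed vector spaces such that $|\langle x,y\rangle|\le\|x\|\,\|y\|$ for all $x\in X$, $y\in Y$, and such that $\{x\in X:\|x\|\le1\}$ is $\sigma(X,Y)$-closed and $\{y\in Y:\|y\|\le1\}$ is $\sigma(Y,X)$-closed. Let $f:X\to\overline{R}$ be lower semi-continuous. Then there exists a conditionally lower semi-continuous function $\mathbf{f_c}:\mathbf{X_c}\to\overline{\mathbf{R}}$ such that $f_c(x)=f(x)$ for all $x\in X$. Moreover, if $f$ is proper convex, then $\mathbf{f_c}$ is conditionally proper convex (that is, there is a conditionally lower semi-continuous extension of $f$ which is conditionally proper convex).
   Context: Fix a complete non-degenerate Boolean algebra $\mathcal{A}=(\mathcal{A},\wedge,\vee,{}^c,0,1)$, with $a\le b$ iff $a\wedge b=a$. A partition is a family $(a_i)$ in $\mathcal{A}$ with $a_i\wedge a_j=0$ for $i\ne j$ and $\vee a_i=1$ (entries may be $0$). Conditional sets. A conditional set of a non-empty set $X$ and $\mathcal{A}$ is a collection $\mathbf{X}$ of objects $x|a$ ($x\in X$, $a\in\mathcal{A}$) such that (C1) $x|b=y|a$ implies $a=b$; (C2) $x|b=y|b$ and $a\le b$ imply $x|a=y|a$; (C3) for each partition $(a_i)$ and each family $(x_i)$ in $X$ there is a unique $x\in X$ with $x|a_i=x_i|a_i$ for all $i$; it is written $x=\sum x_i|a_i$ (concatenation). A conditional set is written in bold and the underlying set inducing it in plain type; conditional elements of $\mathbf{X}$ correspond to elements of $X$. Products carry componentwise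 concatenation. A function $f:X\to Y$ between sets inducing conditional sets is stable if $f(\sum x_i|a_i)=\sum f(x_i)|a_i$; conditional functions $\mathbf{f}:\mathbf{X}\to\mathbf{Y}$ are those induced by stable functions. Step functions. For a non-empty set $E$, $E_s$ is the set of families $(x_i,a_i)$ in $E\times\mathcal{A}$ with $(a_i)$ a partition, where $(x_i,a_i)$ and $(y_j,b_j)$ are identified if $\vee\{a_i:x_i=z\}=\vee\{b_j:y_j=z\}$ for all $z\in E$; two classes agree on $a$ if these identities hold after meeting both sides with $a$. $E_s$ induces a conditional set, elements are written $\sum x_i|a_i$, and $E$ is embedded as the constants $x|1$. Conditional real numbers. On $\mathbb{R}_s$: $\sum x_i|a_i\leqslant\sum y_j|b_j$ (resp. $<$) iff $x_i\le y_j$ (resp. $x_i<y_j$) whenever $a_i\wedge b_j>0$; sum, product and absolute value are taken pointwise on the common refinement. $\mathbb{N}_s\subseteq\mathbb{R}_s$ carries the inherited order. A conditional sequence in $\mathbf{X}$ is a stable function $\mathbb{N}_s\to X$, $n\mapsto x_n$. The conditional real numbers $\mathbf{R}$ are induced by the set $R$ of conditional Cauchy sequences $(x_n)$ in $\mathbb{R}_s$ (for every $r\in\mathbb{R}_s$, $r>0$, there is $n_0\in\mathbb{N}_s$ with $|x_m-x_n|<r$ for all $m,n\geqslant n_0$), with $(x_n),(y_n)$ identified if $|x_n-y_n|$ converges to $0$ (for every $r\in\mathbb{R}_s$, $r>0$, there is $n_0\in\mathbb{N}_s$ with $|x_n-y_n|<r$ for all $n\geqslant n_0$; agreement on $a$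 is the same condition with the inequality required on $a$ only). Operations, absolute value and concatenations are defined representative-wise. $[(x_n)]\leqslant[(y_n)]$ iff for all $r\in\mathbb{R}_s$, $r>0$, there is $n\in\mathbb{N}_s$ with $y_m-x_m>-r$ for all $m\geqslant n$; $[(x_n)]<[(y_n)]$ iff there are $r\in\mathbb{R}_s$, $r>0$, and $n\in\mathbb{N}_s$ with $y_m-x_m>r$ for all $m\geqslant n$. $R_+=\{x\in R:x\geqslant0\}$, $R_{++}=\{x\in R:x>0\}$, $\mathbb{R}\subseteq\mathbb{R}_s\subseteq R$; $(R,\leqslant)$ is Dedekind complete. Conditional extended reals. $\overline{\mathbf{R}}$, induced by $\overline{R}$, is the conditional completion of $\overline{\mathbb{R}}=\mathbb{R}\cup\{\pm\infty\}$ (conditional Cauchy sequences in $\overline{\mathbb{R}}_s$ modulo distance tending to $0$, for the step-function version of the metric $|\arctan x-\arctan y|$). Every $x\in\overline{R}$ is of the form $x=\infty|a+r|b+(-\infty)|c$ with $(a,b,c)$ a partition and $r\in R$, so $R\subseteq\overline{R}$; order and arithmetic extend those of $R$ with the usual conventions for $\pm\infty$ on each piece (and $0\cdot(\pm\infty)=0$). $\overline{R}$ is a complete lattice. $-\infty<x$ means $x|a\ne-\infty|a$ for every $a>0$. Conditional completion of a normed space. For a normed space $X$, $X_s$ carries the pointwise operations and the norm $\|\sum x_i|a_i\|_s=\sum\|x_i\||a_i\in\mathbb{R}_s$. $X_c$ is the set of conditional Cauchy sequences in $X_s$ (with respect to $\|\cdot\|_s$, in the same sense as for $\mathbb{R}_s$)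 modulo $\|x_n-y_n\|_s\to0$; it induces the conditional completion $\mathbf{X_c}$, with representative-wise operations, $R$-scalar multiplication and concatenation, and norm $\|[(x_n)]\|_c=\lim_n\|x_n\|_s\in R_+$. One identifies $X\subseteq X_s\subseteq X_c$ via constants. Similarly for $Y$. The pairing extends to the stable $R$-bilinear form $\langle[(x_n)],[(y_n)]\rangle_c=\lim_n\langle x_n,y_n\rangle_s$ on $X_c\times Y_c$, where $\langle\sum x_i|a_i,\sum y_j|b_j\rangle_s=\sum\langle x_i,y_j\rangle|a_i\wedge b_j$. Weak neighbourhoods. For $x\in X_c$, $\mathcal{V}(x)$ is the collection of all sets $V=\{z\in X_c: |\langle z-x,y_l\rangle_c|\leqslant r\text{ for all }l\in\mathbb{N}_s\text{ with }1\leqslant l\leqslant n\}$, where $r\in R_{++}$, $n\in\mathbb{N}_s$, and $(y_l)_{1\leqslant l\leqslant n}$ is a conditionally finite family in $Y_c$, i.e. a stable function $\{l\in\mathbb{N}_s:1\leqslant l\leqslant n\}\to Y_c$. Functions $f:X\to\overline{R}$. Put $f_s:X_s\to\overline{R}$, $f_s(\sum x_i|a_i)=\sum f(x_i)|a_i$. $f$ is lower semi-continuous if $f(x)=\sup_{V\in\mathcal{V}(x)}\inf\{f_s(z):z\in V\cap X_s\}$ for all $x\in X$. $f$ is proper convex if $-\infty<f(x)$ for all $x\in X$, $f(x_0)\in R$ for at least one $x_0\in X$, and $f(\lambda x+(1-\lambda)y)\leqslant\lambda f(x)+(1-\lambda)f(y)$ for all $x,y\in X$ and real $0\le\lambda\le1$.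 Conditional functions $\mathbf{f}:\mathbf{X_c}\to\overline{\mathbf{R}}$ (induced by stable $f:X_c\to\overline{R}$). $\mathbf{f}$ is conditionally lower semi-continuous if $f(x)=\sup_{V\in\mathcal{V}(x)}\inf\{f(z):z\in V\}$ for all $x\in X_c$. $\mathbf{f}$ is conditionally proper convex if $-\infty<f(x)$ for all $x\in X_c$, $f(x_0)\in R$ for at least one $x_0\in X_c$, and $f(\lambda x+(1-\lambda)y)\leqslant\lambda f(x)+(1-\lambda)f(y)$ for all $x,y\in X_c$ and $\lambda\in R$ with $0\leqslant\lambda\leqslant1$. *)

(* Defs.v *)
From HB Require Import structures.
From mathcomp Require Import all_boot all_order all_algebra.
From mathcomp Require Import all_classical all_reals all_analysis.

Set Implicit Arguments.
Unset Strict Implicit.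
Unset Printing Implicit Defensive.

Import Order.TTheory Order.CTheory GRing.Theory Num.Theory.
Import numFieldNormedType.Exports.

Local Open Scope ring_scope.
Local Open Scope quotient_scope.

HB.mixin Record isCompleteBoolean d (T : Type) of Order.CTBDistrLattice d T := {
  bsup : set T -> T;
  bsup_ub : forall (S : set T) x, S x -> (x <= bsup S)%O;
  bsup_least : forall (S : set T) y,
    (forall x, S x -> (x <= y)%O) -> (bsup S <= y)%O;
  bot_neq_top : (\bot != \top :> T)%O }.

#[short(type="completeBooleanType")]
HB.structure Definition CompleteBoolean d :=
  { T of isCompleteBoolean d T & Order.CTBDistrLattice d T }.

Section Boolean.
Context {d : Order.disp_t} {A : completeBooleanType d}.
Implicit Types a b c : A.
Local Open Scope order_scope.

Definition is_partition (I : Type) (a : I -> A) : Prop :=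
  (forall i j, i <> j -> a i `&` a j = \bot) /\ bsup (range a) = \top.

Lemma le_bot_neq a b : a != \bot -> a <= b -> b != \bot.
Proof. by rewrite -!lt0x => a0; exact: lt_le_trans. Qed.

Lemma meet_bsup_neq0 a (S : set A) :
  a `&` bsup S != \bot -> exists2 s, S s & a `&` s != \bot.
Proof.
move=> H0; apply: contrapT => H; case/negP: H0; rewrite meetC Order.CTBDistrLatticeTheory.disj_leC.
apply: bsup_least => s Ss; rewrite -Order.CTBDistrLatticeTheory.disj_leC meetC.
by apply/negPn/negP => ?; apply: H; exists s.
Qed.

Lemma le_dense a b :
  (forall c, c != \bot -> c <= a -> c `&` b != \bot) -> a <= b.
Proof.
move=> H; have [/eqP|n0] := eqVneq (a `&` ~` b) \bot.
  by rewrite Order.CTBDistrLatticeTheory.disj_leC complK.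
have := H _ n0 (leIl _ _).
by rewrite -meetA meetCx meetx0 eqxx.
Qed.

Lemma partition_hit (I : Type) (a : I -> A) c : is_partition a ->
  c != \bot -> exists i, c `&` a i != \bot.
Proof.
move=> [_ sa] c0; have := @meet_bsup_neq0 c (range a).
by rewrite sa meetx1 => /(_ c0)[_ [i _ <-] ?]; exists i.
Qed.

Lemma partition_dense (I : Type) (a : I -> A) :
  (forall i j, i <> j -> a i `&` a j = \bot) ->
  (forall c, c != \bot -> exists i, c `&` a i != \bot) -> is_partition a.
Proof.
move=> H1 H2; split=> //; apply/eqP; rewrite -le1x; apply: le_dense => c c0 _.
have [i ci] := H2 _ c0; apply: le_bot_neq ci _.
by apply: leI2 => //; apply: bsup_ub; exists i.
Qed.

Lemma partition_sum (I J : Type) (a : I -> A) (b : I -> J -> A) :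
  is_partition a -> (forall i, is_partition (b i)) ->
  is_partition (fun ij : I * J => a ij.1 `&` b ij.1 ij.2).
Proof.
move=> pa pb; apply: partition_dense => [[i j] [k l] /= ne|c c0].
  have [ik|ik] := pselect (i = k); last first.
    by rewrite meetACA (pa.1 _ _ ik) meet0x.
  have [jl|jl] := pselect (j = l); last first.
    by rewrite meetACA ik ((pb k).1 _ _ jl) meetx0.
  by case: ne; rewrite ik jl.
have [i ci] := partition_hit pa c0; have [j cij] := partition_hit (pb i) ci.
by exists (i, j); rewrite meetA.
Qed.

Lemma partition_prod (I J : Type) (a : I -> A) (b : J -> A) :
  is_partition a -> is_partition b ->
  is_partition (fun ij : I * J => a ij.1 `&` b ij.2).
Proof. by move=> pa pb; apply: (partition_sum pa (fun=> pb)). Qed.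

Definition part2 a (i : bool) : A := if i then a else ~` a.

Lemma part2P a : is_partition (part2 a).
Proof.
split=> [[] [] //= _|]; rewrite ?meetxC ?meetCx//.
apply/eqP; rewrite -le1x -(joinxC a) leUx.
by rewrite !bsup_ub //; [exists false|exists true].
Qed.

Lemma partition1 : is_partition (fun _ : unit => \top : A).
Proof.
split=> [[] [] //|]; apply/eqP; rewrite -le1x; apply: bsup_ub.
by exists tt.
Qed.

End Boolean.

(* The object x|a is represented by the pair (x, a): [cagree a x y] means
   x|a = y|a, and x|a, y|b are different objects unless a = b (axiom C1). *)
HB.mixin Record isConditionalSet d (A : completeBooleanType d) (X : Type)
    of Pointed X := {
  cagree : A -> X -> X -> Prop;
  cagree_refl : forall a x, cagree a x x;
  cagree_sym : forall a x y, cagree a x y -> cagree a y x;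
  cagree_trans : forall a x y z, cagree a x y -> cagree a y z -> cagree a x z;
  cagree_le : forall a b x y, (a <= b)%O -> cagree b x y -> cagree a x y;
  cagree_concat : forall (I : Type) (a : I -> A) (x : I -> X), is_partition a ->
    exists! z, forall i, cagree (a i) z (x i) }.

#[short(type="condSetType")]
HB.structure Definition ConditionalSet d (A : completeBooleanType d) :=
  { X of isConditionalSet d A X & Pointed X }.

Arguments cagree {d A X} a x y : rename.
Arguments cagree_refl {d A X} a x : rename.
Arguments cagree_sym {d A X a x y} : rename.
Arguments cagree_trans {d A X a x y z} : rename.
Arguments cagree_le {d A X a b x y} : rename.
Arguments cagree_concat {d A X I a} x pa : rename.

Section ConditionalSetTheory.
Context {d : Order.disp_t} {A : completeBooleanType d}.
Implicit Types a b c : A.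

Definition concat {X : condSetType A} (I : Type) (a : I -> A) (x : I -> X) : X :=
  xget point [set z | forall i, cagree (a i) z (x i)]%classic.

Definition stable_on {X Y : condSetType A} (D : set X) (f : X -> Y) : Prop :=
  forall (I : Type) (a : I -> A) (x : I -> X), is_partition a ->
    (forall i, D (x i)) -> f (concat a x) = concat a (fun i => f (x i)).

Definition stable {X Y : condSetType A} (f : X -> Y) : Prop :=
  forall (I : Type) (a : I -> A) (x : I -> X), is_partition a ->
    f (concat a x) = concat a (fun i => f (x i)).

Lemma concatP {X : condSetType A} (I : Type) (a : I -> A) (x : I -> X) :
  is_partition a -> forall i, cagree (a i) (concat a x) (x i).
Proof.
move=> pa; rewrite /concat; case: xgetP => [z -> //|H].
by have [z [zP _]] := cagree_concat x pa; have := H z.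
Qed.

Lemma cagree_eq {X : condSetType A} (I : Type) (a : I -> A) (x y : X) :
  is_partition a -> (forall i, cagree (a i) x y) -> x = y.
Proof.
move=> pa xy; have [z [_ zu]] := cagree_concat (fun=> y) pa.
by rewrite -(zu x)// -(zu y)// => i; exact: cagree_refl.
Qed.

Lemma cagree_top {X : condSetType A} (x y : X) :
  cagree (\top%O : A) x y -> x = y.
Proof. by move=> xy; apply: (cagree_eq partition1). Qed.

Lemma cagree_parts {X : condSetType A} (I : Type) (a : I -> A) b (x y : X) :
  is_partition a -> (forall i, cagree (a i `&` b)%O x y) -> cagree b x y.
Proof.
move=> pa xy; pose w := concat (part2 b) (fun i => if i then x else y).
have wx : cagree b w x by apply: (concatP _ (part2P b) true).
have wy : cagree (~` b)%O w y by apply: (concatP _ (part2P b) false).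
suff <- : w = y by apply: cagree_sym.
apply: (cagree_eq (partition_prod pa (part2P b))) => -[i []] /=.
  by apply: cagree_trans (xy i); apply: cagree_le wx; apply: leIr.
by apply: cagree_le wy; apply: leIr.
Qed.

Lemma stable_cagree {X Y : condSetType A} (f : X -> Y) a x y :
  stable f -> cagree a x y -> cagree a (f x) (f y).
Proof.
move=> sf xy; pose g z (i : bool) := if i then z else x.
have e : concat (part2 a) (g x) = concat (part2 a) (g y).
  apply: (cagree_eq (part2P a)) => i.
  apply: (cagree_trans (concatP _ (part2P a) i)).
  apply: cagree_trans (cagree_sym (concatP _ (part2P a) i)).
  by case: i => //; apply: cagree_refl.
have fP z : cagree a (f (concat (part2 a) (g z))) (f z).
  by rewrite sf; [exact: (concatP _ (part2P a) true)|exact: part2P].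
by apply: cagree_trans (fP y); rewrite -e; apply/cagree_sym/fP.
Qed.

Lemma cagree_stable {X Y : condSetType A} (f : X -> Y) :
  (forall a x y, cagree a x y -> cagree a (f x) (f y)) -> stable f.
Proof.
move=> H I a x pa; apply: (cagree_eq pa) => i.
by apply: cagree_trans (cagree_sym (concatP _ pa i)); apply/H/concatP.
Qed.

End ConditionalSetTheory.

(* The class of a family (x_i, a_i) under the identification of step functions
   is the map z |-> sup {a_i | x_i = z}. Hence the quotient is the set of those
   maps E -> A that are themselves partitions indexed by E. *)
Section StepFunctions.
Context {d : Order.disp_t} (A : completeBooleanType d).

Record step (E : Type) := Step {
  step_val :> E -> A;
  step_partition : is_partition step_val }.

HB.instance Definition _ E := gen_eqMixin (step E).
HB.instance Definition _ E := gen_choiceMixin (step E).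

Definition family_val (E I : Type) (a : I -> A) (x : I -> E) (z : E) : A :=
  bsup [set a i | i in [set i | x i = z]]%classic.

Lemma family_val_hit (E I : Type) (a : I -> A) (x : I -> E) z c :
  (c `&` family_val a x z != \bot)%O ->
  exists2 i, x i = z & (c `&` a i != \bot)%O.
Proof. by move=> /meet_bsup_neq0[_ [i <- <-] ?]; exists i. Qed.

Lemma family_val_ge (E I : Type) (a : I -> A) (x : I -> E) i :
  (a i <= family_val a x (x i))%O.
Proof. by apply: bsup_ub; exists i. Qed.

Lemma family_val_partition (E I : Type) (a : I -> A) (x : I -> E) :
  is_partition a -> is_partition (family_val a x).
Proof.
move=> pa; apply: partition_dense => [y z yz|c c0].
  apply/eqP/negPn/negP => H; have [i iz] := family_val_hit H.
  rewrite meetC => H'; have [j jy] := family_val_hit H'.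
  have -> : (a i `&` a j = \bot)%O; last by rewrite eqxx.
  by apply: pa.1 => ij; apply: yz; rewrite -iz -jy ij.
have [i ci] := partition_hit pa c0; exists (x i).
by apply: le_bot_neq ci _; apply: leI2 => //; apply: family_val_ge.
Qed.

Definition step_of (E I : Type) (a : I -> A) (x : I -> E)
  (pa : is_partition a) : step E := Step (family_val_partition x pa).

Definition step_const (E : Type) (x : E) : step E :=
  step_of (fun _ : unit => x) partition1.

Definition step_map (E F : Type) (h : E -> F) (p : step E) : step F :=
  step_of h (step_partition p).

Definition step_map2 (E F G : Type) (h : E -> F -> G) (p : step E) (q : step F) :
  step G :=
  step_of (fun xy => h xy.1 xy.2)
    (partition_prod (step_partition p) (step_partition q)).

Definition step_rel_on (E F : Type) (a : A) (rho : E -> F -> Prop)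
    (p : step E) (q : step F) : Prop :=
  forall x y, (a `&` (p x `&` q y) != \bot)%O -> rho x y.

Definition step_agree (E : Type) (a : A) (p q : step E) : Prop :=
  forall z, (p z `&` a)%O = (q z `&` a)%O.


Section Forcing.
Local Open Scope order_scope.
Implicit Types a b c : A.

Lemma step_inj (E : Type) (p : step E) c x y :
  c != \bot -> c <= p x -> c <= p y -> x = y.
Proof.
move=> c0 cx cy; apply: contrapT => /((step_partition p).1) e.
by move: c0; rewrite -lex0 -e lexI cx cy.
Qed.

Lemma step_decide (E : Type) (p : step E) c : c != \bot ->
  exists c' x, [/\ c' != \bot, c' <= c & c' <= p x].
Proof.
move=> c0; have [x cx] := partition_hit (step_partition p) c0.
by exists (c `&` p x), x; rewrite cx leIl leIr.
Qed.

Lemma step_of_decide (E I : Type) (a : I -> A) (x : I -> E)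
    (pa : is_partition a) c z : c != \bot -> c <= step_of x pa z ->
  exists c' i, [/\ c' != \bot, c' <= c, c' <= a i & x i = z].
Proof.
move=> c0 /meet_idPl cz; have H : c `&` step_of x pa z != \bot by rewrite cz.
have [i iz ci] := family_val_hit H.
by exists (c `&` a i), i; rewrite ci leIl leIr.
Qed.

Lemma step_of_le (E I : Type) (a : I -> A) (x : I -> E)
    (pa : is_partition a) c i : c <= a i -> c <= step_of x pa (x i).
Proof. by move=> /le_trans; apply; apply: family_val_ge. Qed.

Lemma step_const_le (E : Type) (x : E) c : c <= step_const x x.
Proof. by apply: (step_of_le (fun=> x) partition1 (i := tt)); apply: lex1. Qed.

Lemma step_map_decide (E F : Type) (h : E -> F) p c z :
  c != \bot -> c <= step_map h p z ->
  exists c' x, [/\ c' != \bot, c' <= c, c' <= p x & h x = z].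
Proof. by move=> c0 /(step_of_decide c0). Qed.

Lemma step_map_le (E F : Type) (h : E -> F) (p : step E) c x :
  c <= p x -> c <= step_map h p (h x).
Proof. exact: step_of_le. Qed.

Lemma step_map2_decide (E F G : Type) (h : E -> F -> G) p q c z :
  c != \bot -> c <= step_map2 h p q z ->
  exists c' x y, [/\ c' != \bot, c' <= c, c' <= p x, c' <= q y & h x y = z].
Proof.
move=> c0 /(step_of_decide c0)[c' [[x y] [c'0 c'c /=]]].
by rewrite lexI => /andP[cx cy] e; exists c', x, y.
Qed.

Lemma step_map2_le (E F G : Type) (h : E -> F -> G) (p : step E) (q : step F)
  c x y : c <= p x -> c <= q y -> c <= step_map2 h p q (h x y).
Proof.
move=> cx cy; apply: (step_of_le (fun xy => h xy.1 xy.2) _ (i := (x, y))).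
by rewrite lexI cx cy.
Qed.

Lemma step_relP (E F : Type) a (rho : E -> F -> Prop) p q :
  step_rel_on a rho p q <->
  (forall c x y, c != \bot -> c <= a -> c <= p x -> c <= q y -> rho x y).
Proof.
split=> [H c x y c0 ca cx cy|H x y c0].
  by apply: H; apply: le_bot_neq c0 _; rewrite !lexI ca cx cy.
apply: (H _ _ _ c0); rewrite ?leIl//.
  by rewrite (le_trans (leIr _ _)) ?leIl.
by rewrite (le_trans (leIr _ _)) ?leIr.
Qed.

Lemma step_agree_le (E : Type) a (p q : step E) c x :
  step_agree a p q -> c <= a -> c <= p x -> c <= q x.
Proof.
move=> pq ca cx; suff: c <= q x `&` a by rewrite lexI => /andP[].
by rewrite -pq lexI cx ca.
Qed.

Lemma step_agreeP (E : Type) a (p q : step E) :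
  step_agree a p q <-> step_rel_on a eq p q.
Proof.
split=> [pq|/step_relP H].
  apply/step_relP => c x y c0 ca cx cy.
  exact: (step_inj c0 (step_agree_le pq ca cx) cy).
move=> z; apply: le_anti; rewrite !lexI !leIr !andbT.
apply/andP; split; apply: le_dense => c c0; rewrite lexI => /andP[cz ca].
  have [c' [y [c'0 c'c c'y]]] := step_decide q c0.
  rewrite (H c' z y)// ?(le_trans c'c)//.
  by apply: le_bot_neq c'0 _; rewrite lexI c'c.
have [c' [y [c'0 c'c c'y]]] := step_decide p c0.
rewrite -(H c' y z)// ?(le_trans c'c)//.
by apply: le_bot_neq c'0 _; rewrite lexI c'c.
Qed.

Lemma step_agree_top (E : Type) (p q : step E) : step_agree \top p q -> p = q.
Proof.
case: p q => p pp [q pq] H.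
have e : p = q by apply/funext => z; have := H z; rewrite /= !meetx1.
by case: _ / e pq {H} => pq; congr Step; apply: Prop_irrelevance.
Qed.

Lemma step_map2_agree (E F G : Type) (h : E -> F -> G) a p p' q q' :
  step_agree a p p' -> step_agree a q q' ->
  step_agree a (step_map2 h p q) (step_map2 h p' q').
Proof.
move=> pp qq; apply/step_agreeP/step_relP => c z z' c0 ca cz cz'.
have [c1 [x [y [c10 c1c c1x c1y <-]]]] := step_map2_decide c0 cz.
apply: (step_inj c10 _ (le_trans c1c cz')); apply: step_map2_le.
  by apply: (step_agree_le pp) => //; apply: le_trans ca.
by apply: (step_agree_le qq) => //; apply: le_trans ca.
Qed.

Lemma step_rel_agree (E F : Type) a (rho : E -> F -> Prop) p p' q :
  step_agree a p p' -> step_rel_on a rho p q -> step_rel_on a rho p' q.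
Proof.
move=> pp /step_relP H; apply/step_relP => c x y c0 ca cx cy.
by apply: (H c) => //; apply: (step_agree_le (a := a)) cx => // z; rewrite pp.
Qed.

Lemma step_rel_le (E F : Type) a b (rho : E -> F -> Prop) p q :
  a <= b -> step_rel_on b rho p q -> step_rel_on a rho p q.
Proof.
move=> ab /step_relP H; apply/step_relP => c x y c0 ca.
by apply: H => //; apply: le_trans ab.
Qed.

Lemma step_rel_parts (E F I : Type) (b : I -> A) a (rho : E -> F -> Prop) p q :
  is_partition b -> (forall i, step_rel_on (b i `&` a) rho p q) ->
  step_rel_on a rho p q.
Proof.
move=> pb H; apply/step_relP => c x y c0 ca cx cy.
have [i ci] := partition_hit pb c0; have /step_relP := H i.
by apply; [exact: ci|rewrite lexI leIr (le_trans (leIl _ _) ca)|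
  rewrite (le_trans (leIl _ _))|rewrite (le_trans (leIl _ _))].
Qed.

End Forcing.

Section StepConditionalSet.
Variable E : pointedType.

HB.instance Definition _ := isPointed.Build (step E) (step_const point).

Lemma step_agree_refl a (p : step E) : step_agree a p p.
Proof. by []. Qed.

Lemma step_agree_sym a (p q : step E) : step_agree a p q -> step_agree a q p.
Proof. by move=> pq z; rewrite pq. Qed.

Lemma step_agree_trans a (p q r : step E) :
  step_agree a p q -> step_agree a q r -> step_agree a p r.
Proof. by move=> pq qr z; rewrite pq qr. Qed.

Lemma step_agree_mono a b (p q : step E) :
  (a <= b)%O -> step_agree b p q -> step_agree a p q.
Proof. by move=> /meet_idPr <- pq z; rewrite !meetA pq. Qed.

Lemma step_agree_concat (I : Type) (a : I -> A) (x : I -> step E) :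
  is_partition a -> exists! z, forall i, step_agree (a i) z (x i).
Proof.
move=> pa; have px := partition_sum pa (fun i => step_partition (x i)).
exists (step_of snd px); split=> [i|z H].
  apply/step_agreeP/step_relP => c y y' c0 ca.
  move=> /(step_of_decide c0)[c' [[j y''] /= [c'0 c'c]]].
  rewrite lexI => /andP[c'j c'y <-] cy'; have ji : j = i.
    apply: contrapT => /(pa.1) e; move: c'0.
    by rewrite -lex0 -e lexI c'j (le_trans c'c ca).
  by rewrite ji in c'y; apply: (step_inj c'0 c'y); apply: le_trans cy'.
apply/step_agree_top/step_agreeP/(step_rel_parts pa) => i; rewrite meetx1.
apply/step_relP => c y y' c0 ca.
move=> /(step_of_decide c0)[c' [[j y''] /= [c'0 c'c]]].
rewrite lexI => /andP[c'j c'y <-] cy'; have ji : j = i.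
  apply: contrapT => /(pa.1) e; move: c'0.
  by rewrite -lex0 -e lexI c'j (le_trans c'c ca).
rewrite ji in c'y; apply: (step_inj c'0 c'y).
by apply: (step_agree_le (H i)) => //; apply: le_trans c'c _.
Qed.

HB.instance Definition _ := isConditionalSet.Build d A (step E)
  step_agree_refl step_agree_sym step_agree_trans step_agree_mono
  step_agree_concat.

End StepConditionalSet.

End StepFunctions.

(* Only the pseudometric axioms are recorded: they suffice for the completion. *)
Record pmetric (R : realType) (E : Type) := PMetric {
  pdist :> E -> E -> R;
  pdistxx : forall x, pdist x x = 0;
  pdistC : forall x y, pdist x y = pdist y x;
  pdist_triangle : forall x y z, pdist x z <= pdist x y + pdist y z }.

Section Completion.
Context {d : Order.disp_t} (A : completeBooleanType d) {R : realType}.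
Implicit Types (a b c : A) (r : step A R) (n : step A nat).

Definition step_lt_on a (p q : step A R) : Prop :=
  step_rel_on a (fun x y : R => x < y) p q.
Definition step_lt (p q : step A R) : Prop := step_lt_on \top%O p q.
Definition step_pos r : Prop := step_lt (step_const A 0) r.
Definition step_leN n (m : step A nat) : Prop := step_rel_on \top%O leq n m.

Definition step_dist (E : Type) (m : pmetric R E) (p q : step A E) : step A R :=
  step_map2 m p q.

(* The index set of conditional sequences is [step A nat], with 0 allowed; this
   changes neither the completion nor the neighbourhoods [wnbhs] below. *)
Definition is_cauchy (E : Type) (m : pmetric R E) (u : step A nat -> step A E) :=
  forall r, step_pos r -> exists n0, forall k l,
    step_leN n0 k -> step_leN n0 l -> step_lt (step_dist m (u k) (u l)) r.

Definition seq_agree (E : Type) (m : pmetric R E) a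
    (u v : step A nat -> step A E) : Prop :=
  forall r, step_pos r -> exists n0, forall n,
    step_leN n0 n -> step_lt_on a (step_dist m (u n) (v n)) r.

Record cauchy_seq (E : pointedType) (m : pmetric R E) := CauchySeq {
  cauchy_val :> step A nat -> step A E;
  cauchy_stable : stable cauchy_val;
  cauchy_cauchy : is_cauchy m cauchy_val }.

HB.instance Definition _ E m := gen_eqMixin (@cauchy_seq E m).
HB.instance Definition _ E m := gen_choiceMixin (@cauchy_seq E m).

Section Tools.
Local Open Scope order_scope.

Lemma step_posP r :
  step_pos r <-> (forall c x, c != \bot -> c <= r x -> (0 < x)%R).
Proof.
split=> [/step_relP H c x c0 cx|H].
  exact: (H c _ _ c0 (lex1 _) (step_const_le _ _) cx).
apply/step_relP => c x y c0 _ cx cy.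
by rewrite (step_inj c0 cx (step_const_le _ _)); apply: H cy.
Qed.

Lemma step_pos_const (t : R) : (0 < t)%R -> step_pos (step_const A t).
Proof.
move=> t0; apply/step_posP => c x c0 cx.
by rewrite (step_inj c0 cx (step_const_le _ _)).
Qed.

Lemma step_leN_refl n : step_leN n n.
Proof. by apply/step_relP => c x y c0 _ cx cy; rewrite (step_inj c0 cx cy). Qed.

Lemma step_leN_max n m : exists k,
  forall l, step_leN k l -> step_leN n l /\ step_leN m l.
Proof.
exists (step_map2 maxn n m) => l /step_relP H.
split; apply/step_relP => c x y c0 ca cx cy.
  have [c' [z [c'0 c'c cz]]] := step_decide m c0.
  have := H c' (maxn x z) y c'0 (lex1 _).
  rewrite geq_max (step_map2_le maxn (le_trans c'c cx) cz) (le_trans c'c cy).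
  by move=> /(_ isT isT) /andP[].
have [c' [z [c'0 c'c cz]]] := step_decide n c0.
have := H c' (maxn z x) y c'0 (lex1 _).
rewrite geq_max (step_map2_le maxn cz (le_trans c'c cx)) (le_trans c'c cy).
by move=> /(_ isT isT) /andP[].
Qed.

(* A property of tails that is local on the pieces can be glued. *)
Lemma tail_glue (I : Type) (a : I -> A) (Q : A -> step A nat -> step A nat -> Prop) :
  is_partition a ->
  (forall b n n' m m', cagree b n n' -> cagree b m m' -> Q b n m -> Q b n' m') ->
  (forall n m, (forall i, Q (a i) n m) -> Q \top n m) ->
  (forall i, exists n0, forall n m, step_leN n0 n -> step_leN n0 m -> Q (a i) n m) ->
  exists n0, forall n m, step_leN n0 n -> step_leN n0 m -> Q \top n m.
Proof.
move=> pa loc glue /boolp.choice[f fP]; exists (concat a f) => n m nP mP.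
apply: glue => i.
pose g k := concat (part2 (a i)) (fun j : bool => if j then k else f i).
have gP k : cagree (a i) (g k) k by exact: (concatP _ (part2P (a i)) true).
have gP' k : cagree (~` a i) (g k) (f i).
  exact: (concatP _ (part2P (a i)) false).
have fg k : step_leN (concat a f) k -> step_leN (f i) (g k).
  move=> kP; apply: (step_rel_parts (part2P (a i))) => -[]; rewrite meetx1 /=.
    have /step_relP H := kP; apply/step_relP => c x y c0 ca cx cy.
    apply: (H c x y c0 (lex1 _)).
      exact: (step_agree_le (cagree_sym (concatP f pa i)) ca cx).
    exact: (step_agree_le (gP k) ca cy).
  apply/step_relP => c x y c0 ca cx cy.
  by rewrite (step_inj c0 cx (step_agree_le (gP' k) ca cy)).
by apply: loc (gP n) (gP m) (fP _ _ _ (fg _ nP) (fg _ mP)).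
Qed.

Lemma tail_glue1 (I : Type) (a : I -> A) (Q : A -> step A nat -> Prop) :
  is_partition a ->
  (forall b n n', cagree b n n' -> Q b n -> Q b n') ->
  (forall n, (forall i, Q (a i) n) -> Q \top n) ->
  (forall i, exists n0, forall n, step_leN n0 n -> Q (a i) n) ->
  exists n0, forall n, step_leN n0 n -> Q \top n.
Proof.
move=> pa loc glue H.
have loc2 b n n' (m m' : step A nat) : cagree b n n' -> cagree b m m' -> Q b n -> Q b n'.
  by move=> e _; apply: loc.
have [n _|i|n0 n0P] := @tail_glue I a (fun b n _ => Q b n) pa loc2.
- exact: glue.
- by have [n0 n0P] := H i; exists n0 => n _ nP _; apply: n0P.
- by exists n0 => n nP; apply: (n0P n n nP nP).
Qed.

Variables (E : pointedType) (m : pmetric R E).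
Implicit Types u v w : step A nat -> step A E.

Lemma step_dist_lt_agree a (p p' q q' : step A E) r :
  cagree a p p' -> cagree a q q' ->
  step_lt_on a (step_dist m p q) r -> step_lt_on a (step_dist m p' q') r.
Proof. by move=> pp qq; exact: (step_rel_agree (step_map2_agree m pp qq)). Qed.

Lemma step_dist_lt_parts (I : Type) (b : I -> A) (p q : step A E) r :
  is_partition b -> (forall i, step_lt_on (b i) (step_dist m p q) r) ->
  step_lt_on \top (step_dist m p q) r.
Proof.
by move=> pb H; apply: (step_rel_parts pb) => i; rewrite meetx1; apply: H.
Qed.

Lemma step_dist_half a (p q s : step A E) r :
  step_lt_on a (step_dist m p q) (step_map (fun x : R => x / 2)%R r) ->
  step_lt_on a (step_dist m q s) (step_map (fun x : R => x / 2)%R r) ->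
  step_lt_on a (step_dist m p s) r.
Proof.
move=> /step_relP pq /step_relP qs; apply/step_relP => c t e c0 ca ct ce.
have [c1 [x [z [c10 c1c c1x c1z <-]]]] := step_map2_decide c0 ct.
have [c2 [y [c20 c2c1 c2y]]] := step_decide q c10.
have c2a : c2 <= a by rewrite (le_trans c2c1)// (le_trans c1c).
have c2e : c2 <= step_map (fun x : R => x / 2)%R r (e / 2)%R.
  by apply: step_map_le; rewrite (le_trans c2c1)// (le_trans c1c).
have := pq c2 _ _ c20 c2a (step_map2_le m (le_trans c2c1 c1x) c2y) c2e.
have := qs c2 _ _ c20 c2a (step_map2_le m c2y (le_trans c2c1 c1z)) c2e.
move=> h1 h2; apply: le_lt_trans (pdist_triangle m x y z) _.
by rewrite (splitr e); apply: ltrD.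
Qed.

Lemma step_pos_half r :
  step_pos r -> step_pos (step_map (fun x : R => x / 2)%R r).
Proof.
move=> /step_posP rP; apply/step_posP => c x c0 cx.
have [c' [y [c'0 c'c cy <-]]] := step_map_decide c0 cx.
by rewrite divr_gt0//; apply: rP cy.
Qed.

Lemma seq_agree_eq a u v : (forall n, cagree a (u n) (v n)) -> seq_agree m a u v.
Proof.
move=> uv r /step_posP rP; exists (step_const A 0%N) => n _.
apply/step_relP => c x y c0 ca cx cy.
have [c' [s [t [c'0 c'c cs ct <-]]]] := step_map2_decide c0 cx.
have -> : t = s.
  by apply: (step_inj c'0 ct); apply: (step_agree_le (uv n)) => //; apply: le_trans ca.
by rewrite pdistxx; apply: rP cy.
Qed.

Lemma seq_agree_sym a u v : seq_agree m a u v -> seq_agree m a v u.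
Proof.
move=> uv r /uv[n0 n0P]; exists n0 => n /n0P; apply: step_rel_agree => z.
congr (_ `&` _); rewrite /step_dist; congr (step_val _ z).
apply/step_agree_top/step_agreeP/step_relP => c x y c0 _ cx cy.
have [c' [s [t [c'0 c'c cs ct <-]]]] := step_map2_decide c0 cx.
rewrite pdistC; apply: (step_inj c'0 _ (le_trans c'c cy)).
exact: step_map2_le.
Qed.

Lemma seq_agree_trans a u v w :
  seq_agree m a u v -> seq_agree m a v w -> seq_agree m a u w.
Proof.
move=> uv vw r /step_pos_half r2.
have [n1 n1P] := uv _ r2; have [n2 n2P] := vw _ r2.
have [n nP] := step_leN_max n1 n2; exists n => k /nP[k1 k2].
by apply: step_dist_half (n1P _ k1) (n2P _ k2).
Qed.

Lemma seq_agree_le a b u v : a <= b -> seq_agree m b u v -> seq_agree m a u v.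
Proof.
move=> ab uv r /uv[n0 n0P]; exists n0 => n /n0P; exact: step_rel_le.
Qed.

Lemma seq_agree_parts (I : Type) (a : I -> A) u v :
  stable u -> stable v -> is_partition a ->
  (forall i, seq_agree m (a i) u v) -> seq_agree m \top u v.
Proof.
move=> su sv pa H r r0.
apply: (tail_glue1 (Q := fun b n => step_lt_on b (step_dist m (u n) (v n)) r) pa).
- by move=> b n n' nn; apply: step_dist_lt_agree; apply: stable_cagree.
- by move=> n; apply: step_dist_lt_parts.
- by move=> i; apply: H.
Qed.

Lemma is_cauchy_concat (I : Type) (a : I -> A)
    (u : I -> step A nat -> step A E) : is_partition a ->
  (forall i, stable (u i)) -> (forall i, is_cauchy m (u i)) ->
  is_cauchy m (fun n => concat a (fun i => u i n)).
Proof.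
move=> pa su cu r r0; pose w n := concat a (fun i => u i n).
apply: (@tail_glue _ _ (fun b k l => step_lt_on b (step_dist m (w k) (w l)) r) pa).
- move=> b n n' k k' nn kk; apply: step_dist_lt_agree.
    apply: (cagree_parts pa) => i.
    apply: (cagree_trans (cagree_le (leIl _ _) (concatP _ pa i))).
    apply: cagree_sym.
    apply: (cagree_trans (cagree_le (leIl _ _) (concatP _ pa i))).
    by apply: (cagree_le (leIr _ _)); apply/cagree_sym/stable_cagree.
  apply: (cagree_parts pa) => i.
  apply: (cagree_trans (cagree_le (leIl _ _) (concatP _ pa i))).
  apply: cagree_sym.
  apply: (cagree_trans (cagree_le (leIl _ _) (concatP _ pa i))).
  by apply: (cagree_le (leIr _ _)); apply/cagree_sym/stable_cagree.
- by move=> k l; apply: step_dist_lt_parts.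
- move=> i; have [n0 n0P] := cu i r r0; exists n0 => k l nk nl.
  apply: step_dist_lt_agree (cagree_sym (concatP _ pa i))
    (cagree_sym (concatP _ pa i)) _.
  by apply: step_rel_le (n0P _ _ nk nl); exact: lex1.
Qed.

Lemma stable_concat (I : Type) (a : I -> A)
    (u : I -> step A nat -> step A E) : is_partition a ->
  (forall i, stable (u i)) -> stable (fun n => concat a (fun i => u i n)).
Proof.
move=> pa su; apply: cagree_stable => b n n' nn; apply: (cagree_parts pa) => i.
apply: (cagree_trans (cagree_le (leIl _ _) (concatP _ pa i))).
apply: cagree_sym.
apply: (cagree_trans (cagree_le (leIl _ _) (concatP _ pa i))).
by apply: (cagree_le (leIr _ _)); apply/cagree_sym/stable_cagree.
Qed.

Lemma stable_cst (p : step A E) : stable (fun _ : step A nat => p).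
Proof. by apply: cagree_stable => a n n' _; apply: cagree_refl. Qed.

Lemma is_cauchy_cst (p : step A E) : is_cauchy m (fun=> p).
Proof.
move=> r r0; exists (step_const A 0%N) => k l _ _.
have [n0 n0P] := @seq_agree_eq \top (fun=> p) (fun=> p)
  (fun=> cagree_refl _ _) r r0.
exact: (n0P n0 (@step_leN_refl n0)).

Qed.

End Tools.

Section Quotient.
Variables (E : pointedType) (m : pmetric R E).

Definition seq_eq (u v : cauchy_seq m) : bool := `[< seq_agree m \top%O u v >].

Lemma seq_eq_equiv : equiv_class_of seq_eq.
Proof.
split=> [u|u v|v u w].
- by apply/asboolP/seq_agree_eq => n; apply: cagree_refl.
- by apply/asboolP/asboolP; apply: seq_agree_sym.
- by move=> /asboolP uv /asboolP vw; apply/asboolP; apply: seq_agree_trans vw.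
Qed.

Canonical seq_eq_canonical := EquivRelPack seq_eq_equiv.

Definition ccompletion : Type := {eq_quot seq_eq}.
HB.instance Definition _ := Choice.on ccompletion.
HB.instance Definition _ := EqQuotient.on ccompletion.

Definition cstep (p : step A E) : ccompletion :=
  \pi_ccompletion (CauchySeq (stable_cst p) (is_cauchy_cst m p)).

Definition cconst (x : E) : ccompletion := cstep (step_const A x).

HB.instance Definition _ := isPointed.Build ccompletion (cconst point).

Definition ccomp_agree (a : A) (x y : ccompletion) : Prop :=
  seq_agree m a (repr x) (repr y).

Lemma repr_pi_agree a (u : cauchy_seq m) :
  seq_agree m a (repr (\pi_ccompletion u)) u.
Proof.
apply: (@seq_agree_le _ _ a \top%O _ _ (lex1 _)).
have : \pi_ccompletion (repr (\pi_ccompletion u)) = \pi_ccompletion u.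
  by rewrite reprK.
by move=> /eqmodP/asboolP.
Qed.

Lemma ccomp_agreeP a (u v : cauchy_seq m) :
  ccomp_agree a (\pi_ccompletion u) (\pi_ccompletion v) <-> seq_agree m a u v.
Proof.
split=> H.
  apply: (seq_agree_trans (seq_agree_sym (repr_pi_agree a u))).
  exact: (seq_agree_trans H (repr_pi_agree a v)).
apply: (seq_agree_trans (repr_pi_agree a u)).
exact: (seq_agree_trans H (seq_agree_sym (repr_pi_agree a v))).
Qed.

Lemma ccomp_agree_refl a x : ccomp_agree a x x.
Proof. by apply: seq_agree_eq => n; apply: cagree_refl. Qed.

Lemma ccomp_agree_sym a x y : ccomp_agree a x y -> ccomp_agree a y x.
Proof. exact: seq_agree_sym. Qed.

Lemma ccomp_agree_trans a x y z :
  ccomp_agree a x y -> ccomp_agree a y z -> ccomp_agree a x z.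
Proof. exact: seq_agree_trans. Qed.

Lemma ccomp_agree_le a b x y :
  (a <= b)%O -> ccomp_agree b x y -> ccomp_agree a x y.
Proof. exact: seq_agree_le. Qed.

Lemma ccomp_agree_top x y : ccomp_agree \top%O x y -> x = y.
Proof.
move=> H; rewrite -[x]reprK -[y]reprK; apply/eqmodP; exact/asboolP.
Qed.

Lemma ccomp_agree_concat (I : Type) (a : I -> A) (x : I -> ccompletion) :
  is_partition a -> exists! z, forall i, ccomp_agree (a i) z (x i).
Proof.
move=> pa; pose u i : cauchy_seq m := repr (x i).
have su i : stable (u i) by exact: cauchy_stable.
have cu i : is_cauchy m (u i) by exact: cauchy_cauchy.
pose w := CauchySeq (stable_concat pa su) (is_cauchy_concat pa su cu).
have wP i : seq_agree m (a i) w (u i).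
  by apply: seq_agree_eq => n; apply: (concatP _ pa i).
exists (\pi_ccompletion w); split=> [i|z zP].
  exact: seq_agree_trans (repr_pi_agree _ _) (wP i).
apply: ccomp_agree_top; apply: (seq_agree_parts _ _ pa) => [||i].
- exact: cauchy_stable.
- exact: cauchy_stable.
apply: (seq_agree_trans (repr_pi_agree _ _)).
exact: (seq_agree_trans (wP i) (seq_agree_sym (zP i))).
Qed.

HB.instance Definition _ := isConditionalSet.Build d A ccompletion
  ccomp_agree_refl ccomp_agree_sym ccomp_agree_trans ccomp_agree_le
  ccomp_agree_concat.

End Quotient.
End Completion.

(* Representative-wise operations: a map that is uniformly continuous on the
   products of unit balls acts on conditional Cauchy sequences. *)
Section Lift.
Context {d : Order.disp_t} {A : completeBooleanType d} {R : realType}.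
Context {E F G : pointedType} {mE : pmetric R E} {mF : pmetric R F}.
Context {mG : pmetric R G}.
Implicit Types (a b c : A) (r : step A R) (h : E -> F -> G).
Local Open Scope order_scope.

Definition loc_unif_cont2 h : Prop :=
  forall x0 y0 (e : R), (0 < e)%R -> exists2 delta : R, (0 < delta)%R &
    forall x x' y y', (mE x0 x < 1)%R -> (mE x0 x' < 1)%R ->
      (mF y0 y < 1)%R -> (mF y0 y' < 1)%R ->
      (mE x x' < delta)%R -> (mF y y' < delta)%R -> (mG (h x y) (h x' y') < e)%R.

Section Core.
Variables (h : E -> F -> G) (hh : loc_unif_cont2 h).

Lemma luc_core (u : cauchy_seq A mE) (v : cauchy_seq A mF) r : step_pos r ->
  exists delta, step_pos delta /\ exists n0, forall a n p q, step_leN n0 n ->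
    step_lt_on a (step_dist mE (u n) p) delta ->
    step_lt_on a (step_dist mF (v n) q) delta ->
    step_lt_on a (step_dist mG (step_map2 h (u n) (v n)) (step_map2 h p q)) r.
Proof.
move=> /step_posP r0.
have h2 : step_pos (step_const A (2^-1 : R)%R).
  by apply: step_pos_const; rewrite invr_gt0.
have [n1 n1P] := cauchy_cauchy u h2; have [n2 n2P] := cauchy_cauchy v h2.
have [n0 n0P] := step_leN_max n1 n2; have [n01 n02] := n0P _ (@step_leN_refl _ _ n0).
have /boolp.choice[f fP] (xye : E * F * R) : exists delta : R,
    ((0 < xye.2)%R -> (0 < delta)%R) /\ ((0 < xye.2)%R -> forall x x' y y',
    (mE xye.1.1 x < 1)%R -> (mE xye.1.1 x' < 1)%R ->
    (mF xye.1.2 y < 1)%R -> (mF xye.1.2 y' < 1)%R ->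
    (mE x x' < delta)%R -> (mF y y' < delta)%R ->
    (mG (h x y) (h x' y') < xye.2)%R).
  have [e0|e0] := ltP 0%R xye.2; last by exists 0%R.
  by have [delta d0 dP] := hh xye.1.1 xye.1.2 e0; exists delta.
pose g xy e := Num.min (f (xy, e)) 2^-1%R.
pose delta := step_map2 g (step_map2 pair (u n0) (v n0)) r.
exists delta; split.
  apply/step_posP => c t c0 ct.
  have [c1 [[x y] [e [c10 c1c _ c1e <-]]]] := step_map2_decide c0 ct.
  rewrite /g lt_min invr_gt0 ltr0n andbT; apply: (fP (x, y, e)).1.
  exact: r0 c1e.
exists n0 => a n p q nP /step_relP pP /step_relP qP.
apply/step_relP => c t e c0 ca ct ce.
have [c1 [z [z' [c10 c1c cz cz' <-]]]] := step_map2_decide c0 ct.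
have [c2 [x [y [c20 c21 c2x c2y hz]]]] := step_map2_decide c10 cz.
have [c3 [x' [y' [c30 c32 c3x' c3y' hz']]]] :=
  step_map2_decide c20 (le_trans c21 cz').
have [c4 [x0 [c40 c43 c4x0]]] := step_decide (u n0) c30.
have [c5 [y0 [c50 c54 c5y0]]] := step_decide (v n0) c40.
have l53 := le_trans c54 c43; have l52 := le_trans l53 c32.
have l51 := le_trans l52 c21; have l5c := le_trans l51 c1c.
have {}c2x := le_trans l52 c2x; have {}c2y := le_trans l52 c2y.
have {}c3x' := le_trans l53 c3x'; have {}c3y' := le_trans l53 c3y'.
have {}c4x0 := le_trans c54 c4x0; have {}ce := le_trans l5c ce.
have {}ca := le_trans l5c ca.
have e0 : (0 < e)%R by exact: r0 ce.
have c5d : c5 <= delta (g (x0, y0) e).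
  by apply: step_map2_le => //; apply: step_map2_le.
have /= fxy := (fP (x0, y0, e)).2 e0.
have xx' := pP c5 _ _ c50 ca (step_map2_le mE c2x c3x') c5d.
have yy' := qP c5 _ _ c50 ca (step_map2_le mF c2y c3y') c5d.
have c5h : c5 <= step_const A (2^-1 : R)%R (2^-1 : R)%R by exact: step_const_le.
have [k1 k2] := n0P _ nP.
have xx0 : (mE x0 x < 2^-1)%R.
  have /step_relP H := n1P _ _ n01 k1.
  exact: H c5 _ _ c50 (lex1 _) (step_map2_le mE c4x0 c2x) c5h.
have yy0 : (mF y0 y < 2^-1)%R.
  have /step_relP H := n2P _ _ n02 k2.
  exact: H c5 _ _ c50 (lex1 _) (step_map2_le mF c5y0 c2y) c5h.
move: xx' yy'; rewrite !lt_min => /andP[x1 x2] /andP[y1 y2].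
have half : (2^-1 + 2^-1 = 1 :> R)%R by rewrite [RHS](splitr 1%R) mul1r.
rewrite -hz -hz'; apply: fxy => //.
- by rewrite (lt_trans xx0)// invf_lt1// ltr1n.
- by rewrite (le_lt_trans (pdist_triangle mE _ x _))// -half ltrD.
- by rewrite (lt_trans yy0)// invf_lt1// ltr1n.
- by rewrite (le_lt_trans (pdist_triangle mF _ y _))// -half ltrD.
Qed.

Variables (u : cauchy_seq A mE) (v : cauchy_seq A mF).

Lemma stable_map2 : stable (fun n => step_map2 h (u n) (v n)).
Proof.
apply: cagree_stable => a n n' nn.
by apply: step_map2_agree; apply: stable_cagree nn; apply: cauchy_stable.
Qed.

Lemma is_cauchy_map2 : is_cauchy mG (fun n => step_map2 h (u n) (v n)).
Proof.
move=> r r0; have [delta [d0 [n0 n0P]]] := luc_core u v r0.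
have [n1 n1P] := cauchy_cauchy u d0; have [n2 n2P] := cauchy_cauchy v d0.
have [n12 n12P] := step_leN_max n1 n2; have [n nP] := step_leN_max n0 n12.
exists n => k l /nP[k0 /n12P[k1 k2]] /nP[_ /n12P[l1 l2]].
by apply: n0P => //; [apply: n1P|apply: n2P].
Qed.

Definition seq_map2 : cauchy_seq A mG := CauchySeq stable_map2 is_cauchy_map2.

End Core.

Definition cmap2 h (hh : loc_unif_cont2 h) (x : ccompletion A mE)
    (y : ccompletion A mF) : ccompletion A mG :=
  \pi_(ccompletion A mG) (seq_map2 hh (repr x) (repr y)).

Lemma seq_map2_agree h (hh : loc_unif_cont2 h) a
    (u u' : cauchy_seq A mE) (v v' : cauchy_seq A mF) :
  seq_agree mE a u u' -> seq_agree mF a v v' ->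
  seq_agree mG a (seq_map2 hh u v) (seq_map2 hh u' v').
Proof.
move=> uu vv r r0; have [delta [d0 [n0 n0P]]] := luc_core hh u v r0.
have [n1 n1P] := uu _ d0; have [n2 n2P] := vv _ d0.
have [n12 n12P] := step_leN_max n1 n2; have [n nP] := step_leN_max n0 n12.
exists n => k /nP[k0 /n12P[k1 k2]].
by apply: n0P => //; [apply: n1P|apply: n2P].
Qed.

Lemma cmap2_pi h (hh : loc_unif_cont2 h) u v :
  cmap2 hh (\pi_(ccompletion A mE) u) (\pi_(ccompletion A mF) v) =
  \pi_(ccompletion A mG) (seq_map2 hh u v).
Proof.
by apply/ccomp_agree_top/ccomp_agreeP/seq_map2_agree; apply: repr_pi_agree.
Qed.

End Lift.

Section Metrics.
Context {R : realType}.

Lemma norm_distxx (V : normedModType R) (x : V) : `|x - x| = 0.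
Proof. by rewrite subrr normr0. Qed.

Lemma norm_dist_triangle (V : normedModType R) (x y z : V) :
  `|x - z| <= `|x - y| + `|y - z|.
Proof. exact: ler_distD. Qed.

Definition norm_metric (V : normedModType R) : pmetric R V :=
  PMetric (@norm_distxx V) (@distrC R V) (@norm_dist_triangle V).

Definition ext_atan (x : \bar R) : R :=
  match x with
  | r%:E => atan r
  | +oo%E => pi / 2
  | -oo%E => - (pi / 2)
  end.

Definition ext_dist (x y : \bar R) : R := `|ext_atan x - ext_atan y|.

Lemma ext_distxx x : ext_dist x x = 0.
Proof. by rewrite /ext_dist subrr normr0. Qed.

Lemma ext_distC x y : ext_dist x y = ext_dist y x.
Proof. exact: distrC. Qed.

Lemma ext_dist_triangle x y z : ext_dist x z <= ext_dist x y + ext_dist y z.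
Proof. exact: ler_distD. Qed.

Definition ext_metric : pmetric R (\bar R) :=
  PMetric ext_distxx ext_distC ext_dist_triangle.

Lemma ext_dist_fin (x y : R) : ext_dist x%:E y%:E <= `|x - y|.
Proof.
rewrite /ext_dist /=; wlog xy : x y / x <= y.
  by case/orP: (le_total x y) => xy H; [|rewrite distrC (distrC x)]; apply: H.
have datan z : z \in `]x, y[ -> is_derive z 1 (@atan R) (1 + z ^+ 2)^-1.
  by move=> _; exact: is_derive1_atan.
have catan : {within `[x, y], continuous (@atan R)}%classic.
  by apply: continuous_subspaceT => z; exact: continuous_atan.
have [z _ e] := MVT_segment xy datan catan.
rewrite distrC (distrC x) e normrM ler_piMl// ger0_norm ?invr_ge0 ?addr_ge0 ?sqr_ge0//.
by rewrite invf_le1 ?ltr_wpDr ?sqr_ge0// lerDl sqr_ge0.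
Qed.

Context {V W U : normedModType R}.

Lemma luc_add : loc_unif_cont2 (mE := norm_metric V) (mF := norm_metric V)
  (mG := norm_metric V) +%R.
Proof.
move=> x0 y0 e e0; exists (e / 2); first by rewrite divr_gt0.
move=> x x' y y' _ _ _ _ /= xx yy.
by rewrite opprD addrACA (splitr e) (le_lt_trans (ler_normD _ _))// ltrD.
Qed.

Lemma luc_sub : loc_unif_cont2 (mE := norm_metric V) (mF := norm_metric V)
  (mG := norm_metric V) (fun x y => x - y).
Proof.
move=> x0 y0 e e0; exists (e / 2); first by rewrite divr_gt0.
move=> x x' y y' _ _ _ _ /= xx yy.
rewrite opprD addrACA (splitr e) (le_lt_trans (ler_normD _ _))// ltrD//.
by rewrite -opprD normrN.
Qed.

Lemma luc_bilinear (h : V -> W -> U) :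
  (forall x x' y, h (x - x') y = h x y - h x' y) ->
  (forall x y y', h x (y - y') = h x y - h x y') ->
  (forall x y, `|h x y| <= `|x| * `|y|) ->
  loc_unif_cont2 (mE := norm_metric V) (mF := norm_metric W)
    (mG := norm_metric U) h.
Proof.
move=> hl hr hb x0 y0 e e0.
pose M := `|x0| + `|y0| + 1; have M0 : 0 < M by rewrite ltr_wpDl ?addr_ge0.
exists (e / 2 / M) => [|x x' y y' /= x1 x1' y1 y1' xx yy].
  by rewrite !divr_gt0.
have -> : h x y - h x' y' = h x (y - y') + h (x - x') y'.
  by rewrite hl hr addrA subrK.
have xM : `|x| <= M.
  have := ler_normB x0 (x0 - x); rewrite opprB addrC subrK => /le_trans; apply.
  by rewrite /M -addrA lerD2l ler_wpDl ?normr_ge0// ltW.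
have yM : `|y'| <= M.
  have := ler_normB y0 (y0 - y'); rewrite opprB addrC subrK => /le_trans; apply.
  by rewrite /M -addrA ler_wpDl ?normr_ge0// lerD2l ltW.
rewrite (splitr e) (le_lt_trans (ler_normD _ _))// ltrD//.
  rewrite (le_lt_trans (hb _ _))//.
  by rewrite (le_lt_trans (ler_wpM2r _ xM))// mulrC -ltr_pdivlMr.
rewrite (le_lt_trans (hb _ _))//.
by rewrite (le_lt_trans (ler_wpM2l _ yM))// -ltr_pdivlMr.
Qed.

End Metrics.

Section MetricOperations.
Context {R : realType} {V : normedModType R}.

Lemma luc_scale : loc_unif_cont2 (mE := norm_metric R^o) (mF := norm_metric V)
  (mG := norm_metric V) *:%R.
Proof.
apply: luc_bilinear => [x x' y|x y y'|x y]; first exact: scalerBl.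
- exact: scalerBr.
- by rewrite normrZ.
Qed.

Lemma luc_norm : loc_unif_cont2 (mE := norm_metric V) (mF := norm_metric V)
  (mG := norm_metric R^o) (fun x _ => `|x| : R^o).
Proof.
move=> x0 y0 e e0; exists e => // x x' y y' _ _ _ _ /= xx _.
by rewrite (le_lt_trans (ler_dist_dist _ _)).
Qed.

Lemma luc_fin : loc_unif_cont2 (mE := norm_metric R^o) (mF := norm_metric R^o)
  (mG := ext_metric) (fun x _ => x%:E).
Proof.
move=> x0 y0 e e0; exists e => // x x' y y' _ _ _ _ /= xx _.
by rewrite (le_lt_trans (ext_dist_fin _ _)).
Qed.

End MetricOperations.

Record dual_pair (R : realType) (X Y : normedModType R) := DualPair {
  pairing :> {bilinear X -> Y -> R^o};
  pairing_sepl : forall x, (forall y, pairing x y = 0) -> x = 0;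
  pairing_sepr : forall y, (forall x, pairing x y = 0) -> y = 0 }.

Definition pairing_bounded (R : realType) (X Y : normedModType R)
    (P : dual_pair X Y) : Prop :=
  forall x y, `|P x y| <= `|x| * `|y|.

(* sigma(X, Y) and sigma(Y, X): the initial topologies for the evaluation maps
   into the pointwise topology. *)
Definition sigmaXY (R : realType) (X Y : normedModType R) (P : dual_pair X Y) :=
  initial_topology (fun x : X => (fun y => P x y) : {ptws Y -> R^o}).
Definition sigmaXY_closed (R : realType) (X Y : normedModType R)
    (P : dual_pair X Y) (B : set X) : Prop := closed (B : set (sigmaXY P)).

Definition sigmaYX (R : realType) (X Y : normedModType R) (P : dual_pair X Y) :=
  initial_topology (fun y : Y => (fun x => P x y) : {ptws X -> R^o}).
Definition sigmaYX_closed (R : realType) (X Y : normedModType R)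
    (P : dual_pair X Y) (B : set Y) : Prop := closed (B : set (sigmaYX P)).

Section ConditionalReals.
Context {d : Order.disp_t} (A : completeBooleanType d) {R : realType}.
Implicit Types a b c : A.

Definition nmcompletion (V : normedModType R) := ccompletion A (norm_metric V).
Definition creal := nmcompletion R^o.
Definition cereal := ccompletion A (ext_metric (R := R)).

Section NormedSpace.
Variable V : normedModType R.
Definition cadd : nmcompletion V -> nmcompletion V -> nmcompletion V :=
  cmap2 luc_add.
Definition csub : nmcompletion V -> nmcompletion V -> nmcompletion V :=
  cmap2 luc_sub.
Definition cscale : creal -> nmcompletion V -> nmcompletion V :=
  cmap2 luc_scale.
End NormedSpace.

Definition cabs (x : creal) : creal := cmap2 luc_norm x x.

(* The order of the conditional reals with the inequality required on a only. *)
Definition cle_on a (x y : creal) : Prop :=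
  forall r : step A R, step_pos r -> exists n0, forall n, step_leN n0 n ->
    step_lt_on a (step_map -%R r)
      (step_map2 (fun s t : R => s - t) (repr y n) (repr x n)).
Definition clt_on a (x y : creal) : Prop :=
  exists2 r : step A R, step_pos r & exists n0, forall n, step_leN n0 n ->
    step_lt_on a r (step_map2 (fun s t : R => s - t) (repr y n) (repr x n)).
Definition cle (x y : creal) : Prop := cle_on \top%O x y.
Definition clt (x y : creal) : Prop := clt_on \top%O x y.

Definition cofr (t : R) : creal := cconst A (norm_metric R^o) t.

Definition ereal_of (x : creal) : cereal := cmap2 luc_fin x x.
Definition epinf : cereal := cconst A ext_metric +oo%E.
Definition eninf : cereal := cconst A ext_metric -oo%E.

(* oo|p + r|q + (-oo)|n, where q is the complement of the join of p and n. *)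
Definition ext_of (p n : A) (r : creal) : cereal :=
  concat (fun o : option bool => match o with
          | Some true => p | Some false => n | None => ~` (p `|` n) end)%O
         (fun o : option bool => match o with
          | Some true => epinf | Some false => eninf | None => ereal_of r end).

(* x = oo|pinf_part x + (-oo)|ninf_part x + fin_part x|fin_dom x; the values of
   [fin_part x] outside [fin_dom x] are irrelevant. *)
Definition pinf_part (x : cereal) : A :=
  bsup [set b : A | cagree b x epinf]%classic.
Definition ninf_part (x : cereal) : A :=
  bsup [set b : A | cagree b x eninf]%classic.
Definition fin_dom (x : cereal) : A := (~` (pinf_part x `|` ninf_part x))%O.
Definition fin_part (x : cereal) : creal :=
  xget point [set r | cagree (fin_dom x) x (ereal_of r)]%classic.

Definition ele (x y : cereal) : Prop :=
  [/\ (pinf_part x <= pinf_part y)%O, (ninf_part y <= ninf_part x)%O &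
      cle_on (fin_dom x `&` fin_dom y)%O (fin_part x) (fin_part y)].

(* The value of oo + (-oo) is -oo, as for the library's extended reals. *)
Definition eadd (x y : cereal) : cereal :=
  ext_of ((pinf_part x `|` pinf_part y) `&` ~` (ninf_part x `|` ninf_part y))%O
         (ninf_part x `|` ninf_part y)%O
         (cadd (fin_part x) (fin_part y)).

Definition pos_part (l : creal) : A :=
  bsup [set b : A | clt_on b (cofr 0) l]%classic.
Definition neg_part (l : creal) : A :=
  bsup [set b : A | clt_on b l (cofr 0)]%classic.

(* On the piece where l = 0 and x is infinite, l * x = 0. *)
Definition escale (l : creal) (x : cereal) : cereal :=
  ext_of ((pos_part l `&` pinf_part x) `|` (neg_part l `&` ninf_part x))%O
         ((pos_part l `&` ninf_part x) `|` (neg_part l `&` pinf_part x))%O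
         (cscale l (fin_part x)).

Definition einf (S : set cereal) : cereal :=
  xget point [set m | (forall x, S x -> ele m x) /\
    (forall m', (forall x, S x -> ele m' x) -> ele m' m)]%classic.
Definition esup (S : set cereal) : cereal :=
  xget point [set m | (forall x, S x -> ele x m) /\
    (forall m', (forall x, S x -> ele x m') -> ele m m')]%classic.

Definition gt_eninf (x : cereal) : Prop :=
  forall a, a != \bot%O -> ~ cagree a x eninf.

End ConditionalReals.

Arguments creal {d} A R.
Arguments cereal {d} A R.
Arguments epinf {d A R}.
Arguments eninf {d A R}.

Section Functions.
Context {d : Order.disp_t} {A : completeBooleanType d} {R : realType}.
Context {X Y : normedModType R} (P : dual_pair X Y) (hP : pairing_bounded P).

Lemma luc_pairing : loc_unif_cont2 (mE := norm_metric X) (mF := norm_metric Y)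
  (mG := norm_metric R^o) (fun x y => P x y).
Proof.
apply: luc_bilinear hP => [x x' y|x y y']; first exact: linearBl.
exact: linearBr.
Qed.

Definition cpairing : nmcompletion A X -> nmcompletion A Y -> creal A R :=
  cmap2 luc_pairing.

Local Open Scope classical_set_scope.

Definition initial_seg (n : step A nat) : set (step A nat) :=
  [set l | step_leN (step_const A 1%N) l /\ step_leN l n].

(* A conditionally finite family is a total map that is only required to be
   stable on [initial_seg n]; its values elsewhere are not used. *)
Definition wnbhs (x : nmcompletion A X) : set (set (nmcompletion A X)) :=
  [set V | exists r n (y : step A nat -> nmcompletion A Y),
    [/\ clt (cofr A 0) r, stable_on (initial_seg n) y &
        V = [set z | forall l, initial_seg n l ->
               cle (cabs (cpairing (csub z x) (y l))) r]]].

Definition step_ext (f : X -> cereal A R) (p : step A X) : cereal A R :=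
  concat p f.

Definition emb (x : X) : nmcompletion A X := cconst A (norm_metric X) x.
Definition emb_step (p : step A X) : nmcompletion A X :=
  cstep (norm_metric X) p.

Definition lsc (f : X -> cereal A R) : Prop :=
  forall x, f x =
    esup [set einf [set step_ext f z | z in [set z | V (emb_step z)]]
         | V in wnbhs (emb x)].

Definition clsc (f : nmcompletion A X -> cereal A R) : Prop :=
  forall x, f x = esup [set einf [set f z | z in V] | V in wnbhs x].

Definition proper_convex (f : X -> cereal A R) : Prop :=
  [/\ forall x, gt_eninf (f x),
      exists x0 r, f x0 = ereal_of r &
      forall x y (t : R), 0 <= t <= 1 ->
        ele (f (t *: x + (1 - t) *: y))
            (eadd (escale (cofr A t) (f x)) (escale (cofr A (1 - t)) (f y)))].

Definition cproper_convex (f : nmcompletion A X -> cereal A R) : Prop :=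
  [/\ forall x, gt_eninf (f x),
      exists x0 r, f x0 = ereal_of r &
      forall x y (l : creal A R), cle (cofr A 0) l -> cle l (cofr A 1) ->
        ele (f (cadd (cscale l x) (cscale (csub (cofr A 1) l) y)))
            (eadd (escale l (f x)) (escale (csub (cofr A 1) l) (f y)))].

End Functions.

(* Main.v *)
(* The extension is the relaxation of f,
     fc x = sup over V in V(x) of inf of f_s over V and X_s,
   which agrees with f on X precisely because f is lower semi-continuous. It is
   conditionally lower semi-continuous by the triangle inequality: if z lies in
   the neighbourhood of x of radius r / 2, then the neighbourhood of z of radius
   r / 2 lies in that of x of radius r. All comparisons are decided on small
   pieces c of the Boolean algebra, on which conditional elements are within a
   real distance of constants: if an inequality fails, it fails on some piece by
   a fixed real gap, and there finitely many conditional data (radii, numbers of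
   functionals, coefficients) can be replaced by constants up to a small error.

   If f is proper convex, finite at x0, and f >= -T-1 on a neighbourhood of x0
   of radius r, then pulling points of a neighbourhood of x towards x0 by a fixed
   homothety bounds f from below there, so fc > -oo. Convexity of fc follows by
   approximating fc x and fc x' by values of f at points xi1 and xi2 of X and the
   coefficient l by a real u: the point u xi1 + (1 - u) xi2 lies in the given
   neighbourhood of l x + (1 - l) x'. *)
Require Import Defs.
From HB Require Import structures.
From mathcomp Require Import all_boot all_order all_algebra.
From mathcomp Require Import all_classical all_reals all_analysis.
From mathcomp Require Import ring lra.

Set Implicit Arguments.
Unset Strict Implicit.
Unset Printing Implicit Defensive.

Import Order.TTheory Order.CTheory GRing.Theory Num.Theory.
Import numFieldNormedType.Exports.

Local Open Scope classical_set_scope.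
Local Open Scope ring_scope.
Local Open Scope quotient_scope.

(* all_analysis exports operations on charges under the same names. *)
Local Notation cadd := Defs.cadd.
Local Notation cscale := Defs.cscale.

(** * Pieces, mixing and local approximation *)

(** The algebra may have no atoms, so a conditional element cannot be evaluated at a point, and an
    element of a completion is a class of sequences whose terms and indices are conditional as well.
    One relation replaces evaluation: [cball c x v e], where x is within e of the constant v on the
    piece c. Agreement, orders and operations are restated through it; afterwards representatives
    serve only for algebraic identities. Membership in a weak neighbourhood is a condition on the
    whole algebra, whereas the arguments produce points that are good on one piece. The bound of the
    pairing by the norms bridges this: on a small piece all functionals of a neighbourhood are
    bounded by one real, so norm approximations by constants satisfy its conditions there, every
    neighbourhood meets X_s, and a point good on one piece can be completed outside it. Infinite
    values enter twice. The order is measured through arctan, and a failed inequality is translated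
    back into two separating reals. In the convexity inequality, 0 times oo is 0, so where a
    coefficient vanishes the inequality comes from stability of the extension and not from
    approximation. *)

Section Density.
Context {d : Order.disp_t} {A : completeBooleanType d}.
Implicit Types a b c : A.

(** Density below a in the sense of forcing: it stands in for a statement at almost every point of
    a. *)
Definition densely a (Q : A -> Prop) : Prop := forall c, c != \bot%O ->
  (c <= a)%O -> exists c', [/\ c' != \bot%O, (c' <= c)%O & Q c'].

Lemma denselyW a b Q : (b <= a)%O -> densely a Q -> densely b Q.
Proof. by move=> ba H c c0 cb; apply: H => //; apply: le_trans ba. Qed.

Lemma densely_imp a (Q Q' : A -> Prop) : (forall c, Q c -> Q' c) ->
  densely a Q -> densely a Q'.
Proof.
by move=> QQ H c c0 /(H _ c0)[c' [? ? /QQ ?]]; exists c'.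
Qed.

Lemma meet_neq0P a c :
  c != \bot%O -> (c `&` a != \bot)%O \/ (c <= ~` a)%O.
Proof.
move=> c0; have [/eqP|ca] := eqVneq (c `&` a)%O \bot%O; last by left.
by rewrite Order.CTBDistrLatticeTheory.disj_leC; right.
Qed.

Lemma le_compl_bot c a : c != \bot%O -> (c <= a)%O -> ~ (c <= ~` a)%O.
Proof.
move=> c0 ca; rewrite -Order.CTBDistrLatticeTheory.disj_leC (meet_idPl ca).
exact/negP.
Qed.

(* The partition is a maximal antichain of pieces that satisfy Q. *)
Lemma mixing (I : Type) (Q : A -> I -> Prop) :
  (forall c, c != \bot%O -> exists c' i, [/\ c' != \bot%O, (c' <= c)%O & Q c' i]) ->
  exists (J : Type) (a : J -> A) (x : J -> I),
    is_partition a /\ forall j, Q (a j) (x j).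
Proof.
move=> dQ; pose P (D : set A) := (forall c, D c -> c != \bot%O /\ exists i, Q c i) /\
  (forall c c', D c -> D c' -> c <> c' -> c `&` c' = \bot)%O.
have [F FP tF|D [[D1 D2] Dmax]] := @Zorn_bigcup A P.
  split=> [c [D FD Dc]|c c' [D FD Dc] [D' FD' Dc']]; first exact: (FP _ FD).1.
  have [DD|DD] := tF _ _ FD FD'; last by apply: (FP _ FD).2 => //; apply: DD.
  by apply: (FP _ FD').2 => //; apply: DD.
have /boolp.choice[x xP] (j : {c | D c}) : exists i, Q (projT1 j) i.
  by case: j => c Dc; exact: (D1 _ Dc).2.
exists {c | D c}, (fun j => projT1 j), x; split=> //.
apply: partition_dense => [[c Dc] [c' Dc'] /= ne|c c0].
  by apply: D2 => // cc'; apply: ne; exact: eq_exist.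
apply: contrapT => H; have {}H b : D b -> (c `&` b = \bot)%O.
  by move=> Db; apply/eqP/negPn/negP => cb; apply: H; exists (exist _ b Db).
have [c1 [i [c10 c1c Qc1]]] := dQ _ c0.
have c1D b : D b -> (c1 `&` b = \bot)%O.
  move=> /H cb; apply/eqP; rewrite -lex0 -cb; exact: leI2.
apply: (Dmax (D `|` [set c1])); split.
- by left.
- move=> /(_ c1 (or_intror erefl)) /c1D; rewrite meetxx => e.
  by move: c10; rewrite e eqxx.
- by move=> c2 [/D1//|->]; split=> //; exists i.
- move=> c2 c3 [Dc2|->] [Dc3|->] ne //.
  + by apply: D2.
  + by rewrite meetC c1D.
  + by rewrite c1D.
Qed.

(** Several pieces of the antichain may carry the same value z, and [p z] is their join. Q need not
    hold on a join, so only density below [p z] survives. *)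
Lemma mixing_step (E : Type) (Q : A -> E -> Prop) :
  (forall c c' z, (c' <= c)%O -> Q c z -> Q c' z) ->
  (forall c, c != \bot%O -> exists c' z, [/\ c' != \bot%O, (c' <= c)%O & Q c' z]) ->
  exists p : step A E, forall c z, c != \bot%O -> (c <= p z)%O ->
    densely c (fun c' => Q c' z).
Proof.
move=> Qle /mixing[J [a [x [pa xP]]]]; exists (step_of x pa).
move=> c z c0 cz c1 c10 c1c.
have [c2 [j [c20 c21 c2j <-]]] := step_of_decide c10 (le_trans c1c cz).
by exists c2; split=> //; apply: Qle (xP j).
Qed.

Lemma step_extP (E : Type) (p q : step A E) :
  densely \top%O (fun c => exists2 z, (c <= p z)%O & (c <= q z)%O) -> p = q.
Proof.
move=> H; apply/step_agree_top/step_agreeP/step_relP => c x y c0 _ cx cy.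
have [c' [c'0 c'c [z pz qz]]] := H c c0 (lex1 _).
rewrite (step_inj c'0 (le_trans c'c cx) pz).
by rewrite (step_inj c'0 (le_trans c'c cy) qz).
Qed.

Lemma concat2P (X : condSetType A) c (x y : X) :
  exists z, cagree c z x /\ cagree (~` c)%O z y.
Proof.
exists (concat (part2 c) (fun b : bool => if b then x else y)); split.
  exact: (concatP _ (part2P c) true).
exact: (concatP _ (part2P c) false).
Qed.

(** The argument of [stable_cagree] only glues x and y, so stability on D is enough. It is applied
    to the families of a weak neighbourhood, which are stable on an initial segment only. *)
Lemma stable_on_cagree (X Y : condSetType A) (D : set X) (f : X -> Y) a x y :
  stable_on D f -> D x -> D y -> cagree a x y -> cagree a (f x) (f y).
Proof.
move=> sf Dx Dy xy; pose g z (i : bool) := if i then z else x.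
have e : concat (part2 a) (g x) = concat (part2 a) (g y).
  apply: (cagree_eq (part2P a)) => i.
  apply: (cagree_trans (concatP _ (part2P a) i)).
  apply: cagree_trans (cagree_sym (concatP _ (part2P a) i)).
  by case: i => //; apply: cagree_refl.
have fP z : D z -> cagree a (f (concat (part2 a) (g z))) (f z).
  move=> Dz; rewrite sf; [exact: (concatP _ (part2P a) true)|exact: part2P|].
  by case.
by apply: cagree_trans (fP y Dy); rewrite -e; apply/cagree_sym/fP.
Qed.

End Density.

Lemma step_pos_div {d : Order.disp_t} {A : completeBooleanType d} {R : realType}
  (r : step A R) (k : R) : 0 < k -> step_pos r -> step_pos (step_map (fun t => t / k) r).
Proof.
move=> k0 /step_posP r0; apply/step_posP => c t c0 ct.
have [c' [s [c'0 c'c cs <-]]] := step_map_decide c0 ct.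
by rewrite divr_gt0//; apply: r0 cs.
Qed.

Section LocalBalls.
Context {d : Order.disp_t} {A : completeBooleanType d} {R : realType}.
Context {E : pointedType} {m : pmetric R E}.
Implicit Types (a b c : A) (x y : ccompletion A m) (v w : E) (e : R).

(* The distance between x and v is at most e on the piece c. Letting e' > e vary
   makes the condition closed, hence local in c and independent of the
   representative (cball_closed, cball_cagree). *)
Definition cball c x v e : Prop := forall e', e < e' -> exists n0, forall n,
  step_leN n0 n -> forall c' z, c' != \bot%O -> (c' <= c)%O ->
    (c' <= repr x n z)%O -> m z v < e'.

Lemma cball_le c c' x v e : (c' <= c)%O -> cball c x v e -> cball c' x v e.
Proof.
move=> cc H e' /H[n0 n0P]; exists n0 => n /n0P{}n0P b z b0 bc.
by apply: n0P => //; apply: le_trans cc.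
Qed.

Lemma cballW c x v w e e' : e + m v w <= e' -> cball c x v e -> cball c x w e'.
Proof.
move=> ee H e1 e1P; have /H[n0 n0P] : e < e1 - m v w.
  by rewrite ltrBrDr (le_lt_trans ee).
exists n0 => n /n0P {}n0P b z b0 bc /(n0P _ _ b0 bc); rewrite ltrBrDr.
by apply: le_lt_trans; exact: pdist_triangle.
Qed.

Lemma cballWr c x v e e' : e <= e' -> cball c x v e -> cball c x v e'.
Proof. by move=> ee; apply: cballW; rewrite pdistxx addr0. Qed.

(** The Cauchy property makes a late term of a representative an approximation of its own class,
    with error r. This is how a representative is turned into balls. *)
Lemma cball_tail x r : step_pos r -> exists n0, forall n, step_leN n0 n ->
  forall c v e, c != \bot%O -> (c <= repr x n v)%O -> (c <= r e)%O -> cball c x v e.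
Proof.
move=> r0; have [n0 n0P] := cauchy_cauchy (repr x) r0.
exists n0 => n nP c v e c0 cv ce e' ee'; exists n0 => k kP b z b0 bc bz.
have /step_relP H := n0P k n kP nP; apply: lt_trans ee'.
apply: (H b _ _ b0 (lex1 _)).
  by apply: step_map2_le => //; apply: le_trans cv.
exact: le_trans ce.
Qed.

Lemma cball_dense c x e : 0 < e -> c != \bot%O ->
  exists c' v, [/\ c' != \bot%O, (c' <= c)%O & cball c' x v e].
Proof.
move=> e0 c0; have [n0 n0P] := cball_tail x (@step_pos_const _ A _ _ e0).
have [c' [v [c'0 c'c c'v]]] := step_decide (repr x n0) c0.
exists c', v; split=> //; apply: n0P c'v _ => //; first exact: step_leN_refl.
exact: step_const_le.
Qed.

(** Both constants are compared with the value of one late term on a smaller piece. This consistency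
    is the source of every later contradiction between bounds. *)
Lemma cball_cons c x v w e e' : c != \bot%O ->
  cball c x v e -> cball c x w e' -> m v w <= e + e'.
Proof.
move=> c0 xv xw; apply/ler_addgt0Pr => t t0; have t20 : 0 < t / 2 by rewrite divr_gt0.
have [|n1 n1P] := xv (e + t / 2); first by rewrite ltrDl.
have [|n2 n2P] := xw (e' + t / 2); first by rewrite ltrDl.
have [n nP] := step_leN_max n1 n2.
have [k1 k2] := nP _ (@step_leN_refl _ _ _).
have [c1 [z [c10 c1c c1z]]] := step_decide (repr x n) c0.
have h1 := n1P _ k1 _ _ c10 c1c c1z; have h2 := n2P _ k2 _ _ c10 c1c c1z.
have := pdist_triangle m v z w; rewrite (pdistC m v z).
by move: h1 h2; move: (m z v) (m z w) (m v w) => *; lra.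
Qed.

Lemma cball_ge0 c x v e : c != \bot%O -> cball c x v e -> 0 <= e.
Proof.
move=> c0 xv; have := cball_cons c0 xv xv.
by rewrite pdistxx -mulr2n pmulrn_lge0.
Qed.

Lemma cball_cagree c x y v e : cagree c x y -> cball c x v e -> cball c y v e.
Proof.
move=> xy xv e' ee'; set t := (e' - e) / 2.
have t0 : 0 < t by rewrite divr_gt0 ?subr_gt0.
have [|n1 n1P] := xv (e + t); first by rewrite ltrDl.
have [n2 n2P] := xy _ (@step_pos_const _ A _ _ t0).
have [n nP] := step_leN_max n1 n2; exists n => k /nP[k1 k2] b z b0 bc bz.
have [b' [z' [b'0 b'b b'z']]] := step_decide (repr x k) b0.
have h1 := n1P _ k1 _ _ b'0 (le_trans b'b bc) b'z'.
have /step_relP h2 := n2P _ k2.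
have {}h2 := h2 b' _ _ b'0 (le_trans b'b bc)
  (step_map2_le m b'z' (le_trans b'b bz)) (step_const_le _ _).
have := pdist_triangle m z z' v; rewrite (pdistC m z z').
have -> : e' = e + t + t by rewrite /t; lra.
by move: h1 h2; move: (m z' v) (m z' z) (m z v) => *; lra.
Qed.

(** The index n0 comes from the Cauchy property alone, before any piece is chosen, so it serves all
    pieces at once. A late term is a ball of radius t around its value, and consistency on a smaller
    piece gives a distance of at most e + 2t, below e' = e + 4t. *)
Lemma cball_closed c x v e :
  (forall t, 0 < t -> densely c (fun c' => cball c' x v (e + t))) -> cball c x v e.
Proof.
move=> H e' ee'; set t := (e' - e) / 4.
have t0 : 0 < t by rewrite divr_gt0 ?subr_gt0.
have [n0 n0P] := cball_tail x (@step_pos_const _ A _ _ t0).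
exists n0 => n nP b z b0 bc bz.
have [b' [b'0 b'b b'v]] := H _ t0 _ b0 bc.
have := cball_cons b'0 (n0P n nP b' z t b'0 (le_trans b'b bz) (step_const_le _ _)) b'v.
move/le_lt_trans; apply; rewrite /t; lra.
Qed.

Lemma cball_local c x v e : densely c (fun c' => cball c' x v e) -> cball c x v e.
Proof.
move=> H; apply: cball_closed => t t0; apply: densely_imp H => c'.
by apply: cballWr; rewrite lerDl ltW.
Qed.

Lemma cball_agree a x y :
  (forall e, 0 < e -> densely a (fun c => exists2 v, cball c x v e & cball c y v e)) ->
  cagree a x y.
Proof.
move=> H r r0; pose r4 := step_map (fun t : R => t / 4) r.
have r40 : step_pos r4 by exact: step_pos_div.
have [n1 n1P] := cball_tail x r40; have [n2 n2P] := cball_tail y r40.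
have [n nP] := step_leN_max n1 n2; exists n => k /nP[k1 k2].
apply/step_relP => c t s c0 ca ct cs.
have [c1 [z [z' [c10 c1c c1z c1z' <-]]]] := step_map2_decide c0 ct.
have {}cs := le_trans c1c cs; have {}ca := le_trans c1c ca.
have s0 : 0 < s by move/step_posP : r0; apply; [exact: c10|].
have s4 : (c1 <= r4 (s / 4))%O by apply: step_map_le.
(* Each sequence contributes s/4 from its tail and s/8 from the common approximation, in total 3s/4
   < s. *)
have [|c2 [c20 c21 [v xv yv]]] := H (s / 8) _ c1 c10 ca; first by rewrite divr_gt0.
have h1 := cball_cons c20 (cball_le c21 (n1P _ k1 _ _ _ c10 c1z s4)) xv.
have h2 := cball_cons c20 (cball_le c21 (n2P _ k2 _ _ _ c10 c1z' s4)) yv.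
apply: (le_lt_trans (pdist_triangle m z v z')); rewrite (pdistC m v z').
by move: h1 h2; move: (m z v) (m z' v) => *; lra.
Qed.

Lemma cagree_local a x y : densely a (fun c => cagree c x y) -> cagree a x y.
Proof.
move=> H; apply: cball_agree => e e0 c c0 /(H _ c0)[c1 [c10 c1c c1xy]].
have [c2 [v [c20 c21 xv]]] := cball_dense x e0 c10.
exists c2; split=> //; first exact: le_trans c1c.
by exists v => //; apply: cball_cagree xv; apply: cagree_le c1xy.
Qed.

Lemma cball_cstep c (p : step A E) v : (c <= p v)%O -> cball c (cstep m p) v 0.
Proof.
move=> cv e' e'0.
have [n0 n0P] := repr_pi_agree c (CauchySeq (stable_cst p) (is_cauchy_cst m p))
  (@step_pos_const _ A _ _ e'0).
exists n0 => n /n0P/step_relP H b z b0 bc bz.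
apply: (H b _ _ b0 bc _ (step_const_le _ _)).
by apply: step_map2_le => //=; apply: le_trans cv.
Qed.

Lemma cball_cconst c v : cball c (cconst A m v) v 0.
Proof. by apply: cball_cstep; apply: step_const_le. Qed.

Lemma cstep_agree_const c (p : step A E) v :
  (c <= p v)%O -> cagree c (cstep m p) (cconst A m v).
Proof.
move=> cv; apply: cball_agree => e e0 b b0 bc; exists b; split=> //.
exists v; apply: (cballWr (ltW e0)); last exact: cball_cconst.
by apply: cball_cstep; apply: le_trans cv.
Qed.

Lemma inv_archi (t : R) : 0 < t ->
  exists k : nat, forall l, (k <= l)%N -> l.+1%:R^-1 < t.
Proof.
move=> t0; exists (Num.trunc t^-1) => l kl.
rewrite invf_plt ?posrE// (lt_le_trans (truncnS_gt _))//.
by rewrite ler_nat ltnS.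
Qed.

(* The data N c v e, read as: the distance to v is at most e on c, determine an
   element: mix the values with e = 1 / (k + 1) into the k-th step function. *)
Section Construction.
Variable N : A -> E -> R -> Prop.
Hypothesis Nle : forall c c' v e, (c' <= c)%O -> N c v e -> N c' v e.
Hypothesis Ndense : forall c e, 0 < e -> c != \bot%O ->
  exists c' v, [/\ c' != \bot%O, (c' <= c)%O & N c' v e].
Hypothesis Ncons : forall c v w e e', c != \bot%O ->
  N c v e -> N c w e' -> m v w <= e + e'.

Lemma cball_construct : exists x, forall c v e, N c v e -> cball c x v e.
Proof.
have /boolp.choice[f fP] (k : nat) : exists p : step A E, forall c z, c != \bot%O ->
    (c <= p z)%O -> densely c (fun c' => N c' z k.+1%:R^-1).
  apply: mixing_step => [c c' z|c c0]; first exact: Nle.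
  by apply: Ndense => //; rewrite invr_gt0.
(* A conditional index n takes the value k on the piece [n k]; concatenating the [f k] along n is
   the stable extension of f to conditional indices. *)
pose u (n : step A nat) := concat n f.
have uP (n : step A nat) k : cagree (n k) (u n) (f k) by exact: (concatP _ (step_partition n)).
have su : stable u.
  apply: cagree_stable => a n n' nn; apply: (cagree_parts (step_partition n)) => k.
  apply: cagree_trans (cagree_le (leIl _ _) (uP n k)) _; apply: cagree_sym.
  apply: cagree_le (uP n' k).
  by apply: (step_agree_le nn); [apply: leIr|apply: leIl].
have uN (n : step A nat) c z : c != \bot%O -> (c <= u n z)%O ->
    exists c' k, [/\ c' != \bot%O, (c' <= c)%O, (c' <= n k)%O & N c' z k.+1%:R^-1].
  move=> c0 cz; have [c1 [k [c10 c1c c1k]]] := step_decide n c0.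
  have c1z := step_agree_le (uP n k) c1k (le_trans c1c cz).
  have [c2 [c20 c21 c2N]] := fP k c1 z c10 c1z c1 c10 (lexx _).
  by exists c2, k; split=> //; [apply: le_trans c1c|apply: le_trans c1k].
have cu : is_cauchy m u.
  move=> r /step_posP r0.
  have /boolp.choice[g gP] (t : R) : exists k : nat, 0 < t ->
      forall l, (k <= l)%N -> l.+1%:R^-1 < t / 2.
    have [t0|t0] := ltP 0 t; last by exists 0%N.
    by have [k kP] := inv_archi (divr_gt0 t0 (ltr0n _ 2)); exists k.
  (* The modulus depends on the value of r, so the threshold is itself conditional: it equals [g t]
     where r equals t. *)
  exists (step_map g r) => k l /step_relP kP /step_relP lP.
  apply/step_relP => c s t c0 _ cs ct.
  have [c1 [z [z' [c10 c1c c1z c1z' <-]]]] := step_map2_decide c0 cs.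
  have [c2 [i [c20 c21 c2i Ni]]] := uN _ _ _ c10 c1z.
  have [c3 [j [c30 c32 c3j Nj]]] := uN _ _ _ c20 (le_trans c21 c1z').
  have {}ct : (c3 <= r t)%O by rewrite (le_trans c32)// (le_trans c21)// (le_trans c1c).
  have t0 := r0 _ _ c30 ct.
  have gi := kP c3 _ _ c30 (lex1 _) (step_map_le g ct) (le_trans c32 c2i).
  have gj := lP c3 _ _ c30 (lex1 _) (step_map_le g ct) c3j.
  apply: le_lt_trans (Ncons c30 (Nle c32 Ni) Nj) _.
  by rewrite (splitr t) ltrD// gP.
exists (\pi_(ccompletion A m) (CauchySeq su cu)) => c v e Nv e' ee'.
set t := (e' - e) / 2; have t0 : 0 < t by rewrite divr_gt0 ?subr_gt0.
have [n1 n1P] := repr_pi_agree c (CauchySeq su cu) (@step_pos_const _ A _ _ t0).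
have [k kP] := inv_archi t0.
have [n nP] := step_leN_max n1 (step_const A k).
exists n => l /nP[/n1P/step_relP l1 /step_relP l2] b z b0 bc bz.
have [b1 [z' [b10 b1b b1z']]] := step_decide (u l) b0.
have [b2 [i [b20 b21 b2i Ni]]] := uN _ _ _ b10 b1z'.
have ki := l2 b2 _ _ b20 (lex1 _) (step_const_le _ _) b2i.
have b2b := le_trans b21 b1b.
have h1 := l1 b2 _ _ b20 (le_trans b2b bc)
  (step_map2_le m (le_trans b2b bz) (le_trans b21 b1z')) (step_const_le _ _).
have h2 := Ncons b20 Ni (Nle (le_trans b2b bc) Nv).
apply: (le_lt_trans (pdist_triangle m z z' v)).
have -> : e' = t + (t + e) by rewrite /t; lra.
by apply: ltrD => //; apply: le_lt_trans h2 _; rewrite ltrD2r kP.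
Qed.

End Construction.

End LocalBalls.

(** * Operations and order of the conditional reals *)

Section Maps.
Context {d : Order.disp_t} {A : completeBooleanType d} {R : realType}.
Context {E F G : pointedType} {mE : pmetric R E} {mF : pmetric R F}.
Context {mG : pmetric R G} (h : E -> F -> G)
  (hh : loc_unif_cont2 (mE := mE) (mF := mF) (mG := mG) h).
Implicit Types (a c : A) (e : R).

(** The tolerance t' matches the slack in [cball], which admits every radius above the stated one.
    Each operation then only needs an estimate between constants. *)
Lemma cball_map2 c (x : ccompletion A mE) (y : ccompletion A mF) v w e1 e2 e3 :
  (forall t, 0 < t -> exists2 t', 0 < t' & forall v' w',
     mE v' v < e1 + t' -> mF w' w < e2 + t' -> mG (h v' w') (h v w) < e3 + t) ->
  cball c x v e1 -> cball c y w e2 -> cball c (cmap2 hh x y) (h v w) e3.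
Proof.
move=> H xv yw e' ee'; set t := (e' - e3) / 2.
have t0 : 0 < t by rewrite divr_gt0 ?subr_gt0.
have [t' t'0 t'P] := H _ t0.
have [|n1 n1P] := xv (e1 + t'); first by rewrite ltrDl.
have [|n2 n2P] := yw (e2 + t'); first by rewrite ltrDl.
have [n3 n3P] := repr_pi_agree c (seq_map2 hh (repr x) (repr y))
  (@step_pos_const _ A _ _ t0).
have [n12 n12P] := step_leN_max n1 n2; have [n nP] := step_leN_max n12 n3.
exists n => k /nP[/n12P[k1 k2] /n3P/step_relP k3] b z b0 bc bz.
have [b1 [v' [b10 b1b b1v']]] := step_decide (repr x k) b0.
have [b2 [w' [b20 b21 b2w']]] := step_decide (repr y k) b10.
have b2b := le_trans b21 b1b.
have l1 := n1P _ k1 _ _ b10 (le_trans b1b bc) b1v'.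
have l2 := n2P _ k2 _ _ b20 (le_trans b2b bc) b2w'.
have := k3 b2 _ _ b20 (le_trans b2b bc) (step_map2_le mG (le_trans b2b bz)
  (step_map2_le h (le_trans b21 b1v') b2w')) (step_const_le _ _).
move=> l3; apply: (le_lt_trans (pdist_triangle mG z (h v' w') _)).
have -> : e' = t + (e3 + t) by rewrite /t; lra.
by rewrite ltrD// t'P.
Qed.

Lemma cmap2_agree a (x x' : ccompletion A mE) (y y' : ccompletion A mF) :
  cagree a x x' -> cagree a y y' -> cagree a (cmap2 hh x y) (cmap2 hh x' y').
Proof. by move=> xx yy; apply/ccomp_agreeP; apply: seq_map2_agree. Qed.

End Maps.

Section RealOrder.
Context {d : Order.disp_t} {A : completeBooleanType d} {R : realType}.
Implicit Types (a b c : A) (x y z : creal A R) (v w e t : R).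

(** This removes representatives from the order: an inequality fails exactly when some piece carries
    approximations that separate the two sides. *)
Lemma cle_onP a x y : cle_on a x y <->
  forall c v w e e', c != \bot%O -> (c <= a)%O ->
    cball c x v e -> cball c y w e' -> v <= w + e + e'.
Proof.
split=> [H c v w e e' c0 ca xv yw|H r r0].
  rewrite leNgt; apply/negP => lt; set t := (v - (w + e + e')) / 4.
  have t0 : 0 < t by rewrite divr_gt0 ?subr_gt0.
  have [|n1 n1P] := xv (e + t); first by rewrite ltrDl.
  have [|n2 n2P] := yw (e' + t); first by rewrite ltrDl.
  have [n3 n3P] := H _ (@step_pos_const _ A _ _ t0).
  have [n12 n12P] := step_leN_max n1 n2; have [n nP] := step_leN_max n12 n3.
  have [/n12P[k1 k2] /n3P/step_relP k3] := nP _ (@step_leN_refl _ _ _).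
  have [c1 [z [c10 c1c c1z]]] := step_decide (repr x n) c0.
  have [c2 [z' [c20 c21 c2z']]] := step_decide (repr y n) c10.
  have := n1P _ k1 _ _ c10 c1c c1z.
  have := n2P _ k2 _ _ c20 (le_trans c21 c1c) c2z'.
  have := k3 c2 _ _ c20 (le_trans (le_trans c21 c1c) ca)
    (step_map_le -%R (step_const_le t _)) (step_map2_le _ c2z' (le_trans c21 c1z)).
  rewrite /= !ltr_norml => h1 /andP[h2 h3] /andP[h4 h5].
  by move: h1 h2 h3 h4 h5 lt; rewrite /t; lra.
(* Two errors of r/4 leave a difference of at least -r/2, which exceeds -r. *)
have r40 := step_pos_div (ltr0n R 4) r0.
have [n1 n1P] := cball_tail x r40; have [n2 n2P] := cball_tail y r40.
have [n nP] := step_leN_max n1 n2; exists n => k /nP[k1 k2].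
apply/step_relP => c s t c0 ca cs ct.
have [c1 [u [c10 c1c c1u <-]]] := step_map_decide c0 cs.
have [c2 [z' [z [c20 c21 c2z' c2z <-]]]] := step_map2_decide c10 (le_trans c1c ct).
have c2u := step_map_le (fun t : R => t / 4) (le_trans c21 c1u).
have u0 : 0 < u by move/step_posP : r0; apply; [exact: c10|].
have := H c2 _ _ _ _ c20 (le_trans (le_trans c21 c1c) ca)
  (n1P _ k1 _ _ _ c20 c2z c2u) (n2P _ k2 _ _ _ c20 c2z' c2u).
by move: u0; clear; lra.
Qed.

(** The strict order asks for a single positive step function below the difference. It is mixed from
    the real gaps found on small pieces. *)
Lemma clt_onP a x y : clt_on a x y <->
  densely a (fun c => exists v w e e',
    [/\ cball c x v e, cball c y w e' & v + e + e' < w]).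
Proof.
split=> [[r /step_posP r0 [n0 n0P]] c c0 ca|H].
  have [c1 [s [c10 c1c c1s]]] := step_decide r c0.
  have s0 := r0 _ _ c10 c1s; have s80 : 0 < s / 8 by rewrite divr_gt0.
  have [n1 n1P] := cball_tail x (@step_pos_const _ A _ _ s80).
  have [n2 n2P] := cball_tail y (@step_pos_const _ A _ _ s80).
  have [n12 n12P] := step_leN_max n1 n2; have [n nP] := step_leN_max n12 n0.
  have [/n12P[k1 k2] /n0P/step_relP k3] := nP _ (@step_leN_refl _ _ _).
  have [c2 [z [c20 c21 c2z]]] := step_decide (repr x n) c10.
  have [c3 [z' [c30 c32 c3z']]] := step_decide (repr y n) c20.
  have c31 := le_trans c32 c21; have c3c := le_trans c31 c1c.
  have := k3 c3 _ _ c30 (le_trans c3c ca) (le_trans c31 c1s)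
    (step_map2_le _ c3z' (le_trans c32 c2z)).
  exists c3; split=> //; exists z, z', (s / 8), (s / 8); split.
  - exact: n1P _ k1 _ _ _ c30 (le_trans c32 c2z) (step_const_le _ _).
  - exact: n2P _ k2 _ _ _ c30 c3z' (step_const_le _ _).
  - by lra.
pose gap c t := 0 < t /\ forall c' v w e e', c' != \bot%O -> (c' <= c)%O ->
  (c' <= a)%O -> cball c' x v e -> cball c' y w e' -> v + t <= w + e + e'.
have [c c' t c'c [t0 H']|c c0|p pP] := @mixing_step _ A R gap.
- split=> // b v w e e' b0 bc; apply: H' => //; exact: le_trans c'c.
- have [ca|ca] := meet_neq0P a c0; last first.
    (* Outside a the gap condition is vacuous, and 1 is a placeholder that keeps the mixed function
       positive. *)
    exists c, 1; split=> //; split=> // b v w e e' b0 bc ba.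
    by case: (le_compl_bot b0 ba (le_trans bc ca)).
  have [c1 [c10 c1c [v [w [e [e' [xv yw lt]]]]]]] := H _ ca (leIr _ _).
  exists c1, (w - (v + e + e')); split=> //; first exact: le_trans c1c (leIl _ _).
  split; first by rewrite subr_gt0.
  move=> b v2 w2 e2 e2' b0 bc _ xv2 yw2.
  have /= := cball_cons b0 (cball_le bc xv) xv2; have /= := cball_cons b0 (cball_le bc yw) yw2.
  rewrite !ler_norml => /andP[h1 h2] /andP[h3 h4]; lra.
have p0 : step_pos p.
  apply/step_posP => c t c0 ct.
  by have [c' [_ _ []]] := pP c t c0 ct c c0 (lexx _).
(* With tails of error p/8, the difference of the terms is at least 3p/4, hence above p/2. *)
exists (step_map (fun t => t / 2) p); first exact: step_pos_div.
have p80 := step_pos_div (ltr0n R 8) p0.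
have [n1 n1P] := cball_tail x p80; have [n2 n2P] := cball_tail y p80.
have [n nP] := step_leN_max n1 n2; exists n => k /nP[k1 k2].
apply/step_relP => c s t c0 ca cs ct.
have [c1 [u [c10 c1c c1u <-]]] := step_map_decide c0 cs.
have [c2 [z' [z [c20 c21 c2z' c2z <-]]]] := step_map2_decide c10 (le_trans c1c ct).
have [c3 [c30 c32 [u0 gapu]]] := pP _ _ c10 c1u c2 c20 c21.
have c31 := le_trans c32 c21.
have c3u := step_map_le (fun t : R => t / 8) (le_trans c31 c1u).
have := gapu c3 _ _ _ _ c30 (lexx _) (le_trans (le_trans c31 c1c) ca)
  (n1P _ k1 _ _ _ c30 (le_trans c32 c2z) c3u)
  (n2P _ k2 _ _ _ c30 (le_trans c32 c2z') c3u).
by move: u0; clear; lra.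
Qed.

Lemma cle_on_le a b x y : (b <= a)%O -> cle_on a x y -> cle_on b x y.
Proof.
move=> ba /cle_onP H; apply/cle_onP => c v w e e' c0 cb.
by apply: H => //; apply: le_trans ba.
Qed.

Lemma cle_onI a x y : (forall t, 0 < t -> densely a (fun c => exists v w,
    [/\ cball c x v t, cball c y w t & v <= w + t])) -> cle_on a x y.
Proof.
move=> H; apply/cle_onP => c v w e e' c0 ca xv yw.
apply/ler_addgt0Pr => t t0.
have [|c' [c'0 c'c [v' [w' [xv' yw' vw]]]]] := H (t / 3) _ c c0 ca.
  by rewrite divr_gt0.
have /= := cball_cons c'0 (cball_le c'c xv) xv'.
have /= := cball_cons c'0 (cball_le c'c yw) yw'.
rewrite !ler_norml => /andP[h1 h2] /andP[h3 h4]; lra.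
Qed.

Lemma cle_on_local a x y : densely a (fun c => cle_on c x y) -> cle_on a x y.
Proof.
move=> H; apply/cle_onP => c v w e e' c0 ca xv yw.
have [c' [c'0 c'c /cle_onP]] := H _ c0 ca.
by apply; [exact: c'0|exact: lexx|exact: cball_le xv|exact: cball_le yw].
Qed.

Lemma cle_on_agree a x x' y y' :
  cagree a x x' -> cagree a y y' -> cle_on a x y -> cle_on a x' y'.
Proof.
move=> xx yy /cle_onP H; apply/cle_onP => c v w e e' c0 ca xv yw.
apply: (H c) => //; [move: xv|move: yw]; apply: cball_cagree; apply: cagree_sym.
  exact: cagree_le xx.
exact: cagree_le yy.
Qed.

Lemma cle_onN a x y : ~ cle_on a x y -> exists c v w e e',
  [/\ c != \bot%O, (c <= a)%O, cball c x v e, cball c y w e' & w + e + e' < v].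
Proof.
move=> H; apply: contrapT => H'; apply: H; apply/cle_onP => c v w e e' c0 ca xv yw.
by rewrite leNgt; apply/negP => lt; apply: H'; exists c, v, w, e, e'.
Qed.

Lemma cball_cofr c t : cball c (cofr A t) t 0.
Proof. exact: cball_cconst. Qed.

Lemma cball_cle c x v e :
  cball c x v e -> cle_on c (cofr A (v - e)) x /\ cle_on c x (cofr A (v + e)).
Proof.
move=> xv; split; apply/cle_onP => c' u w t t' c'0 c'c uP wP.
  have /= := cball_cons c'0 uP (cball_cofr c' _).
  have /= := cball_cons c'0 wP (cball_le c'c xv).
  by rewrite !ler_norml => /andP[? ?] /andP[? ?]; lra.
have /= := cball_cons c'0 wP (cball_cofr c' _).
have /= := cball_cons c'0 uP (cball_le c'c xv).
by rewrite !ler_norml => /andP[? ?] /andP[? ?]; lra.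
Qed.

(** Replaces a conditional radius by a real one: on a small piece a positive r is bounded below by a
    real s > 0. *)
Lemma clt_cofrP a x t : clt_on a (cofr A t) x <->
  densely a (fun c => exists2 s, t < s & cle_on c (cofr A s) x).
Proof.
rewrite clt_onP; split=> H c c0 ca.
  have [c' [c'0 c'c [v [w [e [e' [tv xw lt]]]]]]] := H c c0 ca.
  exists c'; split=> //; exists (w - e'); last exact: (cball_cle xw).1.
  have /= := cball_cons c'0 tv (cball_cofr c' _).
  by rewrite ler_norml => /andP[? ?]; lra.
have [c1 [c10 c1c [s ts /cle_onP xs]]] := H c c0 ca.
have ts4 : 0 < (s - t) / 4 by rewrite divr_gt0 ?subr_gt0.
have [c2 [v [c20 c21 xv]]] := cball_dense x ts4 c10.
exists c2; split; rewrite ?(le_trans c21)//.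
exists t, v, 0, ((s - t) / 4); split=> //; first exact: cball_cofr.
have := xs _ _ _ _ _ c20 c21 (cball_cofr _ _) xv; lra.
Qed.

End RealOrder.

Lemma regular_scaleE (R : realType) (t : R) (u : R^o) : t *: u = t * (u : R).
Proof. by []. Qed.

Section Pairing.
Context {R : realType} {X Y : normedModType R} (P : dual_pair X Y).

Lemma pairingBl x x' y : P (x - x') y = P x y - P x' y.
Proof. exact: linearBl. Qed.

Lemma pairingDl x x' y : P (x + x') y = P x y + P x' y.
Proof. exact: linearDl. Qed.

Lemma pairingZl (t : R) x y : P (t *: x) y = t * P x y.
Proof. exact: linearZl_LR. Qed.

Lemma pairingBr x y y' : P x (y - y') = P x y - P x y'.
Proof. exact: linearBr. Qed.

Lemma pairing0l y : P 0 y = 0.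
Proof. exact: linear0l. Qed.

End Pairing.

(** * Algebraic identities in the completions *)

Section Identities.
Context {d : Order.disp_t} {A : completeBooleanType d} {R : realType}.

(** Identities are inherited from the ground spaces term by term: at each index both step functions
    take the same value on small pieces. The representatives u and v are found by unification. *)
Lemma ccompletion_eq (E : pointedType) (m : pmetric R E) (x y : ccompletion A m)
    (u v : cauchy_seq A m) :
  x = \pi_(ccompletion A m) u -> y = \pi_(ccompletion A m) v ->
  (forall n, densely \top%O (fun c => exists z z',
     [/\ (c <= u n z)%O, (c <= v n z')%O & z = z'])) ->
  x = y.
Proof.
move=> -> -> H; apply: ccomp_agree_top; apply/ccomp_agreeP/seq_agree_eq => n.
suff -> : u n = v n by exact: cagree_refl.
apply: step_extP => c c0 _.
have [c' [c'0 c'c [z [z' [uz vz zz]]]]] := H n c c0 (lex1 _).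
by exists c'; split=> //; exists z => //; rewrite zz.
Qed.

Lemma cmap2_repr (E F G : pointedType) (mE : pmetric R E) (mF : pmetric R F)
    (mG : pmetric R G) (h : E -> F -> G)
    (hh : loc_unif_cont2 (mE := mE) (mF := mF) (mG := mG) h)
    (x : ccompletion A mE) (y : ccompletion A mF) u v :
  x = \pi_(ccompletion A mE) u -> y = \pi_(ccompletion A mF) v ->
  cmap2 hh x y = \pi_(ccompletion A mG) (seq_map2 hh u v).
Proof. by move=> -> ->; exact: cmap2_pi. Qed.

Lemma seq_map2_le (E F G : pointedType) (mE : pmetric R E) (mF : pmetric R F)
    (mG : pmetric R G) (h : E -> F -> G)
    (hh : loc_unif_cont2 (mE := mE) (mF := mF) (mG := mG) h)
    (u : cauchy_seq A mE) (v : cauchy_seq A mF) n c x y :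
  (c <= u n x)%O -> (c <= v n y)%O -> (c <= seq_map2 hh u v n (h x y))%O.
Proof. exact: step_map2_le. Qed.

Lemma const_seq_le (E : pointedType) (m : pmetric R E) n c z :
  (c <= CauchySeq (stable_cst (step_const A z)) (is_cauchy_cst m _) n z)%O.
Proof. exact: step_const_le. Qed.

Context {X Y V : normedModType R} (P : dual_pair X Y) (hP : pairing_bounded P).
Local Notation pair := (cpairing (A := A) hP).

(** Computes a representative of a compound of lifted operations; [step_value] then computes the
    value of its n-th term on a piece where the terms of the arguments are constant. *)
Local Ltac repr_value := repeat (eapply cmap2_repr); reflexivity.

Local Ltac step_value :=
  repeat first [ eassumption | eapply seq_map2_le | eapply const_seq_le ].

Lemma cpairing_split (x x' x'' : nmcompletion A X) (y : nmcompletion A Y) :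
  pair (csub x x'') y = cadd (pair (csub x x') y) (pair (csub x' x'') y).
Proof.
elim/quotW: x => x; elim/quotW: x' => x'; elim/quotW: x'' => x''; elim/quotW: y => y.
rewrite /cpairing /csub /cadd; eapply ccompletion_eq; [repr_value|repr_value|] => n c c0 _.
have [c1 [v1 [c10 c1c cv1]]] := step_decide (x n) c0.
have [c2 [v2 [c20 c21 cv2]]] := step_decide (x' n) c10.
have [c3 [v3 [c30 c32 cv3]]] := step_decide (x'' n) c20.
have [c4 [v4 [c40 c43 cv4]]] := step_decide (y n) c30.
have {}cv3 := le_trans c43 cv3; have {}c42 := le_trans c43 c32.
have {}cv2 := le_trans c42 cv2; have {}c41 := le_trans c42 c21.
have {}cv1 := le_trans c41 cv1; have {}c4c := le_trans c41 c1c.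
exists c4; split=> //; do 2 eexists; split; [step_value..|].
by rewrite /= !pairingBl addrA subrK.
Qed.

(** The last summand is the price of replacing the conditional coefficient k by the real l; it is
    small because l - k is. *)
Lemma cpairing_comb (l : R) (xi1 xi2 : X) (k : creal A R) (x x' : nmcompletion A X)
    (y : nmcompletion A Y) :
  pair (csub (emb (l *: xi1 + (1 - l) *: xi2))
          (cadd (cscale k x) (cscale (csub (cofr A 1) k) x'))) y =
  cadd (cadd (cscale (cofr A l) (pair (csub (emb xi1) x) y))
          (cscale (cofr A (1 - l)) (pair (csub (emb xi2) x') y)))
    (cscale (csub (cofr A l) k) (pair (csub x x') y)).
Proof.
elim/quotW: k => k; elim/quotW: x => x; elim/quotW: x' => x'; elim/quotW: y => y.
rewrite /cpairing /csub /cadd /cscale /emb /cofr /cconst /cstep.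
eapply ccompletion_eq; [repr_value|repr_value|] => n c c0 _.
have [c1 [v1 [c10 c1c cv1]]] := step_decide (x n) c0.
have [c2 [v2 [c20 c21 cv2]]] := step_decide (x' n) c10.
have [c3 [v3 [c30 c32 cv3]]] := step_decide (k n) c20.
have [c4 [v4 [c40 c43 cv4]]] := step_decide (y n) c30.
have {}cv3 := le_trans c43 cv3; have {}c42 := le_trans c43 c32.
have {}cv2 := le_trans c42 cv2; have {}c41 := le_trans c42 c21.
have {}cv1 := le_trans c41 cv1; have {}c4c := le_trans c41 c1c.
exists c4; split=> //; do 2 eexists; split; [step_value..|].
rewrite /= !regular_scaleE !(pairingBl, pairingDl, pairingZl).
ring.
Qed.

Lemma cpairing_scale (t : R) (xi x0 : X) (y : nmcompletion A Y) :
  pair (csub (emb (t *: xi + (1 - t) *: x0)) (emb x0)) y =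
  cscale (cofr A t) (pair (csub (emb xi) (emb x0)) y).
Proof.
elim/quotW: y => y; rewrite /cpairing /csub /cscale /emb /cofr /cconst /cstep.
eapply ccompletion_eq; [repr_value|repr_value|] => n c c0 _.
have [c1 [v [c10 c1c cv]]] := step_decide (y n) c0.
exists c1; split=> //; do 2 eexists; split; [step_value..|].
rewrite /= !regular_scaleE !(pairingBl, pairingDl, pairingZl).
ring.
Qed.

(** Identifies the convex combination on the pieces where its coefficient is 0; [ccombination1] does
    the same for coefficient 1. *)
Lemma ccombination0 (x x' : nmcompletion A V) :
  cadd (cscale (cofr A 0) x) (cscale (csub (cofr A 1) (cofr A 0)) x') = x'.
Proof.
elim/quotW: x => x; elim/quotW: x' => x'.
rewrite /csub /cadd /cscale /cofr /cconst /cstep.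
eapply ccompletion_eq; [repr_value|repr_value|] => n c c0 _.
have [c1 [v1 [c10 c1c cv1]]] := step_decide (x n) c0.
have [c2 [v2 [c20 c21 cv2]]] := step_decide (x' n) c10.
have {}cv1 := le_trans c21 cv1; have {}c2c := le_trans c21 c1c.
exists c2; split=> //; do 2 eexists; split; [step_value..|].
by rewrite scale0r add0r subr0 scale1r.
Qed.

Lemma ccombination1 (x x' : nmcompletion A V) :
  cadd (cscale (cofr A 1) x) (cscale (csub (cofr A 1) (cofr A 1)) x') = x.
Proof.
elim/quotW: x => x; elim/quotW: x' => x'.
rewrite /csub /cadd /cscale /cofr /cconst /cstep.
eapply ccompletion_eq; [repr_value|repr_value|] => n c c0 _.
have [c1 [v1 [c10 c1c cv1]]] := step_decide (x n) c0.
have [c2 [v2 [c20 c21 cv2]]] := step_decide (x' n) c10.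
have {}cv1 := le_trans c21 cv1; have {}c2c := le_trans c21 c1c.
exists c2; split=> //; do 2 eexists; split; [step_value..|].
by rewrite scale1r subrr scale0r addr0.
Qed.

Lemma cscale0 (x : nmcompletion A V) :
  cscale (cofr A 0) x = emb 0.
Proof.
elim/quotW: x => x; rewrite /cscale /emb /cofr /cconst /cstep.
eapply ccompletion_eq; [repr_value|repr_value|] => n c c0 _.
have [c1 [v1 [c10 c1c cv1]]] := step_decide (x n) c0.
exists c1; split=> //; do 2 eexists; split; [step_value..|].
by rewrite scale0r.
Qed.

End Identities.

(** * Error propagation through the operations *)

Section BallArithmetic.
Context {d : Order.disp_t} {A : completeBooleanType d} {R : realType}.
Implicit Types (c : A) (e : R).

Section Bilinear.
Context {V W U : normedModType R} (h : V -> W -> U)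
  (hh : loc_unif_cont2 (mE := norm_metric V) (mF := norm_metric W)
    (mG := norm_metric U) h).
Hypothesis hl : forall x x' y, h (x - x') y = h x y - h x' y.
Hypothesis hr : forall x y y', h x (y - y') = h x y - h x y'.
Hypothesis hb : forall x y, `|h x y| <= `|x| * `|y|.

(** The radius comes from h v' w' - h v w = h (v' - v) w' + h v (w' - w), with the norm of w' at
    most that of w plus e'. *)
Lemma cball_bilinear c (x : nmcompletion A V) (y : nmcompletion A W) v w e e' :
  cball c x v e -> cball c y w e' ->
  cball c (cmap2 hh x y) (h v w) (e * (`|w| + e') + `|v| * e').
Proof.
(* Enlarging the radii by s <= 1 adds s (e + |w| + e' + |v| + s) to the error, at most s (K - 1).
   The second unit in K makes the final inequality strict. *)
apply: cball_map2 => t t0; set K := `|e| + `|w| + `|e'| + `|v| + 2.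
have K0 : 0 < K by rewrite ltr_wpDl ?addr_ge0.
exists (Num.min 1 (t / K)); first by rewrite lt_min ltr01 divr_gt0.
set s := Num.min _ _ => v' w' /= vv ww.
have s0 : 0 < s by rewrite lt_min ltr01 divr_gt0.
have s1 : s <= 1 by rewrite ge_min lexx.
have sK : s * K <= t by rewrite -ler_pdivlMr// ge_min lexx orbT.
have -> : h v' w' - h v w = h (v' - v) w' + h v (w' - w).
  by rewrite hl hr addrA subrK.
apply: (le_lt_trans (ler_normD _ _)).
have w'P : `|w'| <= `|w| + (e' + s).
  by rewrite -(subrK w w') addrC (le_trans (ler_normD _ _))// lerD2l ltW.
have es : 0 < e + s by apply: le_lt_trans vv.
apply: (le_lt_trans (lerD (hb _ _) (hb _ _))).
have h1 : `|v' - v| * `|w'| <= (e + s) * (`|w| + (e' + s)).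
  by apply: ler_pM => //; apply: ltW.
have h2 : `|v| * `|w' - w| <= `|v| * (e' + s) by apply: ler_wpM2l => //; apply: ltW.
apply: (le_lt_trans (lerD h1 h2)).
have e1 := ler_norm e; have e2 := ler_norm e'.
have h3 : s * (e + `|w| + e' + `|v| + s) <= s * (K - 1).
  by rewrite ler_pM2l// /K; lra.
have h4 : s * (K - 1) < s * K by rewrite ltr_pM2l//; lra.
have -> : (e + s) * (`|w| + (e' + s)) + `|v| * (e' + s) =
  e * (`|w| + e') + `|v| * e' + s * (e + `|w| + e' + `|v| + s) by ring.
by rewrite ltrD2l (le_lt_trans h3)// (lt_le_trans h4).
Qed.

End Bilinear.

Context {V : normedModType R}.

Lemma cball_add c (x y : nmcompletion A V) v w e e' :
  cball c x v e -> cball c y w e' -> cball c (cadd x y) (v + w) (e + e').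
Proof.
apply: cball_map2 => t t0; exists (t / 2) => [|v' w' /= vv ww]; first by rewrite divr_gt0.
by rewrite opprD addrACA (le_lt_trans (ler_normD _ _))//; lra.
Qed.

Lemma cball_sub c (x y : nmcompletion A V) v w e e' :
  cball c x v e -> cball c y w e' -> cball c (csub x y) (v - w) (e + e').
Proof.
apply: cball_map2 => t t0; exists (t / 2) => [|v' w' /= vv ww]; first by rewrite divr_gt0.
by rewrite opprD addrACA (le_lt_trans (ler_normD _ _))// -opprD normrN; lra.
Qed.

Lemma cball_scale c (k : creal A R) (x : nmcompletion A V) (l : R) v e e' :
  cball c k l e -> cball c x v e' ->
  cball c (cscale k x) (l *: v) (e * (`|v| + e') + `|l| * e').
Proof.
apply: cball_bilinear => [t t' u|t u u'|t u]; first exact: scalerBl.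
- exact: scalerBr.
- by rewrite normrZ.
Qed.

Lemma cball_abs c (x : creal A R) (v : R) e :
  cball c x v e -> cball c (cabs x) `|v| e.
Proof.
move=> xv; apply: (cball_map2 luc_norm (w := v) _ xv xv) => t t0.
by exists t => // v' w' /= vv _; apply: le_lt_trans (ler_dist_dist _ _) vv.
Qed.

Lemma cball_fin c (x : creal A R) (v : R) e :
  cball c x v e -> cball c (ereal_of x) v%:E e.
Proof.
move=> xv; apply: (cball_map2 luc_fin (w := v) _ xv xv) => t t0.
by exists t => // v' w' /= vv _; apply: le_lt_trans (ext_dist_fin _ _) vv.
Qed.

Lemma cball_pairing {X Y : normedModType R} (P : dual_pair X Y)
    (hP : pairing_bounded P) c (x : nmcompletion A X) (y : nmcompletion A Y) v w e e' :
  cball c x v e -> cball c y w e' ->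
  cball c (cpairing hP x y) (P v w) (e * (`|w| + e') + `|v| * e').
Proof.
apply: cball_bilinear => [x1 x2 u|u y1 y2|]; last exact: hP.
- exact: pairingBl.
- exact: pairingBr.
Qed.

End BallArithmetic.

(** * Conditional extended reals *)

Section ExtAtan.
Context {R : realType}.
Implicit Types (v w : \bar R) (s t : R).

Lemma ext_atan_ge v : - (pi / 2) <= ext_atan v.
Proof.
case: v => [t| |] /=; rewrite ?(ltW (atan_gtNpi2 _))//.
by rewrite -subr_ge0 opprK addr_ge0// divr_ge0// pi_ge0.
Qed.

Lemma ext_atan_le v : ext_atan v <= pi / 2.
Proof.
case: v => [t| |] /=; rewrite ?(ltW (atan_ltpi2 _))//.
by rewrite -subr_ge0 opprK addr_ge0// divr_ge0// pi_ge0.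
Qed.

Lemma ext_atan_surj t : - (pi / 2) <= t -> t <= pi / 2 -> exists v, ext_atan v = t.
Proof.
rewrite le_eqVlt => /predU1P[<- _|lt]; first by exists -oo%E.
rewrite le_eqVlt => /predU1P[->|gt]; first by exists +oo%E.
by exists (tan t)%:E; rewrite /= tanK// in_itv /= lt gt.
Qed.

(** Returns from the arctan scale to real inequalities: even if an end of the gap is the level of an
    infinite value, two reals with a gap of their own fit in between. *)
Lemma atan_between s t : - (pi / 2) <= s -> t <= pi / 2 -> s < t ->
  exists s' t' : R, [/\ s < atan s', s' < t' & atan t' < t].
Proof.
move=> s1 t1 st; set e := (t - s) / 3.
have e0 : 0 < e by rewrite divr_gt0 ?subr_gt0.
have ee : t = s + e + e + e by rewrite /e; lra.
have i1 : s + e \in `]- (pi / 2), pi / 2[ by rewrite in_itv /=; apply/andP; split; lra.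
have i2 : s + e + e \in `]- (pi / 2), pi / 2[ by rewrite in_itv /=; apply/andP; split; lra.
exists (tan (s + e)), (tan (s + e + e)); split; rewrite ?tanK//.
- by rewrite ltrDl.
- by rewrite ltr_tan// ltrDl.
- by rewrite ee ltrDl.
Qed.

Lemma ext_atan_lt_pinf t : ext_atan t%:E < ext_atan +oo%E :> R.
Proof. exact: atan_ltpi2. Qed.

Lemma ext_atan_gt_ninf t : ext_atan -oo%E < ext_atan t%:E :> R.
Proof. exact: atan_gtNpi2. Qed.

Lemma ext_atan_fin s t : (ext_atan s%:E <= ext_atan t%:E :> R) = (s <= t).
Proof.
apply/idP/idP => /=; last exact: le_atan.
by rewrite leNgt => H; rewrite leNgt; apply: contra H; apply: lt_atan.
Qed.

Lemma ext_atan_add t e : 0 <= e -> ext_atan (t + e)%:E <= ext_atan t%:E + e :> R.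
Proof.
move=> e0; have := ext_dist_fin (t + e) t; rewrite [in leRHS](addrC t) addrK (ger0_norm e0).
by rewrite ler_norml => /andP[_]; lra.
Qed.

End ExtAtan.

Section ExtendedOrder.
Context {d : Order.disp_t} {A : completeBooleanType d} {R : realType}.
Implicit Types (a b c : A) (x y z : cereal A R) (v w : \bar R) (e s t : R).
Local Notation ecst := (cconst A (@ext_metric R)).

(* The order of extended reals on the piece a, measured in the arctan scale in
   which infinite values need no special case; ele is ele_on at the top (eleP). *)
Definition ele_on a x y : Prop := forall c v w e e', c != \bot%O -> (c <= a)%O ->
  cball c x v e -> cball c y w e' -> ext_atan v <= ext_atan w + e + e'.

Lemma cball_ext_cons c x v w e e' : c != \bot%O ->
  cball c x v e -> cball c x w e' -> ext_atan v <= ext_atan w + e + e'.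
Proof.
move=> c0 xv xw; have := cball_cons c0 xv xw.
by rewrite /= /ext_dist ler_norml => /andP[_]; lra.
Qed.

Lemma ele_on_le a b x y : (b <= a)%O -> ele_on a x y -> ele_on b x y.
Proof.
by move=> ba H c v w e e' c0 cb; apply: H => //; apply: le_trans ba.
Qed.

Lemma ele_on_trans a y x z : ele_on a x y -> ele_on a y z -> ele_on a x z.
Proof.
move=> xy yz c v w e e' c0 ca xv zw; apply/ler_addgt0Pr => t t0.
have t20 : 0 < t / 2 by rewrite divr_gt0.
have [c' [u [c'0 c'c yu]]] := cball_dense y t20 c0.
have h1 := xy _ _ _ _ _ c'0 (le_trans c'c ca) (cball_le c'c xv) yu.
have h2 := yz _ _ _ _ _ c'0 (le_trans c'c ca) yu (cball_le c'c zw).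
by move: h1 h2; lra.
Qed.

Lemma ele_on_local a x y : densely a (fun c => ele_on c x y) -> ele_on a x y.
Proof.
move=> H c v w e e' c0 ca xv yw; have [c' [c'0 c'c xy]] := H c c0 ca.
by apply: xy (lexx _) _ _; [|exact: cball_le xv|exact: cball_le yw].
Qed.

Lemma ele_on_eq a x y : cagree a x y -> ele_on a x y.
Proof.
move=> xy c v w e e' c0 ca xv; apply: cball_ext_cons => //.
by apply: cball_cagree xv; apply: cagree_le xy.
Qed.

Lemma ele_on_anti a x y : ele_on a x y -> ele_on a y x -> cagree a x y.
Proof.
move=> xy yx; apply: cball_agree => e e0 c c0 ca.
have e30 : 0 < e / 3 by rewrite divr_gt0.
have [c1 [v [c10 c1c xv]]] := cball_dense x e30 c0.
have [c2 [w [c20 c21 yw]]] := cball_dense y e30 c10.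
have {}xv := cball_le c21 xv; have c2a := le_trans (le_trans c21 c1c) ca.
exists c2; split=> //; first exact: le_trans c1c.
exists v; first by apply: cballWr xv; lra.
apply: (cballW _ yw); have h1 := xy _ _ _ _ _ c20 c2a xv yw.
have h2 := yx _ _ _ _ _ c20 c2a yw xv.
suff : `|ext_atan w - ext_atan v| <= e / 3 + e / 3 by rewrite /= /ext_dist; lra.
by rewrite ler_norml; apply/andP; split; lra.
Qed.

Lemma cball_ele c u x v e :
  cball c x v e -> ext_atan u <= ext_atan v - e -> ele_on c (ecst u) x.
Proof.
move=> xv uv b v' w' e1 e2 b0 bc h1 h2.
have := cball_ext_cons b0 h1 (@cball_cconst _ _ _ _ _ b u).
by have := cball_ext_cons b0 (cball_le bc xv) h2; lra.
Qed.

Lemma cball_ege c u x v e :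
  cball c x v e -> ext_atan v + e <= ext_atan u -> ele_on c x (ecst u).
Proof.
move=> xv uv b v' w' e1 e2 b0 bc h1 h2.
have := cball_ext_cons b0 (@cball_cconst _ _ _ _ _ b u) h2.
by have := cball_ext_cons b0 h1 (cball_le bc xv); lra.
Qed.

Lemma ele_on_cst c v w : ext_atan v <= ext_atan w -> ele_on c (ecst v) (ecst w).
Proof. by move=> vw; apply: cball_ele (@cball_cconst _ _ _ _ _ _ _) _; rewrite subr0. Qed.

Lemma ele_on_cstV c v w : c != \bot%O -> ele_on c (ecst v) (ecst w) ->
  ext_atan v <= ext_atan w.
Proof.
move=> c0 H; have := H c _ _ _ _ c0 (lexx _)
  (@cball_cconst _ _ _ _ _ c v) (@cball_cconst _ _ _ _ _ c w).
by rewrite !addr0.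
Qed.

Lemma ele_on_cst_fin c s t : c != \bot%O ->
  ele_on c (ecst s%:E) (ecst t%:E) -> s <= t.
Proof. by move=> c0 /(ele_on_cstV c0); rewrite ext_atan_fin. Qed.

Lemma ele_on_pinf c x : ele_on c x (ecst +oo%E).
Proof.
move=> b v w e e' b0 bc h1 h2.
have := cball_ext_cons b0 (@cball_cconst _ _ _ _ _ b +oo%E) h2.
by have := cball_ge0 b0 h1; have := ext_atan_le v; rewrite [ext_atan +oo%E]/=; lra.
Qed.

Lemma ele_on_ninf c x : ele_on c (ecst -oo%E) x.
Proof.
move=> b v w e e' b0 bc h1 h2.
have := cball_ext_cons b0 h1 (@cball_cconst _ _ _ _ _ b -oo%E).
by have := cball_ge0 b0 h2; have := ext_atan_ge w; rewrite [ext_atan -oo%E]/=; lra.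
Qed.

(** The separating levels are real even where x or y is infinite, so the proofs that start from a
    failed inequality only compare real constants. *)
Lemma ele_onN a x y : ~ ele_on a x y -> exists c s t,
  [/\ c != \bot%O, (c <= a)%O, s < t, ele_on c y (ecst s%:E) & ele_on c (ecst t%:E) x].
Proof.
move=> H; have [c [v [w [e [e' [c0 ca [xv yw lt]]]]]]] : exists c v w e e',
    [/\ c != \bot%O, (c <= a)%O & [/\ cball c x v e, cball c y w e' &
      ext_atan w + e + e' < ext_atan v]].
  apply: contrapT => H'; apply: H => c v w e e' c0 ca xv yw.
  by rewrite leNgt; apply/negP => lt; apply: H'; exists c, v, w, e, e'.
have [|||s [t [h1 h2 h3]]] := @atan_between R (ext_atan w + e') (ext_atan v - e).
- by have := ext_atan_ge w; have := cball_ge0 c0 yw; lra.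
- by have := ext_atan_le v; have := cball_ge0 c0 xv; lra.
- by lra.
exists c, s, t; split=> //; first by apply: cball_ege yw _ => /=; lra.
by apply: cball_ele xv _ => /=; lra.
Qed.

(** From [cle_on] to the arctan order the proof is an estimate, since arctan is 1-Lipschitz. Its
    inverse is not, so for the converse a failure is separated by two real constants, and the first
    direction carries these over. *)
Lemma ele_on_fin a (p q : creal A R) :
  ele_on a (ereal_of p) (ereal_of q) <-> cle_on a p q.
Proof.
have mono b (p' q' : creal A R) : cle_on b p' q' ->
    ele_on b (ereal_of p') (ereal_of q').
  move=> /cle_onP H c v w e e' c0 cb h1 h2; apply/ler_addgt0Pr => t t0.
  have t50 : 0 < t / 5 by rewrite divr_gt0.
  have [c1 [u1 [c10 c1c pu]]] := cball_dense p' t50 c0.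
  have [c2 [u2 [c20 c21 qu]]] := cball_dense q' t50 c10.
  have {}pu := cball_le c21 pu; have c2c := le_trans c21 c1c.
  have := H _ _ _ _ _ c20 (le_trans c2c cb) pu qu; rewrite -ext_atan_fin -addrA.
  have := cball_ext_cons c20 (cball_le c2c h1) (cball_fin pu).
  have := cball_ext_cons c20 (cball_fin qu) (cball_le c2c h2).
  have := @ext_atan_add R u2 (t / 5 + t / 5) (ltW (addr_gt0 t50 t50)).
  move: (ext_atan u1%:E) (ext_atan u2%:E) (ext_atan (u2 + _)%:E) => *; lra.
split=> [H|]; last exact: mono.
apply: contrapT => /cle_onN[c [v [w [e [e' [c0 ca pv qw lt]]]]]].
have h1 := mono _ _ _ (cball_cle pv).1; have h2 := mono _ _ _ (cball_cle qw).2.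
have h3 := ele_on_trans (ele_on_trans h1 (ele_on_le ca H)) h2.
have := h3 c _ _ _ _ c0 (lexx _) (cball_fin (cball_cofr _ _)) (cball_fin (cball_cofr _ _)).
by rewrite !addr0 ext_atan_fin; lra.
Qed.

Lemma ereal_of_cofr t : ereal_of (cofr A t) = ecst t%:E.
Proof.
apply: cagree_top; apply: cball_agree => e e0 c c0 _; exists c; split=> //.
exists t%:E; apply: cballWr (ltW e0) _; last exact: cball_cconst.
exact: cball_fin (cball_cofr _ _).
Qed.

Lemma ele_on_squeeze a x y : (forall e, 0 < e -> densely a (fun c =>
    exists t, ele_on c x (ecst (t + e)%:E) /\ ele_on c (ecst (t - e)%:E) y)) ->
  ele_on a x y.
Proof.
move=> H; apply: contrapT => /ele_onN[c [s [t [c0 ca st ys tx]]]].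
have [|c' [c'0 c'c [u [xu uy]]]] := H ((t - s) / 3) _ c c0 ca.
  by rewrite divr_gt0 ?subr_gt0.
have := ele_on_cst_fin c'0 (ele_on_trans (ele_on_le c'c tx) xu).
have := ele_on_cst_fin c'0 (ele_on_trans uy (ele_on_le c'c ys)).
by lra.
Qed.

Lemma cle_on_anti a (p q : creal A R) : cle_on a p q -> cle_on a q p -> cagree a p q.
Proof.
move=> /cle_onP pq /cle_onP qp; apply: cball_agree => e e0 c c0 ca.
have e30 : 0 < e / 3 by rewrite divr_gt0.
have [c1 [v [c10 c1c xv]]] := cball_dense p e30 c0.
have [c2 [w [c20 c21 yw]]] := cball_dense q e30 c10.
have {}xv := cball_le c21 xv; have c2a := le_trans (le_trans c21 c1c) ca.
exists c2; split=> //; first exact: le_trans c1c.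
exists v; first by apply: cballWr xv; lra.
apply: (cballW _ yw) => /=; have h1 := pq _ _ _ _ _ c20 c2a xv yw.
have h2 := qp _ _ _ _ _ c20 c2a yw xv.
suff : `|w - v| <= e / 3 + e / 3 by lra.
by rewrite ler_norml; apply/andP; split; lra.
Qed.

Lemma ereal_of_inj a (p q : creal A R) :
  cagree a (ereal_of p) (ereal_of q) -> cagree a p q.
Proof.
move=> pq; apply: cle_on_anti; apply/ele_on_fin/ele_on_eq => //.
exact: cagree_sym.
Qed.

Lemma ereal_of_agree a (p q : creal A R) :
  cagree a p q -> cagree a (ereal_of p) (ereal_of q).
Proof. by move=> pq; apply: cmap2_agree. Qed.

End ExtendedOrder.

(** * Infinite and finite parts, sums and scalar multiples *)

Section Parts.
Context {d : Order.disp_t} {A : completeBooleanType d} {R : realType}.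
Implicit Types (a b c p n : A) (x y z : cereal A R) (r l : creal A R) (s t e : R).
Local Notation ecst := (cconst A (@ext_metric R)).

Lemma le_bsup_hit (S : set A) c : c != \bot%O -> (c <= bsup S)%O ->
  exists s : A, [/\ S s, (c `&` s != \bot)%O, (c `&` s <= c)%O & (c `&` s <= s)%O].
Proof.
move=> c0 cS; have := @meet_bsup_neq0 _ A c S; rewrite (meet_idPl cS) => /(_ c0)[s Ss cs].
by exists s; rewrite leIl leIr.
Qed.

Lemma le_compl c a : (forall b, b != \bot%O -> (b <= c)%O -> (b <= a)%O -> False) ->
  (c <= ~` a)%O.
Proof.
move=> H; rewrite -Order.CTBDistrLatticeTheory.disj_leC; apply/negPn/negP => ca.
by apply: (H _ ca); rewrite ?leIl ?leIr.
Qed.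

Lemma disjointP a b : (forall c, c != \bot%O -> (c <= a)%O -> (c <= b)%O -> False) ->
  (a `&` b = \bot)%O.
Proof.
move=> H; apply/eqP; rewrite Order.CTBDistrLatticeTheory.disj_leC; exact: le_compl.
Qed.

(** Agreement is local, hence passes to the supremum of the pieces of agreement. So [pinf_part x]
    and [ninf_part x] are the largest pieces on which x is oo and -oo. *)
Lemma bsup_agree (x y : cereal A R) : cagree (bsup [set b | cagree b x y]) x y.
Proof.
apply: cagree_local => c c0 /(le_bsup_hit c0)[s [Ss cs csc css]].
by exists (c `&` s)%O; split=> //; apply: cagree_le css Ss.
Qed.

Lemma pinf_partP c x : (c <= pinf_part x)%O <-> cagree c x epinf.
Proof.
split=> [cx|]; first exact: cagree_le cx (bsup_agree _ _).
by move=> cx; apply: bsup_ub.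
Qed.

Lemma ninf_partP c x : (c <= ninf_part x)%O <-> cagree c x eninf.
Proof.
split=> [cx|]; first exact: cagree_le cx (bsup_agree _ _).
by move=> cx; apply: bsup_ub.
Qed.

Lemma pinf_nge c x t : c != \bot%O -> cagree c x epinf -> ~ ele_on c x (ecst t%:E).
Proof.
move=> c0 xp xt; have := ele_on_trans (ele_on_eq (cagree_sym xp)) xt.
by move=> /(ele_on_cstV c0); rewrite leNgt ext_atan_lt_pinf.
Qed.

Lemma ninf_nle c x t : c != \bot%O -> cagree c x eninf -> ~ ele_on c (ecst t%:E) x.
Proof.
move=> c0 xp xt; have := ele_on_trans xt (ele_on_eq xp).
by move=> /(ele_on_cstV c0); rewrite leNgt ext_atan_gt_ninf.
Qed.

Lemma pinf_not_ninf c x : c != \bot%O -> cagree c x epinf -> ~ cagree c x eninf.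
Proof.
move=> c0 xp xn; have := cagree_trans (cagree_sym xp) xn.
move=> /ele_on_eq /(ele_on_cstV c0); rewrite leNgt.
by rewrite (lt_trans (ext_atan_gt_ninf 0) (ext_atan_lt_pinf 0)).
Qed.

Lemma le_join_hit c a b : c != \bot%O -> (c <= a `|` b)%O ->
  exists c', [/\ c' != \bot%O, (c' <= c)%O & (c' <= a)%O \/ (c' <= b)%O].
Proof.
move=> c0 cab; have [ca|ca] := meet_neq0P a c0.
  by exists (c `&` a)%O; rewrite leIl; split=> //; left; exact: leIr.
exists c; split=> //; right; rewrite -(meet_idPl cab) meetUr.
move: ca; rewrite -Order.CTBDistrLatticeTheory.disj_leC => /eqP ->.
by rewrite join0x leIr.
Qed.

Lemma ereal_of_bounded c r : c != \bot%O -> exists c' t, [/\ c' != \bot%O, (c' <= c)%O,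
  ele_on c' (ecst (- t)%:E) (ereal_of r) & ele_on c' (ereal_of r) (ecst t%:E)].
Proof.
move=> c0; have [c' [v [c'0 c'c rv]]] := cball_dense r ltr01 c0.
exists c', (`|v| + 1); split=> //; rewrite -ereal_of_cofr; apply/ele_on_fin.
  apply/cle_onP => b u w e e' b0 bc ub wb.
  have := cball_cons b0 ub (cball_cofr b _).
  have := cball_cons b0 wb (cball_le bc rv).
  rewrite /= !ler_norml => /andP[? ?] /andP[? ?].
  by have := ler_norm (- v); rewrite normrN; lra.
apply/cle_onP => b u w e e' b0 bc ub wb.
have := cball_cons b0 wb (cball_cofr b _).
have := cball_cons b0 ub (cball_le bc rv).
rewrite /= !ler_norml => /andP[? ?] /andP[? ?].
by have := ler_norm v; lra.
Qed.

Lemma ereal_of_npinf c r : c != \bot%O -> ~ cagree c (ereal_of r) epinf.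
Proof.
move=> c0 rp; have [c' [t [c'0 c'c _ rt]]] := ereal_of_bounded r c0.
exact: pinf_nge c'0 (cagree_le c'c rp) rt.
Qed.

Lemma ereal_of_nninf c r : c != \bot%O -> ~ cagree c (ereal_of r) eninf.
Proof.
move=> c0 rp; have [c' [t [c'0 c'c rt _]]] := ereal_of_bounded r c0.
exact: ninf_nle c'0 (cagree_le c'c rp) rt.
Qed.

Lemma le_fin_dom c x : (c <= ~` pinf_part x)%O -> (c <= ~` ninf_part x)%O ->
  (c <= fin_dom x)%O.
Proof. by rewrite /fin_dom Order.CTBDistrLatticeTheory.complU lexI => -> ->. Qed.

Lemma fin_dom_npinf x : (fin_dom x <= ~` pinf_part x)%O.
Proof. by rewrite /fin_dom Order.CTBDistrLatticeTheory.complU leIl. Qed.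

Lemma fin_dom_nninf x : (fin_dom x <= ~` ninf_part x)%O.
Proof. by rewrite /fin_dom Order.CTBDistrLatticeTheory.complU leIr. Qed.

(** Where x is not oo, the inequality oo <= x fails on some piece, and the lower of the separating
    reals bounds x from above there. The lower bound arises in the same way from -oo. *)
Lemma fin_dom_bounded x c : c != \bot%O -> (c <= fin_dom x)%O ->
  exists c' s t, [/\ c' != \bot%O, (c' <= c)%O, ele_on c' (ecst s%:E) x &
    ele_on c' x (ecst t%:E)].
Proof.
move=> c0 cx; have [H|/ele_onN[c1 [t [_ [c10 c1c _ xt _]]]]] := pselect (ele_on c epinf x).
  have : (c <= pinf_part x)%O.
    by apply/pinf_partP; apply: ele_on_anti => //; exact: ele_on_pinf.
  by move=> /(le_compl_bot c0); case; apply: le_trans cx (fin_dom_npinf _).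
have [H|/ele_onN[c2 [_ [s [c20 c21 _ _ sx]]]]] := pselect (ele_on c1 x eninf).
  have : (c1 <= ninf_part x)%O.
    by apply/ninf_partP; apply: ele_on_anti => //; exact: ele_on_ninf.
  by move=> /(le_compl_bot c10); case; apply: le_trans (le_trans c1c cx) (fin_dom_nninf _).
exists c2, s, t; split=> //; first exact: le_trans c1c.
exact: ele_on_le xt.
Qed.

(** An arctan radius gives no uniform real error, so u is taken within e of the supremum of all real
    lower bounds of x on pieces below c1. If x <= u + e failed on c2, some smaller piece would have
    a lower bound above that supremum. *)
Lemma fin_dom_dense x c e : 0 < e -> c != \bot%O -> (c <= fin_dom x)%O ->
  exists c' v, [/\ c' != \bot%O, (c' <= c)%O, ele_on c' (ecst (v - e)%:E) x &
    ele_on c' x (ecst (v + e)%:E)].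
Proof.
move=> e0 c0 /(fin_dom_bounded c0)[c1 [s [t [c10 c1c sx xt]]]].
pose T := [set u : R | exists c2, [/\ c2 != \bot%O, (c2 <= c1)%O & ele_on c2 (ecst u%:E) x]].
have ubT : ubound T t.
  move=> u [c2 [c20 c21 ux]]; apply: (ele_on_cst_fin c20).
  exact: ele_on_trans ux (ele_on_le c21 xt).
have supT : has_sup T by split; [exists s, c1|exists t].
have [u [c2 [c20 c21 ux]] uT] := sup_adherent e0 supT.
exists c2, u; split=> //; first exact: le_trans c1c.
  by apply: ele_on_trans ux; apply: ele_on_cst; rewrite ext_atan_fin gerDl oppr_le0 ltW.
apply: contrapT => /ele_onN[c3 [s' [t' [c30 c32 st us tx]]]].
have := ele_on_cst_fin c30 us; have : T t' by exists c3; split=> //; apply: le_trans c21.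
by move=> /(sup_upper_bound supT); lra.
Qed.

(** The two-sided real bounds of x on small pieces are consistent, so they construct a conditional
    real, which is squeezed against x. *)
Lemma fin_partP x : cagree (fin_dom x) x (ereal_of (fin_part x)).
Proof.
rewrite /fin_part; case: xgetP => [r -> //|H]; exfalso.
set D := fin_dom x in H.
(* The construction needs data on every piece; outside D the constant 0 is prescribed. *)
pose N c (v e : R) := 0 <= e /\ (((c <= D)%O /\
  (ele_on c (ecst (v - e)%:E) x /\ ele_on c x (ecst (v + e)%:E))) \/
  ((c <= ~` D)%O /\ v = 0)).
have [c c' v e c'c [e0 [[cD [h1 h2]]|[cD v0]]]|c e e0 c0|c v w e e' c0|r rN] :=
    @cball_construct _ A R R^o (norm_metric R^o) N.
- split=> //; left; split; first exact: le_trans cD.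
  by split; [apply: ele_on_le h1|apply: ele_on_le h2].
- by split=> //; right; split=> //; apply: le_trans cD.
- have [cD|cD] := meet_neq0P D c0.
    have [c1 [v [c10 c1c h1 h2]]] := fin_dom_dense e0 cD (leIr _ _).
    exists c1, v; split=> //; first exact: le_trans c1c (leIl _ _).
    split; [exact: ltW|left; split=> //; exact: le_trans c1c (leIr _ _)].
  by exists c, 0; split=> //; split; [exact: ltW|right].
- move=> [e0 [[cD [h1 h2]]|[cD v0]]] [e'0 [[cD' [h1' h2']]|[cD' w0]]] /=.
  + have := ele_on_cst_fin c0 (ele_on_trans h1 h2').
    have := ele_on_cst_fin c0 (ele_on_trans h1' h2).
    by rewrite ler_norml => ? ?; apply/andP; split; lra.
  + by case: (le_compl_bot c0 cD).
  + by case: (le_compl_bot c0 cD').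
  + by rewrite v0 w0 subrr normr0 addr_ge0.
apply: (H r) => /=; have dense c e : 0 < e -> c != \bot%O -> (c <= D)%O ->
    exists c' v, [/\ c' != \bot%O, (c' <= c)%O, cball c' r v e,
      ele_on c' (ecst (v - e)%:E) x & ele_on c' x (ecst (v + e)%:E)].
  move=> e0 c0 cD; have [c1 [v [c10 c1c h1 h2]]] := fin_dom_dense e0 c0 cD.
  exists c1, v; split=> //; apply: rN; split; first exact: ltW.
  by left; split=> //; apply: le_trans cD.
apply: ele_on_anti; apply: ele_on_squeeze => e e0 c c0 cD.
  have [c1 [v [c10 c1c rv h1 h2]]] := dense c e e0 c0 cD.
  exists c1; split=> //; exists v; split=> //.
  by rewrite -ereal_of_cofr; apply/ele_on_fin; exact: (cball_cle rv).1.
have [c1 [v [c10 c1c rv h1 h2]]] := dense c e e0 c0 cD.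
exists c1; split=> //; exists v; split=> //.
by rewrite -ereal_of_cofr; apply/ele_on_fin; exact: (cball_cle rv).2.
Qed.

Lemma agree_fin c x r : cagree c x (ereal_of r) ->
  (c <= fin_dom x)%O /\ cagree c (fin_part x) r.
Proof.
move=> xr; have cx : (c <= fin_dom x)%O.
  apply: le_fin_dom.
    apply: (@le_compl c (pinf_part x)) => b b0 bc /pinf_partP xp.
    apply: (@ereal_of_npinf b r b0).
    exact: cagree_trans (cagree_sym (cagree_le bc xr)) xp.
  apply: (@le_compl c (ninf_part x)) => b b0 bc /ninf_partP xp.
  apply: (@ereal_of_nninf b r b0).
  exact: cagree_trans (cagree_sym (cagree_le bc xr)) xp.
split=> //; apply: ereal_of_inj; apply: cagree_trans xr.
exact: cagree_sym (cagree_le cx (fin_partP x)).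
Qed.

(** Every piece meets the part where y is oo or the part where x is -oo, or else lies in both finite
    domains, where the order is that of the conditional reals. *)
Lemma eleP x y : ele x y <-> ele_on \top%O x y.
Proof.
split=> [[h1 h2 h3]|H].
  apply: ele_on_local => c c0 _.
  have [cp|cp] := meet_neq0P (pinf_part y) c0.
    exists (c `&` pinf_part y)%O; split; rewrite ?leIl//.
    have /cagree_sym/ele_on_eq : cagree (c `&` pinf_part y)%O y epinf.
      by apply/pinf_partP; apply: leIr.
    by apply: ele_on_trans; exact: ele_on_pinf.
  have [cn|cn] := meet_neq0P (ninf_part x) c0.
    exists (c `&` ninf_part x)%O; split; rewrite ?leIl//.
    have /ele_on_eq : cagree (c `&` ninf_part x)%O x eninf.
      by apply/ninf_partP; apply: leIr.
    by move=> /ele_on_trans; apply; exact: ele_on_ninf.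
  have cx : (c <= fin_dom x)%O.
    apply: (le_fin_dom _ cn); apply: (le_trans cp).
    by rewrite Order.CTBDistrLatticeTheory.leC.
  have cy : (c <= fin_dom y)%O.
    apply: (le_fin_dom cp); apply: (le_trans cn).
    by rewrite Order.CTBDistrLatticeTheory.leC.
  exists c; split=> //.
  apply: (ele_on_trans (ele_on_eq (cagree_le cx (fin_partP x)))).
  apply: (ele_on_trans _ (ele_on_eq (cagree_sym (cagree_le cy (fin_partP y))))).
  by apply/ele_on_fin; apply: cle_on_le h3; rewrite lexI cx cy.
split.
- apply/pinf_partP; apply: ele_on_anti; first exact: ele_on_pinf.
  apply: ele_on_trans (ele_on_le (lex1 _) H); apply: ele_on_eq.
  by apply: cagree_sym; apply/pinf_partP; apply: lexx.
- apply/ninf_partP; apply: ele_on_anti; last exact: ele_on_ninf.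
  apply: ele_on_trans (ele_on_le (lex1 _) H) _; apply: ele_on_eq.
  by apply/ninf_partP; apply: lexx.
apply/ele_on_fin.
apply: (ele_on_trans (ele_on_eq (cagree_sym (cagree_le (leIl _ _) (fin_partP x))))).
apply: (ele_on_trans (ele_on_le (lex1 _) H)).
exact: ele_on_eq (cagree_le (leIr _ _) (fin_partP y)).
Qed.

Lemma ext_ofP p n r : (p `&` n = \bot)%O ->
  [/\ cagree p (ext_of p n r) epinf, cagree n (ext_of p n r) eninf &
      cagree (~` (p `|` n))%O (ext_of p n r) (ereal_of r)].
Proof.
move=> pn; rewrite /ext_of; set a := fun o : option bool => _; set u := fun o => _.
have pa : is_partition a.
  apply: partition_dense.
    have h1 : (p `&` ~` (p `|` n) = \bot)%O.
      by apply/eqP; rewrite Order.CTBDistrLatticeTheory.disj_leC complK leUl.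
    have h2 : (n `&` ~` (p `|` n) = \bot)%O.
      by apply/eqP; rewrite Order.CTBDistrLatticeTheory.disj_leC complK leUr.
    by move=> [[]|] [[]|] //= _; rewrite /a // meetC.
  move=> c c0; have [cp|cp] := meet_neq0P p c0; first by exists (Some true).
  have [cn|cn] := meet_neq0P n c0; first by exists (Some false).
  exists None; rewrite /a Order.CTBDistrLatticeTheory.complU.
  by apply: (le_bot_neq c0); rewrite !lexI lexx cp cn.
split; [exact: (concatP u pa (Some true))|exact: (concatP u pa (Some false))|].
exact: (concatP u pa None).
Qed.

Lemma eadd_disjoint x y :
  (((pinf_part x `|` pinf_part y) `&` ~` (ninf_part x `|` ninf_part y)) `&`
   (ninf_part x `|` ninf_part y) = \bot)%O.
Proof. by rewrite -meetA meetCx meetx0. Qed.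

Lemma eadd_fin c x y (q r : creal A R) :
  cagree c x (ereal_of q) -> cagree c y (ereal_of r) ->
  cagree c (eadd x y) (ereal_of (cadd q r)).
Proof.
move=> /agree_fin[cx xq] /agree_fin[cy yr].
have [_ _ H] := ext_ofP (cadd (fin_part x) (fin_part y)) (eadd_disjoint x y).
apply: (cagree_trans (cagree_le _ H)).
  rewrite Order.CTBDistrLatticeTheory.complU lexI; apply/andP; split.
    apply: (@le_trans _ _ (~` (pinf_part x `|` pinf_part y))%O).
      rewrite Order.CTBDistrLatticeTheory.complU lexI.
      by rewrite (le_trans cx (fin_dom_npinf _)) (le_trans cy (fin_dom_npinf _)).
    by rewrite Order.CTBDistrLatticeTheory.leC leIl.
  rewrite Order.CTBDistrLatticeTheory.complU lexI.
  by rewrite (le_trans cx (fin_dom_nninf _)) (le_trans cy (fin_dom_nninf _)).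
by apply: ereal_of_agree; apply: cmap2_agree.
Qed.

Lemma eadd_pinfl c x y : cagree c x epinf -> (c <= ~` ninf_part y)%O ->
  cagree c (eadd x y) epinf.
Proof.
move=> xp cy.
have [H _ _] := ext_ofP (cadd (fin_part x) (fin_part y)) (eadd_disjoint x y).
have cp : (c <= pinf_part x `|` pinf_part y)%O.
  by apply: le_trans (leUl _ _); apply/pinf_partP.
apply: cagree_le H; rewrite lexI cp /=.
rewrite Order.CTBDistrLatticeTheory.complU lexI cy andbT.
apply: le_compl => b b0 bc /ninf_partP.
exact: pinf_not_ninf b0 (cagree_le bc xp).
Qed.

Lemma eadd_pinfr c x y : cagree c y epinf -> (c <= ~` ninf_part x)%O ->
  cagree c (eadd x y) epinf.
Proof.
move=> yp cx; have [H _ _] := ext_ofP (cadd (fin_part x) (fin_part y)) (eadd_disjoint x y).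
have cp : (c <= pinf_part x `|` pinf_part y)%O.
  by apply: le_trans (leUr _ _); apply/pinf_partP.
apply: cagree_le H; rewrite lexI cp /=.
rewrite Order.CTBDistrLatticeTheory.complU lexI cx /=.
apply: le_compl => b b0 bc /ninf_partP.
exact: pinf_not_ninf b0 (cagree_le bc yp).
Qed.

Lemma pos_part_hit c l : c != \bot%O -> (c <= pos_part l)%O ->
  exists c' v e, [/\ c' != \bot%O, (c' <= c)%O, cball c' l v e & e < v].
Proof.
move=> c0 /(le_bsup_hit c0)[s [/clt_onP Ss cs0 csc css]].
have [c1 [c10 c1c [v [w [e [e' [h1 h2 h3]]]]]]] := Ss _ cs0 css.
exists c1, w, e'; split=> //; first exact: le_trans csc.
have := cball_cons c10 h1 (cball_cofr c1 0).
by rewrite /= ler_norml => /andP[]; lra.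
Qed.

Lemma neg_part_hit c l : c != \bot%O -> (c <= neg_part l)%O ->
  exists c' v e, [/\ c' != \bot%O, (c' <= c)%O, cball c' l v e & v < - e].
Proof.
move=> c0 /(le_bsup_hit c0)[s [/clt_onP Ss cs0 csc css]].
have [c1 [c10 c1c [v [w [e [e' [h1 h2 h3]]]]]]] := Ss _ cs0 css.
exists c1, v, e; split=> //; first exact: le_trans csc.
have := cball_cons c10 h2 (cball_cofr c1 0).
by rewrite /= ler_norml => /andP[]; lra.
Qed.

Lemma escale_disjoint l x :
  (((pos_part l `&` pinf_part x) `|` (neg_part l `&` ninf_part x)) `&`
   ((pos_part l `&` ninf_part x) `|` (neg_part l `&` pinf_part x)) = \bot)%O.
Proof.
have pn b : b != \bot%O -> (b <= pos_part l)%O -> (b <= neg_part l)%O -> False.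
  move=> b0 /(pos_part_hit b0)[c1 [v [e [c10 c1c h1 ev]]]] cn.
  have [c2 [w [e' [c20 c21 h2 we]]]] := neg_part_hit c10 (le_trans c1c cn).
  have := cball_cons c20 (cball_le c21 h1) h2.
  by rewrite /= ler_norml => /andP[]; lra.
have xx b : b != \bot%O -> (b <= pinf_part x)%O -> (b <= ninf_part x)%O -> False.
  move=> b0 /pinf_partP xp /ninf_partP; exact: pinf_not_ninf xp.
apply: disjointP => c c0 /(le_join_hit c0)[c1 [c10 c1c H1]] /(le_trans c1c).
move=> /(le_join_hit c10)[c2 [c20 c21]]; rewrite !lexI.
have : (c2 <= pos_part l `&` pinf_part x)%O \/ (c2 <= neg_part l `&` ninf_part x)%O.
  by case: H1 => /(le_trans c21); [left|right].
rewrite !lexI; case=> /andP[h1 h2] [] /andP[h3 h4].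
- exact: xx h2 h4.
- exact: pn h1 h3.
- exact: pn h3 h1.
- exact: xx h4 h2.
Qed.

Lemma escale_fin c l x r : cagree c x (ereal_of r) ->
  cagree c (escale l x) (ereal_of (cscale l r)).
Proof.
move=> /agree_fin[cx xr].
have [_ _ H] := ext_ofP (cscale l (fin_part x)) (escale_disjoint l x).
apply: (cagree_trans (cagree_le _ H)).
  apply: le_compl => b b0 bc; have bp := le_trans (le_trans bc cx) (fin_dom_npinf _).
  have bn := le_trans (le_trans bc cx) (fin_dom_nninf _).
  move=> /(le_join_hit b0)[b1 [b10 b1b []]] /(le_join_hit b10)[b2 [b20 b21]].
    have b2b := le_trans b21 b1b.
    by rewrite !lexI => -[] /andP[_] /(le_compl_bot b20); case; apply: le_trans b2b _.
  have b2b := le_trans b21 b1b.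
  by rewrite !lexI => -[] /andP[_] /(le_compl_bot b20); case; apply: le_trans b2b _.
by apply: ereal_of_agree; apply: cmap2_agree => //; exact: cagree_refl.
Qed.

Lemma escale_pinf c l x : (c <= pos_part l)%O -> cagree c x epinf ->
  cagree c (escale l x) epinf.
Proof.
move=> cl /pinf_partP cx.
have [H _ _] := ext_ofP (cscale l (fin_part x)) (escale_disjoint l x).
by apply: cagree_le H; rewrite lexU2// lexI cl cx.
Qed.

Lemma zero_parts c l : cagree c l (cofr A 0) ->
  (c <= ~` pos_part l)%O /\ (c <= ~` neg_part l)%O.
Proof.
move=> l0; split; apply: le_compl => b b0 bc.
  move=> /(pos_part_hit b0)[c1 [v [e [c10 c1c h1 ev]]]].
  have := cball_cons c10 (cball_cagree (cagree_le (le_trans c1c bc) l0) h1) (cball_cofr c1 0).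
  by rewrite /= ler_norml => /andP[]; lra.
move=> /(neg_part_hit b0)[c1 [v [e [c10 c1c h1 ev]]]].
have := cball_cons c10 (cball_cagree (cagree_le (le_trans c1c bc) l0) h1) (cball_cofr c1 0).
by rewrite /= ler_norml => /andP[]; lra.
Qed.

(** Where l vanishes neither infinite part of the product survives, and [fin_part x], arbitrary
    where x is infinite, is multiplied by 0. *)
Lemma escale_zero c l x : cagree c l (cofr A 0) ->
  cagree c (escale l x) (ereal_of (cofr A 0)).
Proof.
move=> l0; have [cp cn] := zero_parts l0.
have [_ _ H] := ext_ofP (cscale l (fin_part x)) (escale_disjoint l x).
apply: (cagree_trans (cagree_le _ H)).
  apply: le_compl => b b0 bc; have bp := le_trans bc cp; have bn := le_trans bc cn.
  move=> /(le_join_hit b0)[b1 [b10 b1b []]] /(le_join_hit b10)[b2 [b20 b21]];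
  rewrite !lexI; have b2b := le_trans b21 b1b.
    by move=> [] /andP[h _]; apply: (le_compl_bot b20 h); apply: le_trans b2b _.
  by move=> [] /andP[h _]; apply: (le_compl_bot b20 h); apply: le_trans b2b _.
apply: ereal_of_agree; rewrite -[cofr A 0](cscale0 (fin_part x : nmcompletion A R^o)).
by apply: cmap2_agree => //; exact: cagree_refl.
Qed.

Lemma gt_eninfP x : gt_eninf x <-> ninf_part x = \bot%O.
Proof.
split=> H.
  by apply/eqP/negPn/negP => x0; apply: (H _ x0); apply/ninf_partP; exact: lexx.
by move=> a a0 /ninf_partP; rewrite H lex0; apply/negP.
Qed.

Lemma nonneg_neg_part l : cle (cofr A 0) l -> neg_part l = \bot%O.
Proof.
move=> /cle_onP l0; apply/eqP/negPn/negP => n0.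
have [c [v [e [c0 _ lv ve]]]] := neg_part_hit n0 (lexx _).
by have := l0 _ _ _ _ _ c0 (lex1 _) (cball_cofr _ _) lv; lra.
Qed.

Lemma escale_gt_eninf l x : cle (cofr A 0) l -> gt_eninf x -> gt_eninf (escale l x).
Proof.
move=> /nonneg_neg_part ln /gt_eninfP xn a a0 H.
have [Hp _ Hf] := ext_ofP (cscale l (fin_part x)) (escale_disjoint l x).
have nE : ((pos_part l `&` ninf_part x) `|` (neg_part l `&` pinf_part x) = \bot)%O.
  by rewrite xn ln meetx0 meet0x joinx0.
have [ap|ap] := meet_neq0P
  ((pos_part l `&` pinf_part x) `|` (neg_part l `&` ninf_part x))%O a0.
  apply: (pinf_not_ninf ap (cagree_le (leIr _ _) Hp)).
  exact: cagree_le (leIl _ _) H.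
apply: (ereal_of_nninf a0 (r := cscale l (fin_part x))).
apply: cagree_trans H; apply: cagree_sym; apply: cagree_le Hf.
by rewrite nE joinx0.
Qed.

End Parts.

(** * Suprema and infima of sets of conditional extended reals *)

Section Completeness.
Context {d : Order.disp_t} {A : completeBooleanType d} {R : realType}.
Implicit Types (a b c : A) (x y z : cereal A R) (s t e : R) (S : set (cereal A R)).
Local Notation ecst := (cconst A (@ext_metric R)).

Lemma ele_anti x y : ele x y -> ele y x -> x = y.
Proof. by move=> /eleP xy /eleP yx; apply: cagree_top; apply: ele_on_anti. Qed.

(** On each piece the levels reached by members of the set on smaller pieces have a real supremum in
    the arctan scale. Constants nearly attaining it are consistent and construct the conditional
    supremum. *)
Lemma esup_exists S : exists m, (forall x, S x -> ele x m) /\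
  (forall m', (forall x, S x -> ele x m') -> ele m m').
Proof.
(* Adding -oo changes no upper bound and makes the suprema below nonempty. *)
pose S' := S `|` [set eninf].
pose T c := [set t : R | exists c' (s : cereal A R) v e, [/\ c' != \bot%O, (c' <= c)%O, S' s,
  cball c' s v e & t <= ext_atan v - e]].
have Tsup c : c != \bot%O -> has_sup (T c).
  move=> c0; split.
    exists (- (pi / 2)), c, eninf, -oo%E, 0; split=> //; [by right|exact: cball_cconst|].
    by rewrite subr0.
  exists (pi / 2) => t [c' [s [v [e [c'0 _ _ sv te]]]]].
  by have := cball_ge0 c'0 sv; have := ext_atan_le v; lra.
(* The second condition makes v an upper bound up to e, the third makes it attained up to e; they
   yield the two halves of the claim. *)
pose N c v e := [/\ 0 <= e,
  forall (s : cereal A R) c' w e', S' s -> c' != \bot%O -> (c' <= c)%O -> cball c' s w e' ->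
    ext_atan w <= ext_atan v + e + e' &
  densely c (fun c' => exists (s : cereal A R) w e', [/\ S' s, cball c' s w e' &
    ext_atan v - e <= ext_atan w - e'])].
have Ncmp c v w e e' : c != \bot%O -> N c v e -> N c w e' ->
    ext_atan v <= ext_atan w + e + e'.
  move=> c0 [_ _ v2] [_ w1 _].
  have [c1 [c10 c1c [s [u [f [Ss su h]]]]]] := v2 c c0 (lexx _).
  by have := w1 _ _ _ _ Ss c10 c1c su; lra.
have Nle c c' v e : (c' <= c)%O -> N c v e -> N c' v e.
  move=> c'c [e0 v1 v2]; split=> //; last exact: denselyW v2.
  by move=> s b w e' Ss b0 bc'; apply: v1 => //; apply: le_trans c'c.
have Ndense c e : 0 < e -> c != \bot%O ->
    exists c' v, [/\ c' != \bot%O, (c' <= c)%O & N c' v e].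
  move=> e0 c0.
  have supT := Tsup c c0.
  have [t [Tt tsup tge]] : exists t, [/\ T c t, sup (T c) - e < t & - (pi / 2) <= t].
    have [t Tt tsup] := sup_adherent e0 supT.
    (* [T c] is closed downwards, so t may lie below the range of the levels; the level of -oo then
       serves instead. *)
    have [tge|tlt] := leP (- (pi / 2)) t; first by exists t.
    exists (- (pi / 2)); split=> //; last exact: lt_trans tlt.
    exists c, eninf, -oo%E, 0; split=> //; [by right|exact: cball_cconst|].
    by rewrite subr0.
  have [c1 [s [w [e' [c10 c1c Ss sw te]]]]] := Tt.
  have [|v vt] := @ext_atan_surj R t tge.
    by have := cball_ge0 c10 sw; have := ext_atan_le w; lra.
  exists c1, v; split=> //; split; first exact: ltW.
    move=> s2 b w2 e2 Ss2 b0 bc1 sw2.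
    have : T c (ext_atan w2 - e2).
      by exists b, s2, w2, e2; split=> //; apply: le_trans c1c.
    by move=> /(sup_upper_bound supT); rewrite vt; lra.
  move=> b b0 bc1; exists b; split=> //; exists s, w, e'; split=> //.
    exact: cball_le sw.
  by rewrite vt; lra.
have Ncons c v w e e' : c != \bot%O -> N c v e -> N c w e' ->
    ext_metric v w <= e + e'.
  move=> c0 Nv Nw; rewrite /= /ext_dist ler_norml.
  have := Ncmp _ _ _ _ _ c0 Nv Nw; have := Ncmp _ _ _ _ _ c0 Nw Nv.
  by move=> ? ?; apply/andP; split; lra.
have [m mN] := cball_construct Nle Ndense Ncons.
exists m; split=> [x Sx|y yub]; apply/eleP => c v w e e' c0 _ h1 h2;
    apply/ler_addgt0Pr => t t0; have t20 : 0 < t / 2 by rewrite divr_gt0.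
  have [c1 [u [c10 c1c Nu]]] := Ndense c _ t20 c0.
  have h3 := cball_ext_cons c10 (mN _ _ _ Nu) (cball_le c1c h2).
  have [_ u1 _] := Nu.
  by have := u1 x c1 v e (or_introl Sx) c10 (lexx _) (cball_le c1c h1); lra.
have [c1 [u [c10 c1c Nu]]] := Ndense c _ t20 c0.
have h3 := cball_ext_cons c10 (cball_le c1c h1) (mN _ _ _ Nu).
have [_ _ u2] := Nu; have [c2 [c20 c21 [s [q [f [Ss sq h4]]]]]] := u2 c1 c10 (lexx _).
have sy : ele_on \top%O s y.
  by case: Ss => [/yub/eleP//|->]; exact: ele_on_ninf.
have := sy _ _ _ _ _ c20 (lex1 _) sq (cball_le (le_trans c21 c1c) h2).
by lra.
Qed.

Lemma esupP S : (forall x, S x -> ele x (esup S)) /\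
  (forall m', (forall x, S x -> ele x m') -> ele (esup S) m').
Proof.
rewrite /esup; case: xgetP => [m -> //|H].
by have [m mP] := esup_exists S; case: (H m).
Qed.

Lemma einfP S : (forall x, S x -> ele (einf S) x) /\
  (forall m', (forall x, S x -> ele m' x) -> ele m' (einf S)).
Proof.
rewrite /einf; case: xgetP => [m -> //|H].
have [m [m1 m2]] := esup_exists [set y | forall x, S x -> ele y x].
case: (H m); split=> [x Sx|y yS]; last exact: m1.
by apply: m2 => y; apply.
Qed.

(** The universal property of [esup] is global, so y is replaced by oo outside c. Dually,
    [einf_ge_on] uses -oo. *)
Lemma esup_le_on c S y : (forall x, S x -> ele_on c x y) -> ele_on c (esup S) y.
Proof.
move=> H; have [z [zy zp]] := concat2P c y (epinf : cereal A R).
apply: ele_on_trans (ele_on_eq zy); apply: ele_on_le (lex1 c) _; apply/eleP.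
apply: (esupP S).2 => x Sx; apply/eleP; apply: ele_on_local => b b0 _.
have [bc|bc] := meet_neq0P c b0.
  exists (b `&` c)%O; split; rewrite ?leIl//.
  apply: (ele_on_trans (ele_on_le (leIr _ _) (H x Sx))).
  exact: ele_on_eq (cagree_sym (cagree_le (leIr _ _) zy)).
exists b; split=> //.
exact: ele_on_trans (@ele_on_pinf _ _ _ b x) (ele_on_eq (cagree_sym (cagree_le bc zp))).
Qed.

Lemma einf_ge_on c S y : (forall x, S x -> ele_on c y x) -> ele_on c y (einf S).
Proof.
move=> H; have [z [zy zn]] := concat2P c y (eninf : cereal A R).
apply: (ele_on_trans (ele_on_eq (cagree_sym zy))); apply: ele_on_le (lex1 c) _; apply/eleP.
apply: (einfP S).2 => x Sx; apply/eleP; apply: ele_on_local => b b0 _.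
have [bc|bc] := meet_neq0P c b0.
  exists (b `&` c)%O; split; rewrite ?leIl//.
  apply: ele_on_trans (ele_on_le (leIr _ _) (H x Sx)).
  exact: ele_on_eq (cagree_le (leIr _ _) zy).
exists b; split=> //.
exact: ele_on_trans (ele_on_eq (cagree_le bc zn)) (@ele_on_ninf _ _ _ b x).
Qed.

Lemma esup_ge_on c S x : S x -> ele_on c x (esup S).
Proof. by move=> Sx; apply: ele_on_le (lex1 c) _; apply/eleP; apply: (esupP S).1. Qed.

Lemma einf_le_on c S x : S x -> ele_on c (einf S) x.
Proof. by move=> Sx; apply: ele_on_le (lex1 c) _; apply/eleP; apply: (einfP S).1. Qed.

(** Different members may approach the supremum on different pieces, so one member is obtained on a
    smaller piece only. *)
Lemma esup_hit c S s t : c != \bot%O -> s < t -> ele_on c (ecst t%:E) (esup S) ->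
  exists c' x, [/\ c' != \bot%O, (c' <= c)%O, S x & ele_on c' (ecst s%:E) x].
Proof.
move=> c0 st tS; apply: contrapT => H; suff : ele_on c (esup S) (ecst s%:E).
  by move=> /(ele_on_trans tS)/(ele_on_cst_fin c0); rewrite leNgt st.
apply: esup_le_on => x Sx; apply: contrapT => /ele_onN[c1 [s1 [t1 [c10 c1c st1 h1 h2]]]].
apply: H; exists c1, x; split=> //; apply: ele_on_trans h2; apply: (ele_on_trans h1).
by apply: ele_on_cst; rewrite ext_atan_fin ltW.
Qed.

Lemma einf_hit c S s t : c != \bot%O -> s < t -> ele_on c (einf S) (ecst s%:E) ->
  exists c' x, [/\ c' != \bot%O, (c' <= c)%O, S x & ele_on c' x (ecst t%:E)].
Proof.
move=> c0 st Ss; apply: contrapT => H; suff : ele_on c (ecst t%:E) (einf S).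
  by move=> /ele_on_trans/(_ Ss)/(ele_on_cst_fin c0); rewrite leNgt st.
apply: einf_ge_on => x Sx; apply: contrapT => /ele_onN[c1 [s1 [t1 [c10 c1c st1 h1 h2]]]].
apply: H; exists c1, x; split=> //; apply: (ele_on_trans h1).
by apply: ele_on_trans h2; apply: ele_on_cst; rewrite ext_atan_fin ltW.
Qed.

End Completeness.

(** * Bounds for absolute values in a weak neighbourhood *)

Section RealBounds.
Context {d : Order.disp_t} {A : completeBooleanType d} {R : realType}.
Implicit Types (a b c : A) (p q r x y : creal A R) (s t e k l : R).

Definition chalf r : creal A R := cscale (cofr A 2^-1) r.

Lemma cball_scale_cofr c t x (v : R) e :
  cball c x v e -> cball c (cscale (cofr A t) x) (t * v) (`|t| * e).
Proof.
move=> xv; have := cball_scale (cball_cofr c t) xv.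
by rewrite mul0r add0r.
Qed.

Lemma cball_addR c x y (v w : R) e e' :
  cball c x v e -> cball c y w e' -> cball c (cadd x y) (v + w) (e + e').
Proof. exact: cball_add. Qed.

Lemma cabs_value c p r u w e e' : c != \bot%O -> cle_on c (cabs p) r ->
  cball c p u e -> cball c r w e' -> `|u| <= w + e + e'.
Proof.
move=> c0 /cle_onP H pu rw.
exact: H c _ _ _ _ c0 (lexx _) (cball_abs pu) rw.
Qed.

Lemma cofr_value c t r w e : c != \bot%O -> cle_on c (cofr A t) r ->
  cball c r w e -> t <= w + e.
Proof.
move=> c0 /cle_onP H rw; have := H c _ _ _ _ c0 (lexx _) (cball_cofr c t) rw.
by rewrite addr0.
Qed.

Lemma small_value c p u k e : c != \bot%O -> cball c p 0 k -> cball c p u e ->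
  `|u| <= k + e.
Proof. by move=> c0 h1 h2; have := cball_cons c0 h1 h2; rewrite /= sub0r normrN. Qed.

Lemma dense3 c x y r e : 0 < e -> c != \bot%O -> exists c' u v w,
  [/\ c' != \bot%O, (c' <= c)%O, cball c' x u e, cball c' y v e & cball c' r w e].
Proof.
move=> e0 c0; have [c1 [u [c10 c1c xu]]] := cball_dense x e0 c0.
have [c2 [v [c20 c21 yv]]] := cball_dense y e0 c10.
have [c3 [w [c30 c32 rw]]] := cball_dense r e0 c20.
exists c3, u, v, w; split=> //; first exact: le_trans (le_trans c32 c21) c1c.
  exact: cball_le (le_trans c32 c21) xu.
exact: cball_le yv.
Qed.

Lemma cle_half c t r : cle_on c (cofr A t) r -> cle_on c (cofr A (t / 2)) (chalf r).
Proof.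
move=> tr; apply: cle_onI => e e0 b b0 bc.
have [b1 [w [b10 b1b rw]]] := cball_dense r e0 b0.
have := cofr_value b10 (cle_on_le (le_trans b1b bc) tr) rw => tw.
exists b1; split=> //; exists (t / 2), (2^-1 * w); split.
- by apply: (cballWr _ (cball_cofr b1 _)); apply: ltW.
- apply: (cballWr _ (cball_scale_cofr (t := 2^-1) rw)).
  by rewrite ger0_norm; lra.
- lra.
Qed.

Lemma clt_half r : clt (cofr A 0) r -> clt (cofr A 0) (chalf r).
Proof.
move=> /clt_cofrP H; apply/clt_cofrP; apply: densely_imp H => c [s s0 sr].
by exists (s / 2); [rewrite divr_gt0|exact: cle_half].
Qed.

Lemma chalf_value c r w e : cball c r w e -> cball c (chalf r) (w / 2) e.
Proof.
(* A ball can have a negative radius only on the zero piece, where the condition is vacuous. *)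
move=> rw; have [->|c0] := eqVneq c \bot%O.
  by move=> e' _; exists (step_const A 0%N) => n _ b z /[swap]; rewrite lex0 => /eqP-> /eqP.
have := cball_ge0 c0 rw => e0.
rewrite mulrC; apply: (cballWr _ (cball_scale_cofr (t := 2^-1) rw)).
by rewrite ger0_norm; lra.
Qed.

Lemma cabs_small_le c p r k s : cball c p 0 k -> k <= s -> cle_on c (cofr A s) r ->
  cle_on c (cabs p) r.
Proof.
move=> pk ks sr; apply: cle_onI => e e0 b b0 bc.
have e20 : 0 < e / 2 by rewrite divr_gt0.
have [b1 [u [_ [w [b10 b1b pu _ rw]]]]] := dense3 p p r e20 b0.
have b1c := le_trans b1b bc.
have h1 := small_value b10 (cball_le b1c pk) pu.
have h2 := cofr_value b10 (cle_on_le b1c sr) rw.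
exists b1; split=> //; exists `|u|, w; split; last by lra.
  by apply: (cballWr _ (cball_abs pu)); lra.
by apply: cballWr rw; lra.
Qed.

Lemma cabs_add_half c p q r : cle_on c (cabs p) (chalf r) ->
  cle_on c (cabs q) (chalf r) -> cle_on c (cabs (cadd p q)) r.
Proof.
move=> pr qr; apply: cle_onI => e e0 b b0 bc.
have e40 : 0 < e / 4 by rewrite divr_gt0.
have [b1 [u [v [w [b10 b1b pu qv rw]]]]] := dense3 p q r e40 b0.
have b1c := le_trans b1b bc.
have h1 := cabs_value b10 (cle_on_le b1c pr) pu (chalf_value rw).
have h2 := cabs_value b10 (cle_on_le b1c qr) qv (chalf_value rw).
exists b1; split=> //; exists `|u + v|, w; split.
- by apply: (cballWr _ (cball_abs (cball_addR pu qv))); lra.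
- by apply: cballWr rw; lra.
- by have := ler_normD u v; lra.
Qed.

(** Fits the right side of [cpairing_comb]: the average of p and q stays within r/2, and the other
    half, at least s/2, absorbs the coefficient error g. *)
Lemma cabs_comb_half c p q g r l k s : 0 <= l <= 1 ->
  cle_on c (cabs p) (chalf r) -> cle_on c (cabs q) (chalf r) ->
  cball c g 0 k -> k <= s / 2 -> cle_on c (cofr A s) r ->
  cle_on c (cabs (cadd (cadd (cscale (cofr A l) p) (cscale (cofr A (1 - l)) q)) g)) r.
Proof.
move=> /andP[l0 l1] pr qr gk ks sr; apply: cle_onI => e e0 b b0 bc.
have e80 : 0 < e / 8 by rewrite divr_gt0.
have [b1 [u [v [w [b10 b1b pu qv rw]]]]] := dense3 p q r e80 b0.
have [b2 [z [b20 b21 gz]]] := cball_dense g e80 b10.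
have b2c := le_trans (le_trans b21 b1b) bc.
move: pu qv rw => /(cball_le b21) pu /(cball_le b21) qv /(cball_le b21) rw.
have h1 := cabs_value b20 (cle_on_le b2c pr) pu (chalf_value rw).
have h2 := cabs_value b20 (cle_on_le b2c qr) qv (chalf_value rw).
have h3 := small_value b20 (cball_le b2c gk) gz.
have h4 := cofr_value b20 (cle_on_le b2c sr) rw.
have l1' : 0 <= 1 - l by rewrite subr_ge0.
exists b2; split; rewrite ?(le_trans b21)//.
exists `|l * u + (1 - l) * v + z|, w; split.
- apply: (cballWr _ (cball_abs (cball_addR (cball_addR (cball_scale_cofr (t := l) pu)
    (cball_scale_cofr (t := 1 - l) qv)) gz))).
  by rewrite !ger0_norm//; lra.
- by apply: cballWr rw; lra.
have := ler_normD (l * u + (1 - l) * v) z.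
have := ler_normD (l * u) ((1 - l) * v).
rewrite !normrM (ger0_norm l0) (ger0_norm l1').
have := ler_wpM2l l0 h1; have := ler_wpM2l l1' h2.
by lra.
Qed.

(** Since t (k + s) <= s, one has t k <= (1 - t) s <= (1 - t) r; together with t r from the first
    summand this is r. *)
Lemma cabs_shrink c p q r k s t : 0 <= t <= 1 ->
  cle_on c (cabs p) r -> cball c q 0 k -> t * (k + s) <= s ->
  cle_on c (cofr A s) r -> cle_on c (cabs (cscale (cofr A t) (cadd p q))) r.
Proof.
move=> /andP[t0 t1] pr qk ts sr; apply: cle_onI => e e0 b b0 bc.
have e80 : 0 < e / 8 by rewrite divr_gt0.
have [b1 [u [v [w [b10 b1b pu qv rw]]]]] := dense3 p q r e80 b0.
have b1c := le_trans b1b bc.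
have h1 := cabs_value b10 (cle_on_le b1c pr) pu rw.
have h3 := small_value b10 (cball_le b1c qk) qv.
have h4 := cofr_value b10 (cle_on_le b1c sr) rw.
have t1' : 0 <= 1 - t by rewrite subr_ge0.
have te : t * (e / 8) <= e / 8 by rewrite ler_piMl// ltW.
exists b1; split=> //; exists `|t * (u + v)|, w; split.
- apply: (cballWr _ (cball_abs (cball_scale_cofr (t := t) (cball_addR pu qv)))).
  by rewrite ger0_norm//; lra.
- by apply: cballWr rw; lra.
rewrite normrM (ger0_norm t0).
have := ler_wpM2l t0 (ler_normD u v).
have := ler_wpM2l t0 h1; have := ler_wpM2l t0 h3; have := ler_wpM2l t1' h4.
by lra.
Qed.

Lemma ccomb_le c p q l s t : 0 <= l <= 1 ->
  cle_on c p (cofr A s) -> cle_on c q (cofr A t) ->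
  cle_on c (cadd (cscale (cofr A l) p) (cscale (cofr A (1 - l)) q))
    (cofr A (l * s + (1 - l) * t)).
Proof.
move=> /andP[l0 l1] /cle_onP ps /cle_onP qt; apply: cle_onI => e e0 b b0 bc.
have [b1 [u [v [_ [b10 b1b pu qv _]]]]] := dense3 p q q e0 b0.
have b1c := le_trans b1b bc; have l1' : 0 <= 1 - l by rewrite subr_ge0.
have h1 := ps _ _ _ _ _ b10 b1c pu (cball_cofr _ _).
have h2 := qt _ _ _ _ _ b10 b1c qv (cball_cofr _ _).
exists b1; split=> //.
exists (l * u + (1 - l) * v), (l * s + (1 - l) * t); split.
- apply: (cballWr _ (cball_addR (cball_scale_cofr (t := l) pu)
    (cball_scale_cofr (t := 1 - l) qv))).
  by rewrite !ger0_norm//; lra.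
- by apply: (cballWr _ (cball_cofr b1 _)); apply: ltW.
have := ler_wpM2l l0 h1; have := ler_wpM2l l1' h2.
by lra.
Qed.

End RealBounds.

(** * Weak neighbourhoods and the extension *)

Section WeakNeighbourhoods.
Context {d : Order.disp_t} {A : completeBooleanType d} {R : realType}.
Context {X Y : normedModType R} (P : dual_pair X Y) (hP : pairing_bounded P).
Implicit Types (a b c : A) (x z : nmcompletion A X) (y : step A nat -> nmcompletion A Y).
Implicit Types (r : creal A R) (n : step A nat) (xi : X).

(** The neighbourhood condition required on c only; at the top it defines the members of [wnbhs]. *)
Definition wn_on c x r n y z : Prop := forall l, initial_seg n l ->
  cle_on c (cabs (cpairing hP (csub z x) (y l))) r.

Lemma wn_on_le b c x r n y z : (b <= c)%O -> wn_on c x r n y z -> wn_on b x r n y z.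
Proof. by move=> bc H l /H; apply: cle_on_le. Qed.

Lemma emb_step_agree c (p : step A X) xi : (c <= p xi)%O -> cagree c (emb_step p) (emb xi).
Proof. exact: cstep_agree_const. Qed.

Lemma wn_on_local c x r n y z : densely c (fun b => wn_on b x r n y z) ->
  wn_on c x r n y z.
Proof.
move=> H l ln; apply: cle_on_local; apply: densely_imp H => b; exact.
Qed.

Lemma wn_on_agree c x x' r n y z z' : cagree c x x' -> cagree c z z' ->
  wn_on c x r n y z -> wn_on c x' r n y z'.
Proof.
move=> xx zz H l /H; apply: cle_on_agree; last exact: cagree_refl.
have pp : cagree c (cpairing hP (csub z x) (y l)) (cpairing hP (csub z' x') (y l)).
  by apply: cmap2_agree (cagree_refl _ _); apply: cmap2_agree.
exact: cmap2_agree.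
Qed.

Lemma wn_on_glue c x r n y z z' w : cagree c w z -> cagree (~` c)%O w z' ->
  wn_on c x r n y z -> wn_on \top%O x r n y z' -> wn_on \top%O x r n y w.
Proof.
move=> wz wz' zV z'V; apply: wn_on_local => b b0 _.
have [bc|bc] := meet_neq0P c b0.
  exists (b `&` c)%O; split; rewrite ?leIl//.
  apply: wn_on_agree (cagree_refl _ _) (cagree_sym (cagree_le (leIr _ _) wz)) _.
  exact: wn_on_le (leIr _ _) zV.
exists b; split=> //.
apply: wn_on_agree (cagree_refl _ _) (cagree_sym (cagree_le bc wz')) _.
exact: wn_on_le (lex1 _) z'V.
Qed.

Lemma csub_self x : cagree \top%O (csub x x) (emb 0).
Proof.
apply: cball_agree => e e0 c c0 _.
have e20 : 0 < e / 2 by rewrite divr_gt0.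
have [b [v [b0 bc xv]]] := cball_dense x e20 c0.
exists b; split=> //; exists 0; last by apply: cballWr (ltW e0) _; exact: cball_cconst.
by have := cball_sub xv xv; rewrite subrr; apply: cballWr; lra.
Qed.

Lemma pairing_small c z (w : nmcompletion A Y) (k m : R) :
  cball c z 0 k -> cball c w 0 m -> cball c (cpairing hP z w) 0 (k * m).
Proof.
move=> zk wm; have := cball_pairing hP zk wm.
by rewrite pairing0l !normr0 add0r mul0r addr0.
Qed.

Lemma cball_bounded (V : normedModType R) (w : nmcompletion A V) c : c != \bot%O ->
  exists c' (m : R), [/\ c' != \bot%O, (c' <= c)%O, 0 <= m & cball c' w 0 m].
Proof.
move=> c0; have [c' [v [c'0 c'c wv]]] := cball_dense w ltr01 c0.
exists c', (1 + `|v|); split=> //.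
by apply: cballW wv; rewrite /= subr0.
Qed.

Lemma wn_on_self x r n y : clt (cofr A 0) r -> wn_on \top%O x r n y x.
Proof.
move=> /clt_cofrP r0 l ln; apply: cle_on_local => c c0 _.
have [c1 [c10 c1c [s s0 sr]]] := r0 c c0 (lex1 _).
have [c2 [m [c20 c21 m0 ym]]] := cball_bounded (y l) c10.
have x0 : cball c2 (csub x x) 0 0.
  apply: cball_cagree (cball_cconst _ _).
  exact: cagree_le (lex1 _) (cagree_sym (csub_self x)).
exists c2; split; rewrite ?(le_trans c21)//.
apply: (cabs_small_le (pairing_small x0 ym) _ (cle_on_le c21 sr)).
by rewrite mul0r ltW.
Qed.

(** One bound for the whole family is what lets a norm estimate control all conditions of a weak
    neighbourhood at once. *)
Lemma wn_bounded n y c : stable_on (initial_seg n) y -> c != \bot%O ->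
  exists c' (m : R), [/\ c' != \bot%O, (c' <= c)%O, 0 <= m &
    forall l, initial_seg n l -> cball c' (y l) 0 m].
Proof.
move=> sy c0.
(* [initial_seg n] is empty as soon as n vanishes on some piece. Otherwise it is
   exhausted on c1 by the finitely many indices [L k], which equal k there. *)
have [[l0 [l01 l0n]]|H] := pselect (exists l, initial_seg n l); last first.
  by exists c, 0; split=> // l ln; case: H; exists l.
have [c1 [N [c10 c1c c1N]]] := step_decide n c0.
(* Membership in the segment is required on all pieces, so [L k] falls back on the member l0 outside
   c1, where n may be below k. *)
have /boolp.choice[L LP] (k : nat) := concat2P c1 (step_const A k) l0.
have LE k b : (b <= c1)%O -> (b <= L k k)%O.
  by move=> bc; apply: (step_agree_le (cagree_sym (LP k).1) bc (step_const_le _ _)).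
have Ln k : (0 < k)%N -> (k <= N)%N -> initial_seg n (L k).
  move=> k0 kN; split; apply/step_relP => b i j b0 _ bi bj.
    rewrite (step_inj b0 bi (step_const_le _ _)).
    have [bc|bc] := meet_neq0P c1 b0.
      by rewrite (step_inj bc (le_trans (leIl _ _) bj) (LE k _ (leIr _ _))).
    have bl := step_agree_le (LP k).2 bc bj.
    move/step_relP: l01 => l01.
    exact: l01 b _ _ b0 (lex1 _) (step_const_le _ _) bl.
  have [bc|bc] := meet_neq0P c1 b0.
    rewrite (step_inj bc (le_trans (leIl _ _) bi) (LE k _ (leIr _ _))).
    by rewrite (step_inj bc (le_trans (leIl _ _) bj) (le_trans (leIr _ _) c1N)).
  have bl := step_agree_le (LP k).2 bc bi.
  by move/step_relP: l0n => l0n; exact: l0n b _ _ b0 (lex1 _) bl bj.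
have [c2 [m [c20 c21 m0 H]]] : exists c' (m : R), [/\ c' != \bot%O, (c' <= c1)%O, 0 <= m &
    forall k, (k < N.+1)%N -> cball c' (y (L k)) 0 m].
  elim: N.+1 => [|j [c' [m [c'0 c'1 m0 H]]]]; first by exists c1, 0.
  have [c2 [m' [c20 c2c m'0 ym]]] := cball_bounded (y (L j)) c'0.
  exists c2, (m + m'); split=> //; [exact: le_trans c'1|exact: addr_ge0|].
  move=> k; rewrite ltnS leq_eqVlt => /predU1P[->|/H{}H].
    by apply: cballWr ym; rewrite lerDr.
  by apply: (cballWr _ (cball_le c2c H)); rewrite lerDl.
exists c2, m; split=> //; first exact: le_trans c1c.
move=> l ln; apply: cball_local => b b0 bc2.
have [b1 [k [b10 b1b b1k]]] := step_decide l b0.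
have b1c1 := le_trans (le_trans b1b bc2) c21.
have [/step_relP lo /step_relP hi] := ln.
have k0 : (0 < k)%N by exact: lo b1 _ _ b10 (lex1 _) (step_const_le _ _) b1k.
have kN : (k <= N)%N by exact: hi b1 _ _ b10 (lex1 _) b1k (le_trans b1c1 c1N).
exists b1; split=> //.
apply: cball_cagree (cball_le (le_trans b1b bc2) (H k kN)).
apply: (stable_on_cagree sy (Ln k k0 kN) ln).
apply/step_agreeP/step_relP => b' i j b'0 b'b1 b'i b'j.
rewrite (step_inj b'0 b'i (LE k _ (le_trans b'b1 b1c1))).
exact: step_inj b'0 (le_trans b'b1 b1k) b'j.
Qed.

(** On a piece where the functionals have norm at most m and r >= s, a constant within s / (m + 1)
    of x satisfies all conditions. Mixing these constants gives an element of X_s in the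
    neighbourhood. *)
Lemma wn_step_dense x r n y : clt (cofr A 0) r -> stable_on (initial_seg n) y ->
  exists p : step A X, wn_on \top%O x r n y (emb_step p).
Proof.
move=> /clt_cofrP r0 sy.
have [c c' z|c c0|p pP] := @mixing_step _ A X (fun c xi => wn_on c x r n y (emb xi)).
- exact: wn_on_le.
- have [c1 [c10 c1c [s s0 sr]]] := r0 c c0 (lex1 _).
  have [c2 [m [c20 c21 m0 ym]]] := wn_bounded sy c10.
  have m1 : 0 < m + 1 by rewrite ltr_wpDl.
  have [c3 [xi [c30 c32 xxi]]] := cball_dense x (divr_gt0 s0 m1) c20.
  exists c3, xi; split=> //; first exact: le_trans (le_trans c32 c21) c1c.
  have zx : cball c3 (csub (emb xi) x) 0 (s / (m + 1)).
    by have := cball_sub (cball_cconst c3 xi) xxi; rewrite subrr add0r.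
  move=> l /ym/(cball_le c32) yl.
  apply: (cabs_small_le (pairing_small zx yl) _ (cle_on_le (le_trans c32 c21) sr)).
  by rewrite mulrAC ler_pdivrMr// ler_wpM2l ?ltW// ltrDl.
exists p; apply: wn_on_local => c c0 _.
have [c1 [xi [c10 c1c c1xi]]] := step_decide p c0.
have [c2 [c20 c21 H]] := pP c1 xi c10 c1xi c1 c10 (lexx _).
exists c2; split; rewrite ?(le_trans c21)//.
apply: wn_on_agree (cagree_refl _ _) _ H; apply: cagree_sym.
exact: emb_step_agree (le_trans c21 c1xi).
Qed.

Lemma wn_on_half x x' r n y z : wn_on \top%O x (chalf r) n y x' ->
  forall c, wn_on c x' (chalf r) n y z -> wn_on c x r n y z.
Proof.
move=> h1 c h2 l ln; rewrite (cpairing_split hP z x' x).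
exact: cabs_add_half (h2 l ln) (cle_on_le (lex1 _) (h1 l ln)).
Qed.

Section Extension.
Variable f : X -> cereal A R.

Lemma step_ext_agree c (p : step A X) xi : (c <= p xi)%O -> cagree c (step_ext f p) (f xi).
Proof. by move=> cp; apply: cagree_le cp (concatP f (step_partition p) xi). Qed.

Definition lsc_ext x : cereal A R :=
  esup [set einf [set step_ext f z | z in [set z | V (emb_step z)]] | V in wnbhs hP x].

Local Notation ecst := (cconst A (@ext_metric R)).

Lemma einf_le_lsc_ext c x V : wnbhs hP x V ->
  ele_on c (einf [set step_ext f z | z in [set z | V (emb_step z)]]) (lsc_ext x).
Proof. by move=> VN; apply: esup_ge_on; exists V. Qed.

(** Turns a bound for the supremum of infima into bounds for f at single points on single pieces. A
    point that satisfies the conditions on b only is glued with an element of X_s in the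
    neighbourhood; the infimum bounds the value at the glued element, which agrees with f xi on
    b. *)
Lemma lsc_ext_hit c x (s t : R) : c != \bot%O -> s < t ->
  ele_on c (ecst t%:E) (lsc_ext x) ->
  exists c' r n y, [/\ c' != \bot%O, (c' <= c)%O, clt (cofr A 0) r,
    stable_on (initial_seg n) y & forall b xi, b != \bot%O -> (b <= c')%O ->
      wn_on b x r n y (emb xi) -> ele_on b (ecst s%:E) (f xi)].
Proof.
move=> c0 st /(esup_hit c0 st)[c' [_ [c'0 c'c [V [r [n [y [r0 sy ->]]]] <-] H]]].
exists c', r, n, y; split=> // b xi b0 bc bV.
have [p pV] := wn_step_dense x r0 sy.
have [q [qxi qp]] := concat2P b (step_const A xi : step A X) p.
have qx : (b <= q xi)%O.
  exact: step_agree_le (cagree_sym qxi) (lexx _) (step_const_le _ _).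
have qpV : wn_on \top%O x r n y (emb_step q).
  apply: wn_on_glue bV pV; first exact: emb_step_agree.
  apply: cball_agree => e e0 b' b'0 b'b.
  have [b1 [v [b10 b1b b1v]]] := step_decide q b'0.
  exists b1; split=> //; exists v; apply: cballWr (ltW e0) _; apply: cball_cstep => //.
  exact: step_agree_le qp (le_trans b1b b'b) b1v.
apply: ele_on_trans (ele_on_eq (step_ext_agree qx)).
apply: (ele_on_trans (ele_on_le bc H)); apply: einf_le_on.
by exists q.
Qed.

(** A converse of [lsc_ext_hit] without loss: an element of X_s is constant on small pieces, so
    bounds at constants bound the infimum. *)
Lemma lsc_ext_ge c x r n y (t : R) : clt (cofr A 0) r -> stable_on (initial_seg n) y ->
  (forall b xi, b != \bot%O -> (b <= c)%O -> wn_on b x r n y (emb xi) ->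
    ele_on b (ecst t%:E) (f xi)) ->
  ele_on c (ecst t%:E) (lsc_ext x).
Proof.
move=> r0 sy H; set V := [set z | wn_on \top%O x r n y z].
have VN : wnbhs hP x V by exists r, n, y.
apply: (ele_on_trans _ (einf_le_lsc_ext VN)).
apply: einf_ge_on => _ [p pV <-]; apply: ele_on_local => b b0 bc.
have [b1 [xi [b10 b1b b1xi]]] := step_decide p b0.
exists b1; split=> //.
apply: ele_on_trans (ele_on_eq (cagree_sym (step_ext_agree b1xi))).
apply: H (le_trans b1b bc) _ => //.
apply: wn_on_agree (cagree_refl _ _) (emb_step_agree b1xi) _.
exact: wn_on_le (lex1 _) pV.
Qed.

Lemma lsc_ext_le_hit c x r n y (s t : R) : c != \bot%O -> s < t ->
  clt (cofr A 0) r -> stable_on (initial_seg n) y ->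
  ele_on c (lsc_ext x) (ecst s%:E) ->
  exists c' xi, [/\ c' != \bot%O, (c' <= c)%O, wn_on c' x r n y (emb xi) &
    ele_on c' (f xi) (ecst t%:E)].
Proof.
move=> c0 st r0 sy xs; set V := [set z | wn_on \top%O x r n y z].
have VN : wnbhs hP x V by exists r, n, y.
have /(einf_hit c0 st)[c1 [_ [c10 c1c [p pV <-] H]]] :=
  ele_on_trans (einf_le_lsc_ext VN) xs.
have [c2 [xi [c20 c21 c2xi]]] := step_decide p c10.
exists c2, xi; split=> //; first exact: le_trans c1c.
  apply: wn_on_agree (cagree_refl _ _) (emb_step_agree c2xi) _.
  exact: wn_on_le (lex1 _) pV.
exact: ele_on_trans (ele_on_eq (cagree_sym (step_ext_agree c2xi))) (ele_on_le c21 H).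
Qed.

(** Neighbourhoods of z and z' differ as sets, but with the same radius and functionals they impose
    the same condition on every piece where z and z' agree. *)
Lemma lsc_ext_stable : stable lsc_ext.
Proof.
apply: cagree_stable => a x x' xx.
have mono z z' : cagree a z z' -> ele_on a (lsc_ext z) (lsc_ext z').
  move=> zz; apply: contrapT => /ele_onN[c [s [t [c0 ca st h1 h2]]]].
  (* [lsc_ext_hit] gives up part of the bound; half of the gap is left for the contradiction. *)
  have mt : (s + t) / 2 < t by lra.
  have [c1 [r [n [y [c10 c1c r0 sy H]]]]] := lsc_ext_hit c0 mt h2.
  have h3 : ele_on c1 (ecst ((s + t) / 2)%:E) (lsc_ext z').
    apply: (lsc_ext_ge r0 sy) => b xi b0 bc bV.
    apply: H => //; apply: wn_on_agree (cagree_refl _ _) bV; apply: cagree_sym.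
    exact: cagree_le (le_trans (le_trans bc c1c) ca) zz.
  by have := ele_on_cst_fin c10 (ele_on_trans h3 (ele_on_le c1c h1)); lra.
by apply: ele_on_anti; apply: mono => //; exact: cagree_sym.
Qed.

Lemma lsc_ext_clsc : clsc hP lsc_ext.
Proof.
move=> x; apply: ele_anti; last first.
  apply: (esupP _).2 => _ [V [r [n [y [r0 sy ->]]]] <-].
  apply: (einfP _).1; exists x => //; exact: wn_on_self.
apply/eleP; apply: contrapT => /ele_onN[c [s [t [c0 _ st h1 h2]]]].
have mt : (s + t) / 2 < t by lra.
have [c1 [r [n [y [c10 c1c r0 sy H]]]]] := lsc_ext_hit c0 mt h2.
pose V := [set z | wn_on \top%O x (chalf r) n y z].
have VN : wnbhs hP x V by exists (chalf r), n, y; split=> //; exact: clt_half.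
have h3 : ele_on c1 (ecst ((s + t) / 2)%:E) (einf (lsc_ext @` V)).
  apply: einf_ge_on => _ [z zV <-]; apply: (lsc_ext_ge (clt_half r0) sy).
  by move=> b xi b0 bc bV; apply: H => //; apply: wn_on_half bV.
have h4 : ele_on c1 (ecst ((s + t) / 2)%:E)
    (esup [set einf (lsc_ext @` V) | V in wnbhs hP x]).
  by apply: (ele_on_trans h3); apply: esup_ge_on; exists V.
have := ele_on_cst_fin c10 (ele_on_trans h4 (ele_on_le c1c h1)); lra.
Qed.

End Extension.

End WeakNeighbourhoods.

(** * Convexity *)

Section Coefficients.
Context {d : Order.disp_t} {A : completeBooleanType d} {R : realType}.
Implicit Types (a b c : A) (l p q : creal A R) (x y : cereal A R) (e s t : R).
Local Notation ecst := (cconst A (@ext_metric R)).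

Lemma le_fin_dom_bounded c (x : cereal A R) t : gt_eninf x -> ele_on c x (ecst t%:E) ->
  (c <= fin_dom x)%O.
Proof.
move=> /gt_eninfP xn xt; apply: le_fin_dom; last by rewrite xn compl0 lex1.
apply: (@le_compl _ _ c (pinf_part x)) => b b0 bc /pinf_partP xp.
exact: pinf_nge b0 xp (ele_on_le bc xt).
Qed.

Lemma fin_or_pinf c (x : cereal A R) : gt_eninf x -> c != \bot%O ->
  (exists c', [/\ c' != \bot%O, (c' <= c)%O & cagree c' x epinf]) \/
  cagree c x (ereal_of (fin_part x)).
Proof.
move=> /gt_eninfP xn c0; have [cp|cp] := meet_neq0P (pinf_part x) c0; [left|right].
  exists (c `&` pinf_part x)%O; split; rewrite ?leIl//.
  by apply/pinf_partP; exact: leIr.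
by apply: cagree_le (fin_partP x); apply: le_fin_dom cp _; rewrite xn compl0 lex1.
Qed.

Lemma agree_fin_nninf c (x : cereal A R) p : cagree c x (ereal_of p) ->
  (c <= ~` ninf_part x)%O.
Proof. by move=> /agree_fin[cx _]; exact: le_trans cx (fin_dom_nninf _). Qed.

(** An approximation of radius e/2 leaves the unit interval by at most e/2, and moving it to the end
    point costs that much again. Convexity of f is available only for reals in the interval. *)
Lemma unit_interval_dense c (l : creal A R) e : 0 < e -> c != \bot%O ->
  cle (cofr A 0) l -> cle l (cofr A 1) ->
  exists c' t, [/\ c' != \bot%O, (c' <= c)%O, 0 <= t <= 1 & cball c' l t e].
Proof.
move=> e0 c0 /cle_onP l0 /cle_onP l1; have e20 : 0 < e / 2 by rewrite divr_gt0.
have [b [t [b0 bc lt]]] := cball_dense l e20 c0.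
have h0 := l0 _ _ _ _ _ b0 (lex1 _) (cball_cofr b 0) lt.
have h1 := l1 _ _ _ _ _ b0 (lex1 _) lt (cball_cofr b 1).
have [t0|t0] := ltP t 0.
  exists b, 0; split; rewrite ?lexx ?ler01//.
  by apply: cballW lt; rewrite /= subr0 ler0_norm; lra.
have [t1|t1] := ltP 1 t.
  exists b, 1; split; rewrite ?lexx ?ler01//.
  by apply: cballW lt; rewrite /= ger0_norm; lra.
by exists b, t; split=> //; [rewrite t0|apply: cballWr lt; lra].
Qed.

(** Positive and zero coefficients must be separated because 0 times oo is 0. *)
Lemma nonneg_split c (l : creal A R) : c != \bot%O -> cle (cofr A 0) l ->
  exists c', [/\ c' != \bot%O, (c' <= c)%O &
    (c' <= pos_part l)%O \/ cagree c' l (cofr A 0)].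
Proof.
move=> c0 l0; have [lc|/cle_onN[c1 [v [w [e [e' [c10 c1c lv wP vw]]]]]]] :=
  pselect (cle_on c l (cofr A 0)).
  exists c; split=> //; right; apply: cle_on_anti => //.
  exact: cle_on_le (lex1 _) l0.
exists c1; split=> //; left; apply: bsup_ub; apply/clt_onP => b b0 bc.
exists b; split=> //; exists w, v, e', e; split; [|exact: cball_le lv|].
  exact: cball_le wP.
by rewrite addrAC.
Qed.

Lemma csub_cofr s t : csub (cofr A s) (cofr A t) = cofr A (s - t).
Proof.
apply: cagree_top; apply: cball_agree => e e0 c c0 _; exists c; split=> //.
exists (s - t); last by apply: cballWr (ltW e0) _; exact: cball_cofr.
by apply: (cballWr _ (cball_sub (cball_cofr c s) (cball_cofr c t))); rewrite addr0 ltW.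
Qed.

Lemma cadd0 (p : creal A R) : cadd (cofr A 0) p = p /\ cadd p (cofr A 0) = p.
Proof.
split; apply: cagree_top; apply: cball_agree => e e0 c c0 _;
  have [b [v [b0 bc pv]]] := cball_dense p e0 c0; exists b; split=> //; exists v => //.
  by have := cball_add (cball_cofr b 0) pv; rewrite !add0r.
by have := cball_add pv (cball_cofr b 0); rewrite !addr0.
Qed.

Lemma cscale1 (p : creal A R) : cscale (cofr A 1) p = p.
Proof.
apply: cagree_top; apply: cball_agree => e e0 c c0 _.
have [b [v [b0 bc pv]]] := cball_dense p e0 c0; exists b; split=> //; exists v => //.
by have := cball_scale (cball_cofr b 1) pv; rewrite scale1r mul0r add0r normr1 mul1r.
Qed.

Lemma csub1_ge0 l : cle l (cofr A 1) -> cle (cofr A 0) (csub (cofr A 1) l).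
Proof.
move=> /cle_onP l1; apply: cle_onI => e e0 c c0 _.
have [b [v [b0 bc lv]]] := cball_dense l e0 c0.
have h := l1 _ _ _ _ _ b0 (lex1 _) lv (cball_cofr b 1).
exists b; split=> //; exists 0, (1 - v); split; last by move: h; lra.
  by apply: (cballWr _ (cball_cofr b 0)); exact: ltW.
by have := cball_sub (cball_cofr b 1) lv; rewrite add0r.
Qed.

Lemma csub1_eq0 c l : cagree c (csub (cofr A 1) l) (cofr A 0) -> cagree c l (cofr A 1).
Proof.
move=> l0; apply: cball_agree => e e0 b b0 bc; have e20 : 0 < e / 2 by rewrite divr_gt0.
have [b1 [v [b10 b1b lv]]] := cball_dense l e20 b0.
have h := cball_cagree (cagree_le (le_trans b1b bc) l0) (cball_sub (cball_cofr b1 1) lv).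
exists b1; split=> //; exists 1; last by apply: (cballWr _ (cball_cofr b1 1)); exact: ltW.
apply: cballW lv; have := cball_cons b10 h (cball_cofr b1 0).
by rewrite /= subr0 distrC; lra.
Qed.

Lemma escale_one c l (x : cereal A R) : gt_eninf x -> cagree c l (cofr A 1) ->
  ele_on c x (escale l x).
Proof.
move=> gx l1; apply: ele_on_local => b b0 bc.
have lb : (b <= pos_part l)%O.
  apply: bsup_ub; apply/clt_onP => b' b'0 b'b; exists b'; split=> //.
  exists 0, 1, 0, 0; split; [exact: cball_cofr| |by rewrite !addr0].
  apply: cball_cagree (cball_cofr _ _); apply: cagree_sym.
  exact: cagree_le (le_trans b'b bc) l1.
have [[b1 [b10 b1b xp]]|xf] := fin_or_pinf gx b0.
  exists b1; split=> //; apply: ele_on_eq; apply: (cagree_trans xp); apply: cagree_sym.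
  by apply: escale_pinf xp; exact: le_trans lb.
exists b; split=> //; apply: ele_on_eq; apply: (cagree_trans xf); apply: cagree_sym.
apply: (cagree_trans (escale_fin l xf)); rewrite -[X in cagree _ _ (ereal_of X)]cscale1.
apply: ereal_of_agree; apply: cmap2_agree; [exact: cagree_le l1|exact: cagree_refl].
Qed.

Lemma eadd_zerol c (x y : cereal A R) : gt_eninf y -> cagree c x (ereal_of (cofr A 0)) ->
  ele_on c y (eadd x y).
Proof.
move=> gy x0; apply: ele_on_local => b b0 bc; have {}x0 := cagree_le bc x0.
have [[b1 [b10 b1b yp]]|yf] := fin_or_pinf gy b0.
  exists b1; split=> //; apply: ele_on_eq; apply: (cagree_trans yp); apply: cagree_sym.
  by apply: (eadd_pinfr yp); apply: agree_fin_nninf (cagree_le b1b x0).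
exists b; split=> //; apply: ele_on_eq; apply: (cagree_trans yf); apply: cagree_sym.
by have := eadd_fin x0 yf; rewrite (cadd0 _).1.
Qed.

Lemma eadd_zeror c (x y : cereal A R) : gt_eninf x -> cagree c y (ereal_of (cofr A 0)) ->
  ele_on c x (eadd x y).
Proof.
move=> gx y0; apply: ele_on_local => b b0 bc; have {}y0 := cagree_le bc y0.
have [[b1 [b10 b1b xp]]|xf] := fin_or_pinf gx b0.
  exists b1; split=> //; apply: ele_on_eq; apply: (cagree_trans xp); apply: cagree_sym.
  by apply: (eadd_pinfl xp); apply: agree_fin_nninf (cagree_le b1b y0).
exists b; split=> //; apply: ele_on_eq; apply: (cagree_trans xf); apply: cagree_sym.
by have := eadd_fin xf y0; rewrite (cadd0 _).2.
Qed.

End Coefficients.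

Section Convexity.
Context {d : Order.disp_t} {A : completeBooleanType d} {R : realType}.
Context {X Y : normedModType R} (P : dual_pair X Y) (hP : pairing_bounded P).
Variable f : X -> cereal A R.
Hypothesis hf : lsc hP f.
Hypothesis cf : proper_convex f.
Implicit Types (a b c : A) (xi : X) (r l : creal A R) (s t : R).
Local Notation ecst := (cconst A (@ext_metric R)).
Local Notation fc := (lsc_ext hP f).

Lemma lsc_ext_emb xi : fc (emb xi) = f xi.
Proof. by rewrite [RHS]hf. Qed.

(** Real upper bounds place both values in their finite domains, since f is never -oo; there the
    extended operations reduce to those of the conditional reals. *)
Lemma convex_le c xi1 xi2 t s1 s2 : 0 <= t <= 1 ->
  ele_on c (f xi1) (ecst s1%:E) -> ele_on c (f xi2) (ecst s2%:E) ->
  ele_on c (f (t *: xi1 + (1 - t) *: xi2)) (ecst (t * s1 + (1 - t) * s2)%:E).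
Proof.
move=> t01 h1 h2; have [gt _ cvx] := cf.
have c1 := le_fin_dom_bounded (gt xi1) h1; have c2 := le_fin_dom_bounded (gt xi2) h2.
have e1 := cagree_le c1 (fin_partP (f xi1)); have e2 := cagree_le c2 (fin_partP (f xi2)).
have /eleP/(ele_on_le (lex1 c)) H := cvx xi1 xi2 t t01.
apply: (ele_on_trans H).
apply: (ele_on_trans (ele_on_eq (eadd_fin (escale_fin _ e1) (escale_fin _ e2)))).
rewrite -ereal_of_cofr; apply/ele_on_fin; apply: ccomb_le => //.
  by apply/ele_on_fin; rewrite ereal_of_cofr; apply: ele_on_trans (ele_on_eq (cagree_sym e1)) h1.
by apply/ele_on_fin; rewrite ereal_of_cofr; apply: ele_on_trans (ele_on_eq (cagree_sym e2)) h2.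
Qed.

(* On a piece where f x0 <= T and f >= -T-1 near x0, the points of a weak
   neighbourhood of x are pulled into the neighbourhood of x0 by a homothety
   with centre x0 and fixed ratio t, so convexity bounds f from below there. *)
Lemma lsc_ext_gt_eninf x : gt_eninf (fc x).
Proof.
have [_ [x0 [r0 fx0]] _] := cf.
move=> a a0 fxn; have [c1 [T [c10 c1a h1 h2]]] := ereal_of_bounded r0 a0.
(* Lower semi-continuity enters here: the lower bound for f x0 becomes one for the extension at x0,
   and so provides a neighbourhood on which f is bounded below. *)
rewrite -fx0 -lsc_ext_emb in h1.
have mT : - T - 1 < - T by rewrite gtrBl.
have [c2 [r [n [y [c20 c21 rpos sy H]]]]] := lsc_ext_hit c10 mT h1.
have [c3 [M [c30 c32 M0 yM]]] := wn_bounded sy c20.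
have /clt_cofrP/(_ c3 c30 (lex1 _))[c4 [c40 c43 [s s0 sr]]] := rpos.
have [c5 [K [c50 c54 K0 xK]]] := cball_bounded (csub x (emb x0)) c40.
have c53 := le_trans c54 c43; have c52 := le_trans c53 c32; have c51 := le_trans c52 c21.
set k := K * M; have k0 : 0 <= k by exact: mulr_ge0.
have ks0 : 0 < k + s by exact: ltr_wpDl.
(* The ratio with t (k + s) = s required by [cabs_shrink]: k bounds the pairings of x - x0 with the
   functionals, and s <= r. *)
pose t := s / (k + s); have t0 : 0 < t by exact: divr_gt0.
have t1 : t <= 1 by rewrite ler_pdivrMr// mul1r lerDr.
have t01 : 0 <= t <= 1 by rewrite ltW.
(* Solves t u + (1 - t) T = - T - 1, so a value of f below u at xi would put the shrunk point below
   the bound near x0. *)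
pose u := (- T - 1 - (1 - t) * T) / t.
suff : ele_on c5 (ecst u%:E) (fc x).
  by apply: ninf_nle c50 (cagree_le (le_trans c51 c1a) fxn).
apply: (lsc_ext_ge rpos sy) => b xi b0 bc5 bV.
apply: contrapT => /ele_onN[b1 [s1 [t1' [b10 b1b st le1 /(ele_on_cst_fin b10) ge1]]]].
have b15 := le_trans b1b bc5.
have wV : wn_on hP b1 (emb x0) r n y (emb (t *: xi + (1 - t) *: x0)).
  move=> l ln; rewrite cpairing_scale (cpairing_split hP (emb xi) x (emb x0)).
  apply: (cabs_shrink t01 (cle_on_le b1b (bV l ln)) (k := k) (s := s)).
  - apply: pairing_small (cball_le b15 xK) _.
    exact: cball_le (le_trans b15 c53) (yM l ln).
  - by rewrite /t mulrAC -mulrA divff ?mulr1// gt_eqF.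
  - exact: cle_on_le (le_trans b15 c54) sr.
have lo := H b1 _ b10 (le_trans b15 c52) wV.
have h2' : ele_on b1 (f x0) (ecst T%:E).
  by rewrite fx0; apply: ele_on_le h2; exact: le_trans b15 c51.
have := ele_on_cst_fin b10 (ele_on_trans lo (convex_le t01 le1 h2')).
have : t * s1 < t * u by rewrite ltr_pM2l// (lt_le_trans st).
have -> : t * u = - T - 1 - (1 - t) * T by rewrite /u mulrC divfK// gt_eqF.
lra.
Qed.

(** A failure leaves a real gap D on some piece. The extension is at least t at the combination,
    while approximation by points of X makes it smaller up to errors below D. *)
Lemma lsc_ext_convex_fin c x x' l p q : c != \bot%O ->
  cle (cofr A 0) l -> cle l (cofr A 1) ->
  cagree c (fc x) (ereal_of p) -> cagree c (fc x') (ereal_of q) ->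
  ele_on c (fc (cadd (cscale l x) (cscale (csub (cofr A 1) l) x')))
    (ereal_of (cadd (cscale l p) (cscale (csub (cofr A 1) l) q))).
Proof.
move=> c0 l0 l1 xp xq; apply: contrapT => /ele_onN[c1 [s [t [c10 c1c st hs ht]]]].
set D := t - s; have D0 : 0 < D by rewrite subr_gt0.
have mt : t - D / 4 < t by rewrite gtrBl divr_gt0.
have [c2 [r [n [y [c20 c21 rpos sy H]]]]] := lsc_ext_hit c10 mt ht.
have [c3 [M [c30 c32 M0 yM]]] := wn_bounded sy c20.
have /clt_cofrP/(_ c3 c30 (lex1 _))[c4 [c40 c43 [s0 s00 sr]]] := rpos.
have [c5 [K [c50 c54 K0 xK]]] := cball_bounded (csub x x') c40.
have [c6 [B1 [c60 c65 B10 pB]]] := cball_bounded p c50.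
have [c7 [B2 [c70 c76 B20 qB]]] := cball_bounded q c60.
(* The losses are D/4 in the lower bound, 2e for the values of f at the two points, e for p and q,
   and at most D/8 for the coefficient: 9D/16 in total. *)
set e := D / 16; have e0 : 0 < e by rewrite divr_gt0.
set k := K * M; have k0 : 0 <= k by exact: mulr_ge0.
set B := B1 + B2 + 4 * e + 1; have B0 : 0 < B by rewrite ltr_wpDl// !addr_ge0// mulr_ge0// ltW.
(* The precision of the coefficient. The first entry keeps the error g k in the pairings within half
   the radius; the second keeps the change in the combination of p and q, at most g B, within
   D/8. *)
set g := Num.min (s0 / 2 / (k + 1)) (D / 8 / B).
have g0 : 0 < g by rewrite lt_min !divr_gt0// ltr_wpDl.
have gk : g * k <= s0 / 2.
  rewrite (@le_trans _ _ (g * (k + 1)))// ?ler_pM2l ?lerDl//.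
  by rewrite -ler_pdivlMr ?ltr_wpDl// ge_min lexx.
have gB : g * B <= D / 8 by rewrite -ler_pdivlMr// ge_min lexx orbT.
have [c8 [u [c80 c87 u01 lu]]] := unit_interval_dense g0 c70 l0 l1.
have [c9 [v [c90 c98 pv]]] := cball_dense p e0 c80.
have [c10' [w [b0 b9 qw]]] := cball_dense q e0 c90.
move: c10' b0 b9 qw => b b0 b9 qw; have b8 := le_trans b9 c98.
have b7 := le_trans b8 c87; have b6 := le_trans b7 c76; have b5 := le_trans b6 c65.
have b4 := le_trans b5 c54; have b3 := le_trans b4 c43; have b2 := le_trans b3 c32.
have b1 := le_trans b2 c21; have bc := le_trans b1 c1c.
have {}pv := cball_le b9 pv; have {}lu := cball_le b8 lu.
have xv : ele_on b (fc x) (ecst (v + e)%:E).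
  apply: (ele_on_trans (ele_on_eq (cagree_le bc xp))).
  by rewrite -ereal_of_cofr; apply/ele_on_fin; exact: (cball_cle pv).2.
have xw : ele_on b (fc x') (ecst (w + e)%:E).
  apply: (ele_on_trans (ele_on_eq (cagree_le bc xq))).
  by rewrite -ereal_of_cofr; apply/ele_on_fin; exact: (cball_cle qw).2.
have ve : v + e < v + 2 * e by lra.
have we : w + e < w + 2 * e by lra.
have [a1 [xi1 [a10 a1b xiV1 f1]]] := lsc_ext_le_hit b0 ve (clt_half rpos) sy xv.
have [a2 [xi2 [a20 a21 xiV2 f2]]] := lsc_ext_le_hit a10 we (clt_half rpos) sy (ele_on_le a1b xw).
have a2b := le_trans a21 a1b.
have wV : wn_on hP a2 (cadd (cscale l x) (cscale (csub (cofr A 1) l) x')) r n y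
    (emb (u *: xi1 + (1 - u) *: xi2)).
  move=> j jn; rewrite cpairing_comb.
  apply: (cabs_comb_half u01 (cle_on_le a21 (xiV1 j jn)) (xiV2 j jn) _ gk).
    have lu0 : cball a2 (csub (cofr A u) l) 0 g.
      by have := cball_sub (cball_cofr a2 u) (cball_le a2b lu); rewrite subrr add0r.
    have := cball_scale lu0 (pairing_small hP (cball_le (le_trans a2b b5) xK)
      (cball_le (le_trans a2b b3) (yM j jn))).
    by rewrite scale0r !normr0 add0r mul0r addr0.
  exact: cle_on_le (le_trans a2b b4) sr.
have lo := H a2 _ a20 (le_trans a2b b2) wV.
have lb := ele_on_cst_fin a20 (ele_on_trans lo (convex_le u01 (ele_on_le a21 f1) f2)).
have lu1 := cball_sub (cball_cofr b 1) lu.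
have rhs := cball_add (cball_scale lu pv) (cball_scale lu1 qw).
have /ele_on_fin/ele_on_trans/(_ (ele_on_le b1 hs)) := (cball_cle rhs).1.
rewrite ereal_of_cofr => /(ele_on_cst_fin b0).
rewrite !regular_scaleE add0r.
have nv : `|v| <= B1 + e by exact: small_value b0 (cball_le b6 pB) pv.
have nw : `|w| <= B2 + e by exact: small_value b0 (cball_le b7 qB) qw.
have gv := ler_wpM2l (ltW g0) nv; have gw := ler_wpM2l (ltW g0) nw.
case/andP: u01 => u0 u1; rewrite (ger0_norm u0) (ger0_norm (_ : 0 <= 1 - u)) ?subr_ge0//.
(* [v] and [w] have type R^o, whose operations lra does not recognize. *)
have key (v' w' : R) : t - D / 4 <= u * (v' + 2 * e) + (1 - u) * (w' + 2 * e) ->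
    g * `|v'| <= g * (B1 + e) -> g * `|w'| <= g * (B2 + e) ->
    u * v' + (1 - u) * w' -
      (g * (`|v'| + e) + u * e + (g * (`|w'| + e) + (1 - u) * e)) <= s -> False.
  move: gB e0 g0; have -> : t = s + D by rewrite /D; lra.
  have -> : D = 16 * e by rewrite /e; lra.
  rewrite /B; clearbody e; lra.
exact: key lb gv gw.
Qed.

(** Where a value is oo and its coefficient positive, the right side is oo. Where that coefficient
    vanishes, the combination agrees with the other point, stability transfers the value, and the
    right side dominates the other summand. The remaining pieces have both values finite. *)
Lemma lsc_ext_cproper_convex : cproper_convex fc.
Proof.
split; first exact: lsc_ext_gt_eninf.
  by have [_ [x0 [r0 fx0]] _] := cf; exists (emb x0), r0; rewrite lsc_ext_emb.
move=> x x' l l0 l1; set z := cadd _ _; set m := csub _ l.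
have m0 : cle (cofr A 0) m by exact: csub1_ge0.
have gx : gt_eninf (fc x) by exact: lsc_ext_gt_eninf.
have gx' : gt_eninf (fc x') by exact: lsc_ext_gt_eninf.
have glx := escale_gt_eninf l0 gx; have gmx := escale_gt_eninf m0 gx'.
apply/eleP/ele_on_local => c c0 _.
have [[c1 [c10 c1c xp]]|xf] := fin_or_pinf gx c0.
  have [c2 [c20 c21 [lp|lz]]] := nonneg_split c10 l0.
    exists c2; split; rewrite ?(le_trans c21)//.
    apply: ele_on_trans (ele_on_eq (cagree_sym (eadd_pinfl _ _))).
    - exact: ele_on_pinf.
    - exact: escale_pinf lp (cagree_le c21 xp).
    - by move/gt_eninfP : gmx => ->; rewrite compl0 lex1.
  exists c2; split; rewrite ?(le_trans c21)//.
  have m1 : cagree c2 m (cofr A 1).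
    have := @csub_cofr _ A R 1 0; rewrite subr0 => <-.
    by apply: cmap2_agree lz; exact: cagree_refl.
  have zx : cagree c2 z x'.
    rewrite -(ccombination0 x x'); apply: cmap2_agree; apply: cmap2_agree => //;
      try exact: cagree_refl.
    by apply: cmap2_agree lz; exact: cagree_refl.
  apply: (ele_on_trans (ele_on_eq (stable_cagree (@lsc_ext_stable _ _ _ _ _ _ hP f) zx))).
  apply: (ele_on_trans (escale_one gx' m1)).
  by apply: eadd_zerol gmx _; exact: escale_zero.
have [[c1 [c10 c1c xp]]|xf'] := fin_or_pinf gx' c0.
  have [c2 [c20 c21 [lp|lz]]] := nonneg_split c10 m0.
    exists c2; split; rewrite ?(le_trans c21)//.
    apply: ele_on_trans (ele_on_eq (cagree_sym (eadd_pinfr _ _))).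
    - exact: ele_on_pinf.
    - exact: escale_pinf lp (cagree_le c21 xp).
    - by move/gt_eninfP : glx => ->; rewrite compl0 lex1.
  exists c2; split; rewrite ?(le_trans c21)//.
  have l1' := csub1_eq0 lz.
  have zx : cagree c2 z x.
    rewrite -(ccombination1 x x'); apply: cmap2_agree; apply: cmap2_agree => //;
      try exact: cagree_refl.
    by apply: cmap2_agree l1'; exact: cagree_refl.
  apply: (ele_on_trans (ele_on_eq (stable_cagree (@lsc_ext_stable _ _ _ _ _ _ hP f) zx))).
  apply: (ele_on_trans (escale_one gx l1')).
  by apply: eadd_zeror glx _; exact: escale_zero.
exists c; split=> //.
apply: ele_on_trans (lsc_ext_convex_fin c0 l0 l1 xf xf') _.
apply: ele_on_eq; apply: cagree_sym.
exact: eadd_fin (escale_fin l xf) (escale_fin m xf').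
Qed.

End Convexity.

Theorem theorem3p5 (d : Order.disp_t) (A : completeBooleanType d)
    (R : realType) (X Y : normedModType R) (P : dual_pair X Y)
    (hP : pairing_bounded P)
    (hX : sigmaXY_closed P [set x : X | `|x| <= 1])
    (hY : sigmaYX_closed P [set y : Y | `|y| <= 1])
    (f : X -> cereal A R) (hf : lsc hP f) :
  exists fc : nmcompletion A X -> cereal A R,
    [/\ stable fc,
        clsc hP fc,
        forall x : X, fc (emb x) = f x &
        proper_convex f -> cproper_convex fc].
Proof.
exists (lsc_ext hP f); split.
- exact: lsc_ext_stable.
- exact: lsc_ext_clsc.
- exact: lsc_ext_emb hf.
- exact: lsc_ext_cproper_convex hf.
Qed.
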